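(* Let $p$ be a Gibbs distribution with a known factor graph $\mathsf{C}$ having $N$ factors, $n$ variables, and $\bar\nu=O(1)$, such that $p$ corresponds to the Pauli error rates for a quantum channel. Suppose that this noisy channel is GTM, $\tfrac12$-weak, $\tfrac12$-stable, and that the spectral gaps $\Delta_{\bar C}$ are of constant order (bounded below by a positive constant). Then there exists a canonical estimator $q$ such that for all sufficiently small $\epsilon>0$, using $T$ samples with $$T=O\Big(\frac{N^2}{G^2\epsilon^2}\log\Big(\frac N\delta\Big)\Big)$$ we have, with probability at least $1-\delta$, $$\|p-q\|_1\le\epsilon\,r^\star .$$ Moreover, an estimate proportional to $q$ can be found in time $\mathrm{poly}(n)$.
   Context: Pauli labels. Let $d=2^n$. $\mathsf{P}^n$ denotes the $n$-qubit Pauli group modulo phases, identified with $\mathbb{Z}_2^{2n}$: $a=(a_x,a_z)$ labels the Hermitian matrix $P_a=i^{a_x\cdot a_z}X[a_x]Z[a_z]$, where $A[v]=\bigotimes_iA^{v_i}$. Let $\langle a,b\rangle=a_x\cdot b_z+a_z\cdot b_x\bmod2$. An element of $\mathsf{P}^n$ is also written $\boldsymbol x=(x_1,\dots,x_n)$, where the variable $x_j$ is its $j$th single-qubit Pauli tensor factor; $\boldsymbol 0$ is the identity Pauli, used as the fixed reference assignment. A stabilizer group is a subgroup $\mathsf{S}\subseteq\mathsf{P}^n$ on which $\langle\cdot,\cdot\rangle$ vanishes; $\mathsf{C_S}=\{a:\langle a,s\rangle=0\ \forall s\in\mathsf{S}\}$, $\mathsf{A_S}=\mathsf{P}^n/\mathsf{C_S}$.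 Write $|a)=d^{-1/2}P_a$ with $(A|B)=\mathrm{Tr}(A^\dagger B)$; channels act as superoperators; $\mathcal{P}_a(M)=P_aMP_a^\dagger$. Noise model. GTM (gate-independent, time-stationary, Markovian) means: there is a fixed completely positive trace-preserving map $\Lambda$ such that the noisy implementation of every Pauli gate $\mathcal{P}_a$ is, at every time, $\mathcal{P}_a\Lambda$, and for each stabilizer group $\mathsf{S}$ the noisy preparation of its stabilizer state is a fixed density operator $\tilde\rho_{\mathsf{S},0}$ and its noisy syndrome measurement a fixed POVM $\{\tilde E_{\mathsf{S},b}:b\in\mathsf{A_S}\}$. Pauli eigenvalues: $f_a=(a|\Lambda|a)$. Pauli error rates: $p(a)=4^{-n}\sum_b(-1)^{\langle a,b\rangle}f_b$. $\tfrac12$-weak: $f_a\in[\tfrac12,1]$ for all $a$. $\tfrac12$-stable: each SPAM (state preparation and measurement) parameter $A_h=\sum_{b\in\mathsf{A_S}}(-1)^{\langle h,b\rangle}(\tilde E_{\mathsf{S},b}|h)(h|\Lambda|\tilde\rho_{\mathsf{S},0})$, $h\in\mathsf{S}$, satisfies $A_h\ge\tfrac12$. For a set $B$ of qubits, $\Delta_B=1-\max|f_a|$ over nonzero $a\in\mathsf{P}^n$ acting trivially on all qubits outside $B$ (the spectral gap of the marginal channel). Samples. One sample is one run of the following experiment for a stabilizer group $\mathsf{S}$ and sequence length $m$: prepare $\tilde\rho_{\mathsf{S},0}$; for $i=0,\dots,m$ apply a noisy Pauli gate $P_{a_i}$ with $a_i\in\mathsf{P}^n$ uniformly random; perform the noisy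 syndrome measurement of $\mathsf{S}$ with outcome $b$; return the class of $b+\sum_ia_i$ in $\mathsf{A_S}$. Gibbs random fields. A factor graph $\mathsf{C}=\{C_k\}$ is given by factors $C_k\subseteq\{1,\dots,n\}$. A Gibbs random field (Gibbs distribution) with factor graph $\mathsf{C}$ is a probability distribution $p(\boldsymbol x)=\frac1Z\prod_k\phi_k(\boldsymbol x_{C_k})$ with strictly positive $\phi_k$, where $\boldsymbol x_C=(x_j)_{j\in C}$. The Markov blanket of $S\subseteq\{1,\dots,n\}$ is $\partial S=\bigcup\{C_k:C_k\cap S\ne\emptyset\}\setminus S$ and its closure is $\bar S=S\cup\partial S$. $p(\boldsymbol x_S)$ denotes marginals and $p(\cdot|\cdot)$ conditionals. $\mathsf{C}^*=\bigcup_k2^{C_k}\setminus\{\emptyset\}$ is the set of factors and subfactors. $\bar\nu=\max_{C}|\bar C|$. Canonical estimator. One has $p(\boldsymbol x)=p(\boldsymbol 0)\prod_{D\in\mathsf{C}^*}\phi_D(\boldsymbol x_D)$ with canonical factor potentials $\log\phi_D(\boldsymbol x_D)=\sum_{S\subseteq D}(-1)^{|D|-|S|}\log p(\boldsymbol x_S|\boldsymbol 0_{\partial S})$. A canonical estimator of $p$ is a distribution $q$ obtained by substituting empirical estimates $\{\hat p_{\bar C}:C\in\mathsf{C}^*\}$ of the marginals $p(\boldsymbol x_{\bar C})$ into these expressions, i.e. replacing $p(\boldsymbol x_S|\boldsymbol 0_{\partial S})$ by $\hat p_{\bar S}(\boldsymbol x_S|\boldsymbol 0_{\partial S})$, and normalizing.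 Parameters. $G=G(p,q)=\min_{\boldsymbol x_C}\sqrt{p(\boldsymbol x_C|\boldsymbol 0_{\partial C})\,q(\boldsymbol x_C|\boldsymbol 0_{\partial C})}$, the minimum being over every factor or subfactor $C$ and all values of $\boldsymbol x_C$. $r^\star=\max_C\|\boldsymbol 1_I-p(\boldsymbol x_{\bar C})\|_\infty$, where $\boldsymbol 1_I$ is the point mass on the identity Pauli.
   Formalization: ''Time poly(n)'' is stated as poly(n) times T, up to powers of log T, since the T samples must be read and T grows as ε tends to 0; δ ranges over (0, δ_max] for any fixed δ_max < 1, with constants depending on δ_max, since for N = 1 the bound on T vanishes as δ tends to 1. *)

(* Defs.v *)
From HB Require Import structures.
From mathcomp Require Export all_boot all_order all_algebra complex.
From mathcomp Require Export reals sequences exp.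

Set Implicit Arguments.
Unset Strict Implicit.
Unset Printing Implicit Defensive.

Import Order.TTheory GRing.Theory Num.Theory.
Local Open Scope ring_scope.
Local Open Scope complex_scope.

(** * Pauli labels *)

(** [a j] is the [j]-th tensor factor of [a], as the pair [(a_x j, a_z j)]. *)
Notation pauli n := {ffun 'I_n -> ('Z_2 * 'Z_2)%type}.

Definition symp n (a b : pauli n) : 'Z_2 :=
  \sum_j ((a j).1 * (b j).2 + (a j).2 * (b j).1).

Definition sgn_symp (R : realType) n (a b : pauli n) : R :=
  (-1) ^+ (symp a b : nat).

(** The assignment [x_B], as a label that is the identity outside [B]. *)
Definition restr n (B : {set 'I_n}) (x : pauli n) : pauli n :=
  [ffun j => if j \in B then x j else 0].

(** * Operators on n qubits *)

(** Rows and columns are indexed by computational basis states via [enum_val];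
    [#|basis n| = 2 ^ n]. *)
Notation basis n := {ffun 'I_n -> 'I_2}.
Notation op R n := 'M[complex R]_(#|basis n|).
Notation ket R n := 'cV[complex R]_(#|basis n|).

Definition adj (R : realType) m n (A : 'M[R[i]]_(m, n)) : 'M[R[i]]_(n, m) :=
  (map_mx Num.conj A)^T.

Definition tensor (R : realType) n (A : 'I_n -> 'M[R[i]]_2) : op R n :=
  \matrix_(u, v) \prod_(j < n) A j ((enum_val u : basis n) j) ((enum_val v : basis n) j).

Definition pauliX (R : realType) : 'M[R[i]]_2 :=
  \matrix_(u, v) (u != v)%:R.
Definition pauliZ (R : realType) : 'M[R[i]]_2 :=
  \matrix_(u, v) ((u == v)%:R * (-1) ^+ (u : nat)).

(** [a_x . a_z] is computed in the natural numbers, so that [pauli_op a] is the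
    tensor product of the matrices I, X, Y, Z. *)
Definition pauli_op (R : realType) n (a : pauli n) : op R n :=
  'i ^+ (\sum_(j < n) (a j).1 * (a j).2)%N *:
    (tensor (fun j => iter (a j).1 (mulmx (pauliX R)) 1%:M)
     *m tensor (fun j => iter (a j).2 (mulmx (pauliZ R)) 1%:M)).

Definition hs (R : realType) n (A B : op R n) : R[i] := \tr (adj A *m B).

(** The normalized Pauli [ |a) = d^(-1/2) P_a ], with [d = 2 ^ n]. *)
Definition pauli_ket (R : realType) n (a : pauli n) : op R n :=
  ((Num.sqrt ((2 ^ n)%:R : R))^-1)%:C *: pauli_op R a.

(** [0 <= z] in [R[i]] means that [z] is real and nonnegative. *)
Definition psd (R : realType) n (A : op R n) : Prop :=
  forall v : ket R n, 0 <= (adj v *m A *m v) 0 0.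

Definition block_psd (R : realType) n k (A : 'I_k -> 'I_k -> op R n) : Prop :=
  forall v : 'I_k -> ket R n,
    0 <= \sum_i \sum_j (adj (v i) *m A i j *m v j) 0 0.

(** Positivity of [id_k (x) L] for every [k]; an operator on the tensor product
    of [C^k] with the n-qubit space is given by its blocks. *)
Definition completely_positive (R : realType) n (L : op R n -> op R n) : Prop :=
  forall k (A : 'I_k -> 'I_k -> op R n),
    block_psd A -> block_psd (fun i j => L (A i j)).

Definition trace_preserving (R : realType) n (L : op R n -> op R n) : Prop :=
  forall A, \tr (L A) = \tr A.

Definition density_op (R : realType) n (A : op R n) : Prop :=
  psd A /\ \tr A = 1.

(** * Stabilizer groups and syndromes *)

Definition stabilizer_group n (S : {set pauli n}) : Prop :=
  [/\ 0 \in S, {in S &, forall a b, a + b \in S}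
    & {in S &, forall a b, symp a b = 0}].

Definition centralizer n (S : {set pauli n}) : {set pauli n} :=
  [set a | [forall s in S, symp a s == 0]].

Definition syndrome_class n (S : {set pauli n}) (a : pauli n) : {set pauli n} :=
  [set a + c | c in centralizer S].

(** The quotient [A_S] of all labels by the centralizer of [S], as the set of
    cosets. *)
Definition syndromes n (S : {set pauli n}) : {set {set pauli n}} :=
  [set syndrome_class S a | a : pauli n].

Definition rep n (b : {set pauli n}) : pauli n := odflt 0 [pick a in b].

Definition povm (R : realType) n (S : {set pauli n})
    (E : {set pauli n} -> op R n) : Prop :=
  (forall b, b \in syndromes S -> psd (E b)) /\
  \sum_(b in syndromes S) E b = 1%:M.

(** * Noise model *)

(** The noisy implementation of the Pauli gate [P_a] is [L] followed by
    conjugation by [pauli_op a], at every time; [rho S] and [E S] are the noisy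
    preparation and the noisy syndrome measurement for [S]. *)
Definition gtm (R : realType) n (L : op R n -> op R n)
    (rho : {set pauli n} -> op R n)
    (E : {set pauli n} -> {set pauli n} -> op R n) : Prop :=
  [/\ completely_positive L, trace_preserving L
    & forall S, stabilizer_group S -> density_op (rho S) /\ povm S (E S)].

(** For completely positive [L], positive [rho S] and positive [E S b], the
    complex numbers below are real, so taking real parts loses nothing. *)
Definition pauli_eigenvalue (R : realType) n (L : op R n -> op R n)
    (a : pauli n) : R :=
  complex.Re (hs (pauli_ket R a) (L (pauli_ket R a))).

Definition pauli_error_rate (R : realType) n (L : op R n -> op R n)
    (a : pauli n) : R :=
  ((4 ^ n)%:R)^-1 * \sum_(b : pauli n) sgn_symp R a b * pauli_eigenvalue L b.

Definition spam (R : realType) n (L : op R n -> op R n)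
    (rho : {set pauli n} -> op R n)
    (E : {set pauli n} -> {set pauli n} -> op R n)
    (S : {set pauli n}) (h : pauli n) : R :=
  \sum_(b in syndromes S) sgn_symp R h (rep b) *
    complex.Re (hs (E S b) (pauli_ket R h) * hs (pauli_ket R h) (L (rho S))).

Definition half_weak (R : realType) n (L : op R n -> op R n) : Prop :=
  forall a : pauli n, 2^-1 <= pauli_eigenvalue L a <= 1.

Definition half_stable (R : realType) n (L : op R n -> op R n)
    (rho : {set pauli n} -> op R n)
    (E : {set pauli n} -> {set pauli n} -> op R n) : Prop :=
  forall S, stabilizer_group S -> {in S, forall h, 2^-1 <= spam L rho E S h}.

(** The maximum over an empty set of labels is taken to be 0. *)
Definition spectral_gap (R : realType) n (L : op R n -> op R n)
    (B : {set 'I_n}) : R :=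
  1 - \big[Num.max/0]_(a : pauli n | (a != 0) && (restr B a == a))
        `|pauli_eigenvalue L a|.

(** * Samples *)

(** Probability that one run for the group [S] and sequence length [m] returns
    the class [c]: average over the [m + 1] uniformly random Pauli gates, of
    which the first entry of the tuple is applied first. *)
Definition sample_prob (R : realType) n (L : op R n -> op R n)
    (rho : {set pauli n} -> op R n)
    (E : {set pauli n} -> {set pauli n} -> op R n)
    (S : {set pauli n}) (m : nat) (c : {set pauli n}) : R :=
  ((4 ^ n)%:R ^+ m.+1)^-1 *
  \sum_(a : m.+1.-tuple (pauli n))
    \sum_(b in syndromes S | [set x + \sum_(i < m.+1) tnth a i | x : pauli n in b] == c)
      complex.Re (hs (E S b)
        (foldl (fun M g => pauli_op R g *m L M *m adj (pauli_op R g))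
               (rho S) a)).

(** The settings of one run: generators of the stabilizer group and the
    sequence length. *)
Record setting (n : nat) := Setting { gens : seq (pauli n); len : nat }.

Definition stab_span n (g : seq (pauli n)) : {set pauli n} :=
  foldr (fun (a : pauli n) (S : {set pauli n}) => S :|: [set a + s | s in S])
        [set (0 : pauli n)] g.

(** The classes returned by [T] independent runs. *)
Notation outcomes n T := {ffun 'I_T -> {set pauli n}}.

Definition possible_outcomes n T (s : 'I_T -> setting n)
    (w : outcomes n T) : Prop :=
  forall t, w t \in syndromes (stab_span (gens (s t))).

Definition prob (R : realType) n (L : op R n -> op R n)
    (rho : {set pauli n} -> op R n)
    (E : {set pauli n} -> {set pauli n} -> op R n)
    T (s : 'I_T -> setting n) (event : pred (outcomes n T)) : R :=
  \sum_(w : outcomes n T | event w)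
    \prod_(t < T) sample_prob L rho E (stab_span (gens (s t))) (len (s t)) (w t).

(** * Gibbs random fields *)

Definition gibbs (R : realType) n (C : {set {set 'I_n}}) (p : pauli n -> R) :
    Prop :=
  exists phi : {set 'I_n} -> pauli n -> R,
    (forall D x, 0 < phi D x) /\
    (forall x, p x = (\prod_(D in C) phi D (restr D x)) /
                     (\sum_y \prod_(D in C) phi D (restr D y))).

Definition blanket n (C : {set {set 'I_n}}) (S : {set 'I_n}) : {set 'I_n} :=
  (\bigcup_(D in C | D :&: S != set0) D) :\: S.

(** The closure of [S] under its Markov blanket. *)
Definition mb_closure n (C : {set {set 'I_n}}) (S : {set 'I_n}) : {set 'I_n} :=
  S :|: blanket C S.

Definition subfactors n (C : {set {set 'I_n}}) : {set {set 'I_n}} :=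
  (\bigcup_(D in C) powerset D) :\ set0.

(** The marginal on [B], evaluated at the assignment [y] of [B]; it is carried
    by the labels that are the identity outside [B]. *)
Definition marginal (R : realType) n (p : pauli n -> R) (B : {set 'I_n})
    (y : pauli n) : R :=
  \sum_(x | restr B x == y) p x.

(** [p(x_S | 0_B)] for disjoint [S] and [B]. *)
Definition cond0 (R : realType) n (p : pauli n -> R) (S B : {set 'I_n})
    (x : pauli n) : R :=
  marginal p (S :|: B) (restr S x) / marginal p B 0.

(** Strictly positive probability distributions of [x_B]. *)
Definition local_distribution (R : realType) n (B : {set 'I_n})
    (r : pauli n -> R) : Prop :=
  [/\ forall y, restr B y = y -> 0 < r y,
      forall y, restr B y <> y -> r y = 0
    & \sum_y r y = 1].

(** * Canonical estimator *)

(** [phat B] is the estimate of the marginal on [B]. *)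
Definition log_potential (R : realType) n (C : {set {set 'I_n}})
    (phat : {set 'I_n} -> pauli n -> R) (D : {set 'I_n}) (x : pauli n) : R :=
  \sum_(S in powerset D)
    (-1) ^+ (#|D| - #|S|)%N *
    ln (cond0 (phat (mb_closure C S)) S (blanket C S) x).

Definition canonical_weight (R : realType) n (C : {set {set 'I_n}})
    (phat : {set 'I_n} -> pauli n -> R) (x : pauli n) : R :=
  \prod_(D in subfactors C) expR (log_potential C phat D x).

Definition canonical (R : realType) n (C : {set {set 'I_n}})
    (phat : {set 'I_n} -> pauli n -> R) (x : pauli n) : R :=
  canonical_weight C phat x / \sum_y canonical_weight C phat y.

Definition l1dist (R : realType) n (p q : pauli n -> R) : R :=
  \sum_x `|p x - q x|.

(** All values are at most 1, so the initial value 1 of the minimum only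
    matters when there are no subfactors. *)
Definition Gparam (R : realType) n (C : {set {set 'I_n}})
    (p q : pauli n -> R) : R :=
  \big[Num.min/1]_(D in subfactors C) \big[Num.min/1]_(x : pauli n)
    Num.sqrt (cond0 p D (blanket C D) x * cond0 q D (blanket C D) x).

Definition rstar (R : realType) n (C : {set {set 'I_n}}) (p : pauli n -> R) :
    R :=
  \big[Num.max/0]_(D in C) \big[Num.max/0]_(y : pauli n)
    `|(y == 0)%:R - marginal p (mb_closure C D) y|.

(** * Running time *)

(** First-order recursive programs over binary trees with natural-number
    leaves.  Tree operations, variable access, branching and calls cost one
    step, arithmetic is charged the bit length of its operands (logarithmic
    cost criterion), so that polynomial time is the usual notion. *)
Inductive data := Leaf of nat | Node of data & data.

Inductive arith := OAdd | OSub | OMul | ODiv | OLeq.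

Inductive expr :=
| Var of nat
| Const of nat
| Cons of expr & expr
| Fst of expr
| Snd of expr
| IsPair of expr
| Arith of arith & expr & expr
| Ite of expr & expr & expr
| Let of expr & expr
| Call of nat & expr.

(** The [f]-th entry is the body of the function [f]; its only variable is its
    argument. *)
Definition program := seq expr.

Definition arith_fun (o : arith) (a b : nat) : nat :=
  match o with
  | OAdd => (a + b)%N
  | OSub => (a - b)%N
  | OMul => (a * b)%N
  | ODiv => (a %/ b)%N
  | OLeq => (a <= b)%N
  end.

Definition bitlen (a : nat) : nat := (trunc_log 2 a).+1.

Definition leaf (v : data) : nat := if v is Leaf a then a else 0%N.
Definition fst_data (v : data) : data := if v is Node a _ then a else Leaf 0.
Definition snd_data (v : data) : data := if v is Node _ b then b else Leaf 0.
Definition is_pair (v : data) : bool := if v is Node _ _ then true else false.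
Definition is_true_data (v : data) : bool := if v is Leaf 0 then false else true.

(** [eval P env e v t]: in the environment [env], indexed from the innermost
    binder, [e] evaluates to [v] in [t] steps. *)
Inductive eval (P : program) : seq data -> expr -> data -> nat -> Prop :=
| EvalVar env i : eval P env (Var i) (nth (Leaf 0) env i) 1
| EvalConst env a : eval P env (Const a) (Leaf a) 1
| EvalCons env e1 e2 v1 v2 t1 t2 :
    eval P env e1 v1 t1 -> eval P env e2 v2 t2 ->
    eval P env (Cons e1 e2) (Node v1 v2) (t1 + t2).+1
| EvalFst env e v t :
    eval P env e v t -> eval P env (Fst e) (fst_data v) t.+1
| EvalSnd env e v t :
    eval P env e v t -> eval P env (Snd e) (snd_data v) t.+1
| EvalIsPair env e v t :
    eval P env e v t -> eval P env (IsPair e) (Leaf (is_pair v)) t.+1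
| EvalArith env o e1 e2 v1 v2 t1 t2 :
    eval P env e1 v1 t1 -> eval P env e2 v2 t2 ->
    eval P env (Arith o e1 e2) (Leaf (arith_fun o (leaf v1) (leaf v2)))
      (t1 + t2 + bitlen (leaf v1) + bitlen (leaf v2))
| EvalIte env e e1 e2 v w t s :
    eval P env e v t ->
    eval P env (if is_true_data v then e1 else e2) w s ->
    eval P env (Ite e e1 e2) w (t + s).+1
| EvalLet env e1 e2 v w t s :
    eval P env e1 v t -> eval P (v :: env) e2 w s ->
    eval P env (Let e1 e2) w (t + s).+1
| EvalCall env f e v w t s :
    eval P env e v t -> eval P [:: v] (nth (Const 0) P f) w s ->
    eval P env (Call f e) w (t + s).+1.

Definition runs (P : program) (input output : data) (t : nat) : Prop :=
  eval P [:: input] (nth (Const 0) P 0) output t.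

Definition enc_list A (f : A -> data) (s : seq A) : data :=
  foldr (fun x v => Node (f x) v) (Leaf 0) s.

Definition enc_letter (u : 'Z_2 * 'Z_2) : data := Leaf (u.1 + 2 * u.2)%N.

Definition enc_pauli n (a : pauli n) : data :=
  enc_list (fun j => enc_letter (a j)) (enum 'I_n).

Definition enc_set n (D : {set 'I_n}) : data :=
  enc_list (fun j : 'I_n => Leaf j) (enum D).

(** The input of the classical processing: the number of qubits, the factor
    graph, and the list of all settings and returned classes, a class being
    given by a representative. *)
Definition enc_input n (C : {set {set 'I_n}}) T (s : 'I_T -> setting n)
    (w : outcomes n T) : data :=
  Node (Leaf n) (Node (enc_list (@enc_set n) (enum C))
    (enc_list (fun t : 'I_T =>
        Node (enc_list (@enc_pauli n) (gens (s t)))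
             (Node (Leaf (len (s t))) (enc_pauli (rep (w t)))))
      (enum 'I_T))).

(** A tabulated local factor: its scope, and for each listed assignment of the
    scope a value given as numerator and denominator. *)
Definition table (n : nat) : Type :=
  (seq 'I_n * seq (seq ('Z_2 * 'Z_2) * (nat * nat)))%type.

Definition enc_table n (f : table n) : data :=
  Node (enc_list (fun j : 'I_n => Leaf j) f.1)
       (enc_list (fun r : seq ('Z_2 * 'Z_2) * (nat * nat) =>
                    Node (enc_list enc_letter r.1) (Node (Leaf r.2.1) (Leaf r.2.2)))
                 f.2).

(** Looks up the row of [x]; the value is 0 when there is none. *)
Definition table_value (R : realType) n (f : table n) (x : pauli n) : R :=
  let y := [seq x j | j <- f.1] in
  let r := nth (0%N, 0%N) (unzip2 f.2) (index y (unzip1 f.2)) in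
  r.1%:R / r.2%:R.

(** [fs] is a factorized description of a function proportional to [q]. *)
Definition describes_proportional (R : realType) n (fs : seq (table n))
    (q : pauli n -> R) : Prop :=
  exists2 c : R, 0 < c & forall x, \prod_(f <- fs) table_value R f x = c * q x.

(* Main.v *)
(** Conjugation by the uniformly random Pauli gates twirls the noise, so that the
    expectation of [(-1) ^ <h, c>] over the class [c] returned by a run with sequence
    length [m] is [A_h * f_h ^ m].  Lengths 0 and 1 suffice: the ratio of the two
    empirical means estimates [f_h], because [A_h] and [f_h] are at least 1/2.

    Colour the qubits with boundedly many colours so that each closure of a factor has
    distinctly coloured qubits, and let all assignments of Pauli letters to colours take
    turns as measurement bases.  Every label supported on a closure is then measured by
    a constant fraction of the runs, and Chernoff and union bounds estimate all these
    [f_h] at once.  Fourier inversion on the closures gives the marginals [p_B].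

    By Markov property and Moebius inversion [p] is its own canonical product
    (Hammersley-Clifford), and [p_B >= G/2] at the points that enter it because
    [p(0_B) >= 1/2].  Hence an additive error of order [eps * G / N] in the marginals
    makes a multiplicative error of order [eps] in [p]; the gap bounds [r*] from below. *)
From mathcomp Require Import zify ring lra spectral sesquilinear.
Require Import Defs.
Set Implicit Arguments.
Unset Strict Implicit.
Unset Printing Implicit Defensive.
Import Order.TTheory GRing.Theory Num.Theory.
Local Open Scope ring_scope.

(** * Labels and Pauli matrices *)

(** The bound on the number of runs contains [Gparam C p q], where [q] is random, while the
    threshold [T0] is fixed before any outcome. So [T0] is computed from [Gmin C p], which involves
    [p] alone. On the good event [p] and [q] agree pointwise up to a factor below 2, so that
    [Gparam C p q <= 2 * Gmin C p], and the bound written with [q] follows there.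

    A factor that multiplies the estimate attached to a set [S] and does not depend on [x] shifts
    the logarithm of the canonical product by a constant, and disappears in the normalization. The
    program can therefore use natural numbers only: it tabulates approximations of
    [T * 4 ^ #|B| * p_B] without normalizing them, and realizes the Moebius sign by exchanging
    numerator and denominator.

    Since [rstar] is at least [gap / 2], a multiplicative error [1 + eps * gap / 2] is enough; this
    fixes the precision [eta = eps * gap * Gmin / (512 * N * 4 ^ nu)] of the empirical means. The
    bound [delta <= dmax < 1] keeps [ln (N / delta)] away from 0, so that all additive constants can
    be absorbed into the sample constant. *)

Lemma ord2P (x : 'I_2) : x = 0 \/ x = 1.
Proof. by case: x => [[|[|//]] ?]; [left|right]; apply/val_inj. Qed.

Lemma Z2P (x : 'Z_2) : x = 0 \/ x = 1.
Proof. exact: ord2P. Qed.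

Lemma Z2_addxx (x : 'Z_2) : x + x = 0.
Proof. by case: (Z2P x) => ->; apply/val_inj. Qed.

Lemma letter_addxx (x : 'Z_2 * 'Z_2) : x + x = 0.
Proof. by case: x => a b; congr pair; apply: Z2_addxx. Qed.

Lemma pauli_addxx n (a : pauli n) : a + a = 0.
Proof. by apply/ffunP => j; rewrite !ffunE letter_addxx. Qed.

Lemma basis_addxx n (v : basis n) : v + v = 0.
Proof. by apply/ffunP => j; rewrite !ffunE; apply: (Z2_addxx (v j)). Qed.

Lemma sign_Z2D (A : pzRingType) (x y : 'Z_2) :
  (-1) ^+ (x + y : 'Z_2)%R = (-1) ^+ x * (-1) ^+ y :> A.
Proof.
case: (Z2P x) (Z2P y) => -> [] ->; rewrite ?add0r ?addr0 ?expr0 ?mul1r ?mulr1 //.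
by rewrite [RHS](_ : _ = (-1) ^+ 1%N * (-1) ^+ 1%N) // expr1 mulrNN mulr1.
Qed.

Lemma sign_Z2sum (A : pzRingType) I (r : seq I) (F : I -> 'Z_2) :
  (-1) ^+ (\sum_(j <- r) F j)%R = \prod_(j <- r) (-1) ^+ F j :> A.
Proof.
elim: r => [|j r IH]; first by rewrite !big_nil expr0.
by rewrite !big_cons sign_Z2D IH.
Qed.

Definition xpart n (a : pauli n) : basis n := [ffun j => (a j).1].
Definition zpart n (a : pauli n) : basis n := [ffun j => (a j).2].

(** The character [(-1)^(z.v)] of [Z_2^n]. A Pauli matrix is a translation of the basis by [xpart]
    combined with multiplication by such a character. *)
Definition chi (A : pzRingType) n (z v : basis n) : A :=
  \prod_j (-1) ^+ (z j * v j)%N.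

Lemma sign_mul_ordD (A : pzRingType) (z v w : 'I_2) :
  (-1) ^+ (z * (v + w)%R)%N = (-1) ^+ (z * v)%N * (-1) ^+ (z * w)%N :> A.
Proof.
by case: (ord2P z) (ord2P v) (ord2P w) => -> [->|->] [->|->];
  rewrite ?add0r ?addr0 ?mul0n ?mul1n ?muln0 ?expr0 ?mul1r ?mulr1 //;
  rewrite [RHS](_ : _ = (-1) ^+ 1%N * (-1) ^+ 1%N) // expr1 mulrNN mulr1.
Qed.

Lemma chiC (A : pzRingType) n (z v : basis n) : chi A z v = chi A v z.
Proof. by apply: eq_bigr => j _; rewrite mulnC. Qed.

Lemma chiD (A : comPzRingType) n (z v w : basis n) :
  chi A z (v + w) = chi A z v * chi A z w.
Proof. by rewrite -big_split /=; apply: eq_bigr => j _; rewrite ffunE sign_mul_ordD. Qed.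

Lemma chi0 (A : pzRingType) n (z : basis n) : chi A z 0 = 1.
Proof. by apply: big1 => j _; rewrite ffunE muln0. Qed.

Lemma chi_sq (A : comPzRingType) n (z v : basis n) : chi A z v * chi A z v = 1.
Proof. by rewrite -chiD basis_addxx chi0. Qed.

(** Orthogonality of characters: the sum factorizes over qubits, and a qubit with [v j != 0]
    contributes [1 - 1]. *)
Lemma chi_sum (A : comPzRingType) n (v : basis n) :
  \sum_(z : basis n) chi A z v = (v == 0)%:R * (2 ^ n)%:R.
Proof.
rewrite -(bigA_distr_bigA (fun j (z : 'I_2) => (-1) ^+ (z * v j)%N)).
have E j : \sum_(z : 'I_2) (-1) ^+ (z * v j)%N = (v j == 0)%:R *+ 2 :> A.
  rewrite !big_ord_recl big_ord0 addr0 /= expr0.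
  case: (ord2P (v j)) => ->; first by rewrite muln0 expr0 eqxx mulr2n.
  by rewrite [LHS](_ : _ = 1 + (-1) ^+ 1%N) // expr1 subrr mul0rn.
under eq_bigr do rewrite E.
case: eqP => [->|/eqP v0].
  by under eq_bigr do rewrite ffunE eqxx; rewrite prodr_const card_ord mul1r natrX.
rewrite mul0r; have [j vj] : exists j, v j != 0.
  by apply/existsP; rewrite -negb_forall; apply: contraNN v0 => /forallP v0;
     apply/eqP/ffunP => j; rewrite ffunE; apply/eqP.
by rewrite (bigD1 j) //= (negbTE vj) mul0rn mul0r.
Qed.

(** Separates the symplectic sign into two characters, so that sums over the X and Z parts of a
    label can be done independently. *)
Lemma symp_chi (A : comPzRingType) n (a b : pauli n) :
  (-1) ^+ (symp a b) = chi A (xpart a) (zpart b) * chi A (zpart a) (xpart b).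
Proof.
rewrite sign_Z2sum -big_split; apply: eq_bigr => j _; rewrite sign_Z2D !ffunE.
by case: (Z2P (a j).1) (Z2P (a j).2) (Z2P (b j).1) (Z2P (b j).2) => -> [->|->] [->|->] [->|->].
Qed.

Lemma sum_pauli_parts (V : nmodType) n (F : basis n -> basis n -> V) :
  \sum_(a : pauli n) F (xpart a) (zpart a) = \sum_x \sum_z F x z.
Proof.
rewrite pair_big /= (reindex (fun a : pauli n => (xpart a, zpart a))) //=.
exists (fun p : basis n * basis n => [ffun j => (p.1 j, p.2 j)] : pauli n) => [a|[x z]] _.
  by apply/ffunP => j; rewrite !ffunE; case: (a j).
by congr pair; apply/ffunP => j; rewrite !ffunE.
Qed.

Section Operators.
Variables (R : realType) (n : nat).
Implicit Types (a b h : pauli n) (u v w : basis n) (M : op R n).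
Local Notation er := (@enum_rank (basis n)).

Lemma sum_basis (V : nmodType) (F : 'I_#|basis n| -> V) :
  \sum_i F i = \sum_(u : basis n) F (er u).
Proof. by rewrite (reindex er) //=; exists enum_val => i _; [exact: enum_rankK|exact: enum_valK]. Qed.

Lemma tensorE (A : 'I_n -> 'M[R[i]]_2) u v :
  tensor A (er u) (er v) = \prod_j A j (u j) (v j).
Proof. by rewrite mxE !enum_rankK. Qed.

Lemma prod_eq_ffun (u v : basis n) : \prod_j ((u j == v j)%:R : R[i]) = (u == v)%:R.
Proof.
case: eqP => [->|/eqP uv]; first by apply: big1 => j _; rewrite eqxx.
have [j uj] : exists j, u j != v j.
  by apply/existsP; rewrite -negb_forall; apply: contraNN uv => /forallP uv;
     apply/eqP/ffunP => j; apply/eqP.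
by rewrite (bigD1 j) //= (negbTE uj) mul0r.
Qed.

Lemma iter_pauliX (x : 'Z_2) (i j : 'I_2) :
  iter x (mulmx (pauliX R)) 1%:M i j = (i == j + x)%:R.
Proof.
case: (Z2P x) => -> /=; first by rewrite mxE addr0; case: eqP.
rewrite mulmx1 mxE.
by case: (ord2P i) (ord2P j) => -> [->|->].
Qed.

Lemma iter_pauliZ (x : 'Z_2) (i j : 'I_2) :
  iter x (mulmx (pauliZ R)) 1%:M i j = (i == j)%:R * (-1) ^+ (x * j)%N.
Proof.
case: (Z2P x) => -> /=; first by rewrite mxE mul0n mulr1; case: eqP.
rewrite mulmx1 mxE mul1n.
by case: eqP => [->|_] //; rewrite !mul0r.
Qed.

Definition phase a : R[i] := 'i ^+ (\sum_(j < n) (a j).1 * (a j).2)%N.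

(** A Pauli matrix has one nonzero entry per column; all later computations with Paulis go through
    this formula. *)
Lemma pauli_opE a u v :
  pauli_op R a (er u) (er v) = phase a * (u == v + xpart a)%:R * chi _ (zpart a) v.
Proof.
rewrite mxE mxE sum_basis -mulrA; congr (_ * _).
rewrite (bigD1 v) //= [X in _ + X]big1 ?addr0 => [|w wv]; last first.
  rewrite [X in _ * X]tensorE.
  under [X in _ * X]eq_bigr do rewrite iter_pauliZ.
  by rewrite big_split /= prod_eq_ffun (negbTE wv) mul0r mulr0.
rewrite !tensorE; congr (_ * _).
  under eq_bigr do rewrite iter_pauliX.
  by rewrite -prod_eq_ffun; apply: eq_bigr => j _; rewrite !ffunE.
by apply: eq_bigr => j _; rewrite iter_pauliZ eqxx mul1r ffunE.
Qed.

Lemma phase_norm a : phase a * Num.conj (phase a) = 1.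
Proof. by rewrite -normCK normrX normCi expr1n expr1n. Qed.

(** The square of the phase is [(-1)^(a_x.a_z)], so its inverse is itself times that sign. This is
    what makes Pauli matrices Hermitian. *)
Lemma phase_conj a : Num.conj (phase a) = phase a * chi _ (zpart a) (xpart a).
Proof.
have E : phase a * phase a = chi _ (zpart a) (xpart a).
  rewrite -expr2 /phase -exprM mulnC exprM sqrCi /chi prodrXr.
  by congr (_ ^+ _); apply: eq_bigr => j _; rewrite !ffunE mulnC.
rewrite -[LHS]mul1r -(chi_sq _ (zpart a) (xpart a)) -E.
by rewrite -[RHS]mulr1 -(phase_norm a); ring.
Qed.

Lemma chi_conj (z v : basis n) : Num.conj (chi _ z v : R[i]) = chi _ z v.
Proof. by rewrite /chi rmorph_prod; apply: eq_bigr => j _; rewrite rmorphXn /= rmorphN1. Qed.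

End Operators.

(** * Costs of programs *)

Local Open Scope nat_scope.

Lemma bitlen_leS a : bitlen a <= a.+1.
Proof.
rewrite /bitlen ltnS; case: a => [|a]; first by rewrite trunc_log0.
by apply: ltnW; apply: leq_trans (ltn_expl _ _) (trunc_logP _ _).
Qed.

Lemma bitlen_le a b : a < 2 ^ b.+1 -> bitlen a <= b.+1.
Proof.
move=> ab; rewrite /bitlen; case: a ab => [|a] ab; first by rewrite trunc_log0.
by rewrite -(ltn_exp2l _ _ (isT : 1 < 2)); apply: leq_ltn_trans (trunc_logP _ _) ab.
Qed.

Lemma ltn_bitlen a : a < 2 ^ bitlen a.
Proof. exact: trunc_log_ltn. Qed.

Lemma bitlen_mono a b : a <= b -> bitlen a <= bitlen b.
Proof. by move=> ab; rewrite ltnS leq_trunc_log. Qed.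

Lemma bitlenM a b : bitlen (a * b) <= bitlen a + bitlen b.
Proof.
have H : a * b < 2 ^ (bitlen a + bitlen b) by rewrite expnD; apply: ltn_mul; exact: ltn_bitlen.
by move: H; rewrite {1 3}/bitlen addSn => /bitlen_le.
Qed.

(** A right fold. Functions have a single argument, so it is a pair of a context, passed along
    unchanged, and the list. In [init], [Var 0] is this pair; in [body], under the [Let], the pair
    has become [Var 1]. *)
Definition loop (self : nat) (init body : expr) : expr :=
  Ite (IsPair (Snd (Var 0)))
    (Let (Call self (Cons (Fst (Var 0)) (Snd (Snd (Var 0))))) body) init.

Section BigStep.
Variable P : program.

(** An upper bound in place of the exact number of steps, so that costs can be rounded up at each
    stage. *)
Definition evals env e v b := exists2 t, eval P env e v t & t <= b.
Definition calls f v w b := evals [:: v] (nth (Const 0) P f) w b.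

Lemma ev_conv env e v w b c : evals env e v b -> v = w -> b <= c -> evals env e w c.
Proof. by case=> t et tb <- bc; exists t => //; apply: leq_trans bc. Qed.

Lemma ev_var env i : evals env (Var i) (nth (Leaf 0) env i) 1.
Proof. by exists 1 => //; constructor. Qed.

Lemma ev_const env a : evals env (Const a) (Leaf a) 1.
Proof. by exists 1 => //; constructor. Qed.

Lemma ev_cons env e1 e2 v1 v2 b1 b2 :
  evals env e1 v1 b1 -> evals env e2 v2 b2 -> evals env (Cons e1 e2) (Node v1 v2) (b1 + b2).+1.
Proof.
by move=> [t1 ? ?] [t2 ? ?]; exists (t1 + t2).+1; [constructor|rewrite ltnS leq_add].
Qed.

Lemma ev_fst env e v b : evals env e v b -> evals env (Fst e) (fst_data v) b.+1.
Proof. by move=> [t ? ?]; exists t.+1; [constructor|]. Qed.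

Lemma ev_snd env e v b : evals env e v b -> evals env (Snd e) (snd_data v) b.+1.
Proof. by move=> [t ? ?]; exists t.+1; [constructor|]. Qed.

Lemma ev_ispair env e v b : evals env e v b -> evals env (IsPair e) (Leaf (is_pair v)) b.+1.
Proof. by move=> [t ? ?]; exists t.+1; [constructor|]. Qed.

Lemma ev_arith env o e1 e2 v1 v2 b1 b2 :
  evals env e1 v1 b1 -> evals env e2 v2 b2 ->
  evals env (Arith o e1 e2) (Leaf (arith_fun o (leaf v1) (leaf v2)))
     (b1 + b2 + bitlen (leaf v1) + bitlen (leaf v2)).
Proof.
move=> [t1 ? ?] [t2 ? ?]; exists (t1 + t2 + bitlen (leaf v1) + bitlen (leaf v2)).
  by constructor.
by rewrite !leq_add2r leq_add.
Qed.

(** Charging both branches avoids a maximum in the cost expressions. *)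
Lemma ev_ite env e e1 e2 v w b b1 b2 : evals env e v b ->
  (is_true_data v -> evals env e1 w b1) -> (~~ is_true_data v -> evals env e2 w b2) ->
  evals env (Ite e e1 e2) w (b + b1 + b2).+1.
Proof.
move=> [t et tb] H1 H2; case: (boolP (is_true_data v)) => vb.
  have [s es sb] := H1 vb; exists (t + s).+1; last by rewrite ltnS; lia.
  by apply: EvalIte et _; rewrite vb.
have [s es sb] := H2 vb; exists (t + s).+1; last by rewrite ltnS; lia.
by apply: EvalIte et _; rewrite (negbTE vb).
Qed.

Lemma ev_let env e1 e2 v w b1 b2 :
  evals env e1 v b1 -> evals (v :: env) e2 w b2 -> evals env (Let e1 e2) w (b1 + b2).+1.
Proof.
move=> [t1 ? ?] [t2 ? ?]; exists (t1 + t2).+1; last by rewrite ltnS leq_add.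
by apply: EvalLet; eassumption.
Qed.

Lemma ev_call env f e v w b1 b2 :
  evals env e v b1 -> calls f v w b2 -> evals env (Call f e) w (b1 + b2).+1.
Proof.
move=> [t1 ? ?] [t2 ? ?]; exists (t1 + t2).+1; last by rewrite ltnS leq_add.
by apply: EvalCall; eassumption.
Qed.

(** Besides the body, a turn costs 12 steps for the test, the new argument, the call and the
    binding; the empty list costs 4 besides [init]. The body receives the splitting
    [s = s0 ++ x :: s'], through which it can use facts known about every entry of the whole list,
    such as duplicate-freeness or size bounds. *)
Lemma evf_loop self init body A (ea : A -> data) (V : seq A -> data) ctx c0 c (s : seq A) :
  nth (Const 0) P self = loop self init body ->
  evals [:: Node ctx (Leaf 0)] init (V [::]) c0 ->
  (forall x s' s0, s = s0 ++ x :: s' ->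
     evals [:: V s'; Node ctx (Node (ea x) (enc_list ea s'))] body (V (x :: s')) c) ->
  calls self (Node ctx (enc_list ea s)) (V s) (c0 + 4 + size s * (c + 12)).
Proof.
move=> selfE initE; elim: s => [|x s IH] bodyE; rewrite /calls selfE.
  rewrite [size _]/= mul0n addn0; have [t et tb] := initE; exists (3 + t).+1; last by lia.
  exact: (EvalIte (EvalIsPair (EvalSnd (EvalVar P [:: Node ctx (Leaf 0)] 0))) et).
have [|t et tb] := IH; first by move=> y s' s0 E; apply: (bodyE y s' (x :: s0)); rewrite E.
have [t' et' tb'] := bodyE x s [::] erefl.
set arg := Node ctx _.
have args := EvalCons (EvalFst (EvalVar P [:: arg] 0)) (EvalSnd (EvalSnd (EvalVar P [:: arg] 0))).
have test := EvalIsPair (EvalSnd (EvalVar P [:: arg] 0)).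
exists (3 + ((2 + 3).+1 + t).+1.+1 + t').+1; last by rewrite [size _]/=; lia.
have -> : (3 + ((2 + 3).+1 + t).+2 + t').+1 = (3 + ((((2 + 3).+1 + t).+1) + t').+1).+1 by lia.
exact: (EvalIte test (EvalLet (EvalCall args et) et')).
Qed.

Lemma evf_loop_le N self init body A (ea : A -> data) (V : seq A -> data) ctx c0 c (s : seq A) :
  size s <= N -> nth (Const 0) P self = loop self init body ->
  evals [:: Node ctx (Leaf 0)] init (V [::]) c0 ->
  (forall x s' s0, s = s0 ++ x :: s' ->
     evals [:: V s'; Node ctx (Node (ea x) (enc_list ea s'))] body (V (x :: s')) c) ->
  calls self (Node ctx (enc_list ea s)) (V s) (N * (c + 12) + c0 + 4).
Proof.
move=> sN selfE initE bodyE; apply: ev_conv; first exact: evf_loop selfE initE bodyE.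
  by [].
by have := leq_mul sN (leqnn (c + 12)); lia.
Qed.

End BigStep.

(** Two comparisons, since [OLeq] is the only test on numbers. *)
Definition eEq (a b : expr) : expr := Ite (Arith OLeq a b) (Arith OLeq b a) (Const 0).

Lemma ev_eq P env e1 e2 v1 v2 c1 c2 :
  evals P env e1 v1 c1 -> evals P env e2 v2 c2 ->
  evals P env (eEq e1 e2) (Leaf (leaf v1 == leaf v2))
     (2 * (c1 + c2 + bitlen (leaf v1) + bitlen (leaf v2)) + 2).
Proof.
move=> H1 H2; apply: ev_conv.
- apply: (ev_ite (w := Leaf (leaf v1 == leaf v2))); first exact: ev_arith H1 H2.
  + rewrite /=; case: leqP => //= ab _; apply: ev_conv; first exact: ev_arith H2 H1.
      by rewrite /= eqn_leq ab.
    exact: leqnn.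
  + rewrite /=; case: leqP => //= ab _; apply: ev_conv; first exact: ev_const.
      by rewrite gtn_eqF.
    exact: leqnn.
- by [].
- by rewrite /=; lia.
Qed.

(** Builds the derivation from the head of the expression, leaving value and cost to unification;
    its argument is the tactic applied to the callee of each call. *)
Ltac ev_step call :=
  lazymatch goal with
  | |- evals _ _ (Var _) _ _ => eapply ev_var
  | |- evals _ _ (Const _) _ _ => eapply ev_const
  | |- evals _ _ (Cons _ _) _ _ => eapply ev_cons; [ev_step call|ev_step call]
  | |- evals _ _ (Fst _) _ _ => eapply ev_fst; ev_step call
  | |- evals _ _ (Snd _) _ _ => eapply ev_snd; ev_step call
  | |- evals _ _ (IsPair _) _ _ => eapply ev_ispair; ev_step call
  | |- evals _ _ (Arith _ _ _) _ _ => eapply ev_arith; [ev_step call|ev_step call]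
  | |- evals _ _ (eEq _ _) _ _ => eapply ev_eq; cbn [nth]; [ev_step call|ev_step call]
  | |- evals _ _ (Call _ _) _ _ => eapply ev_call; [ev_step call | cbn [nth fst_data snd_data leaf arith_fun]; call]
  | |- _ => idtac
  end.

Ltac ev_exact := apply: ev_conv; [ev_step idtac | by [] | exact: leqnn].

(** For a branch that cannot be taken: its cost is 0, so it does not count in [ev_ite]. *)
Lemma ev_absurd P env e w b : b = false -> b -> evals P env e w 0.
Proof. by move=> ->. Qed.

(** * The estimation program *)

Notation letter := ('Z_2 * 'Z_2)%type.

(* In the body of a loop, [Var 0] is the result for the tail of the list. *)
Notation ACC := (Var 0).
Notation CTX := (Fst (Var 1)).
Notation HEAD := (Fst (Snd (Var 1))).
Notation TAIL := (Snd (Snd (Var 1))).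
Notation NIL := (Const 0).
Notation ARG := (Var 0).

Notation fMAIN := 0.
Notation fMEM := 1.
Notation fSUBSET := 2.
Notation fINREST := 3.
Notation fUNION := 4.
Notation fMEETS := 5.
Notation fCLOS := 6.
Notation fPREP := 7.
Notation fSUBS := 8.
Notation fASG := 9.
Notation fLEN := 10.
Notation fNTH := 11.
Notation fLOOKUP := 12.
Notation fMATCH := 13.
Notation fANTI := 14.
Notation fSIGN := 15.
Notation fSIGN0 := 16.
Notation fCNT := 17.
Notation fDIFF := 18.
Notation fFHAT := 19.
Notation fVAL := 20.
Notation fSNDS := 21.
Notation fROWS := 22.
Notation fPAR := 23.
Notation fTABS := 24.
Notation fDLOOP := 25.
Notation fFAC := 26.

Definition eMAIN := Call fFAC (Cons (Snd ARG) (Fst (Snd ARG))).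
Definition eMEM := loop fMEM (Const 0) (Ite (eEq CTX HEAD) (Const 1) ACC).
Definition eSUBSET := loop fSUBSET (Const 1)
  (Ite (Call fMEM (Cons HEAD CTX)) ACC (Const 0)).
(** A subfactor may lie in several factors but must enter the product once. It is emitted with the
    last factor of the list that contains it, that is, when no factor of the remaining list does. *)
Definition eINREST := loop fINREST (Const 0)
  (Ite (Call fSUBSET (Cons HEAD CTX)) (Const 1) ACC).
Definition eUNION := loop fUNION (Fst ARG)
  (Ite (Call fMEM (Cons HEAD ACC)) ACC (Cons HEAD ACC)).
Definition eMEETS := loop fMEETS (Const 0)
  (Ite (Call fMEM (Cons HEAD CTX)) (Const 1) ACC).
Definition eCLOS := loop fCLOS (Fst ARG)
  (Ite (Call fMEETS (Cons CTX HEAD)) (Call fUNION (Cons ACC HEAD)) ACC).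
Definition ePREP := loop fPREP (Snd (Fst ARG)) (Cons (Cons (Fst CTX) HEAD) ACC).
Definition eSUBS := loop fSUBS (Cons NIL NIL)
  (Call fPREP (Cons (Cons HEAD ACC) ACC)).
Definition ePREPL k e := Call fPREP (Cons (Cons (Cons HEAD (Const k)) e) ACC).
Definition eASG := loop fASG (Cons NIL NIL)
  (ePREPL 0 (ePREPL 1 (ePREPL 2 (ePREPL 3 NIL)))).
Definition eLEN := loop fLEN (Const 0) (Arith OAdd ACC (Const 1)).
Definition eNTH := Ite (Fst ARG)
  (Call fNTH (Cons (Arith OSub (Fst ARG) (Const 1)) (Snd (Snd ARG))))
  (Fst (Snd ARG)).
Definition eLOOKUP := loop fLOOKUP (Const 0)
  (Ite (eEq CTX (Fst HEAD)) (Snd HEAD) ACC).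
Definition eMATCH := loop fMATCH (Const 1)
  (Ite (Snd HEAD)
    (Ite (eEq (Snd HEAD) (Call fNTH (Cons (Fst HEAD) CTX))) ACC (Const 0)) ACC).
Definition eANTI := Ite (Fst ARG)
  (Ite (Snd ARG) (Ite (eEq (Fst ARG) (Snd ARG)) (Const 0) (Const 1)) (Const 0)) (Const 0).
Definition eSIGN := loop fSIGN (Const 0)
  (Ite (Call fANTI (Cons (Snd HEAD) (Call fNTH (Cons (Fst HEAD) CTX))))
    (Arith OSub (Const 1) ACC) ACC).
Definition eSIGN0 := loop fSIGN0 (Const 0)
  (Ite (Call fANTI (Cons (Snd HEAD) (Call fLOOKUP (Cons (Fst HEAD) CTX))))
    (Arith OSub (Const 1) ACC) ACC).
(** Signs +1 and -1 are counted separately because numbers are natural; the difference is taken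
    once, at the end. The first generator of a run spells its measurement basis. *)
Definition eCNT := loop fCNT (Cons (Const 0) (Const 0))
  (Ite (eEq (Fst (Snd HEAD)) (Snd CTX))
    (Ite (Call fMATCH (Cons (Fst (Fst HEAD)) (Fst CTX)))
      (Ite (Call fSIGN (Cons (Snd (Snd HEAD)) (Fst CTX)))
        (Cons (Fst ACC) (Arith OAdd (Snd ACC) (Const 1)))
        (Cons (Arith OAdd (Fst ACC) (Const 1)) (Snd ACC)))
      ACC)
    ACC).
Definition eDIFF := Arith OSub (Fst ARG) (Snd ARG).
Definition eCOUNT k := Call fDIFF (Call fCNT (Cons (Cons (Fst ARG) (Const k)) (Snd ARG))).
(** The factor [fLEN], the number of runs, is a common denominator: integer division then loses at
    most one unit in [T]. *)
Definition eFHAT := Arith ODiv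
  (Arith OMul (Call fLEN (Cons NIL (Snd ARG))) (eCOUNT 1)) (eCOUNT 0).
Definition eVAL := loop fVAL (Cons (Const 0) (Const 0))
  (Ite (Call fSIGN0 (Cons (Fst CTX) HEAD))
    (Cons (Fst ACC) (Arith OAdd (Snd ACC) (Call fFHAT (Cons HEAD (Snd CTX)))))
    (Cons (Arith OAdd (Fst ACC) (Call fFHAT (Cons HEAD (Snd CTX)))) (Snd ACC))).
Definition eSNDS := loop fSNDS NIL (Cons (Snd HEAD) ACC).
(** The flag [Fst CTX] is the parity of [#|D| - #|S|]; when it is odd the estimate goes to the
    denominator, which is the exponent -1 of the Moebius formula. Adding 1 keeps the estimate
    positive. *)
Definition eROWS := 
  let g := Arith OAdd (Call fDIFF (Call fVAL (Cons (Cons HEAD (Snd (Snd CTX))) (Fst (Snd CTX))))) (Const 1) in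
  loop fROWS NIL
  (Cons (Cons (Call fSNDS (Cons NIL HEAD))
     (Ite (Fst CTX) (Cons (Const 1) g) (Cons g (Const 1)))) ACC).
Definition ePAR := Let (Arith OSub (Call fLEN (Cons NIL (Fst ARG))) (Call fLEN (Cons NIL (Snd ARG))))
  (Arith OSub (Var 0) (Arith OMul (Arith ODiv (Var 0) (Const 2)) (Const 2))).
Definition eTABS := loop fTABS (Fst (Snd (Fst ARG)))
  (Cons (Cons HEAD (Call fROWS (Cons
     (Cons (Call fPAR (Cons (Fst CTX) HEAD))
       (Cons (Call fASG (Cons NIL (Call fCLOS (Cons HEAD (Fst (Snd (Snd CTX)))))))
          (Snd (Snd (Snd CTX)))))
     (Call fASG (Cons NIL HEAD))))) ACC).
Definition eDLOOP := loop fDLOOP (Fst (Snd (Fst ARG)))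
  (Ite (IsPair HEAD)
    (Ite (Call fINREST (Cons HEAD (Fst CTX))) ACC
      (Call fTABS (Cons (Cons HEAD (Cons ACC (Snd (Snd CTX)))) (Call fSUBS (Cons NIL HEAD))))) ACC).
Definition eFAC := loop fFAC NIL
  (Call fDLOOP (Cons (Cons TAIL (Cons ACC CTX)) (Call fSUBS (Cons NIL HEAD)))).

Definition estimator : program :=
  [:: eMAIN; eMEM; eSUBSET; eINREST; eUNION; eMEETS; eCLOS; ePREP; eSUBS; eASG; eLEN; eNTH;
      eLOOKUP; eMATCH; eANTI; eSIGN; eSIGN0; eCNT; eDIFF; eFHAT; eVAL; eSNDS; eROWS; ePAR;
      eTABS; eDLOOP; eFAC].

Local Notation evf := (calls estimator).

(** * Loops over sets of qubits, and the Markov closure *)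

Section Sets.
Variable n : nat.
Implicit Types (s c l : seq 'I_n) (j : 'I_n).

Definition enc_ord (j : 'I_n) : data := Leaf j.
Local Notation encs := (enc_list enc_ord).

Lemma bitlen_ord j : bitlen j <= n.
Proof. exact: leq_trans (bitlen_leS j) (ltn_ord j). Qed.

Definition cMEM := n * (4 * n + 60) + 5.

Lemma ev_MEM j s : size s <= n -> evf fMEM (Node (Leaf j) (encs s)) (Leaf (j \in s)) cMEM.
Proof.
move=> sn; apply: ev_conv.
- apply: (evf_loop_le (V := fun s => Leaf (j \in s)) (c := 4 * n + 48) sn) => //; first exact: ev_const.
  move=> x s' s0 _; apply: ev_conv.
  + apply: (ev_ite (w := Leaf (j \in x :: s'))).
    * ev_step idtac.
    * rewrite inE -val_eqE /=; case: eqP => // _ _; exact: ev_const.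
    * rewrite inE -val_eqE /=; case: eqP => // _ _; exact: ev_var.
  + by [].
  + rewrite /=; have := bitlen_ord j; have := bitlen_ord x; lia.
- by [].
- by rewrite /cMEM; lia.
Qed.

Definition cSUBSET := n * (cMEM + 60) + 5.

Lemma ev_SUBSET c s : size c <= n -> size s <= n ->
  evf fSUBSET (Node (encs c) (encs s)) (Leaf (all (mem c) s)) cSUBSET.
Proof.
move=> cn sn; apply: ev_conv.
- apply: (evf_loop_le (V := fun s => Leaf (all (mem c) s)) (c := cMEM + 48) sn) => //; first exact: ev_const.
  move=> x s' s0 _; apply: ev_conv.
  + apply: (ev_ite (w := Leaf (all (mem c) (x :: s')))).
    * ev_step ltac:(exact: ev_MEM).
    * rewrite /=; case: (x \in c) => // _; exact: ev_var.
    * rewrite /=; case: (x \in c) => // _; exact: ev_const.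
  + by [].
  + by lia.
- by [].
- by rewrite /cSUBSET; lia.
Qed.

Lemma size_uniq_ord s : uniq s -> size s <= n.
Proof. by move=> us; rewrite -(card_uniqP us) -[X in _ <= X](card_ord n) max_card. Qed.

Local Notation encss := (enc_list (enc_list enc_ord)).

Definition cINREST N := N * (cSUBSET + 60) + 5.

Lemma ev_INREST N D (cs : seq (seq 'I_n)) : size cs <= N -> size D <= n -> all uniq cs ->
  evf fINREST (Node (encs D) (encss cs)) (Leaf (has (fun c => all (mem c) D) cs)) (cINREST N).
Proof.
move=> csN Dn ucs; apply: ev_conv.
- apply: (evf_loop_le (V := fun cs => Leaf (has (fun c : seq 'I_n => all (mem c) D) cs)) (c := cSUBSET + 48) csN) => //; first exact: ev_const.
  move=> x s' s0 E; have ux : size x <= n.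
    by apply: size_uniq_ord; move: ucs; rewrite E all_cat /= => /and3P[].
  apply: ev_conv.
  + apply: (ev_ite (w := Leaf (has (fun c : seq 'I_n => all (mem c) D) (x :: s')))).
    * ev_step ltac:(apply: ev_SUBSET).
      by [].
      by [].
    * rewrite /=; case: (all _ D) => // _; exact: ev_const.
    * rewrite /=; case: (all _ D) => // _; exact: ev_var.
  + by [].
  + by lia.
- by [].
- by rewrite /cINREST; lia.
Qed.

Definition union (u c : seq 'I_n) := foldr (fun j u => if j \in u then u else j :: u) u c.

Lemma union_uniq u c : uniq u -> uniq (union u c).
Proof. by move=> uu; elim: c => //= j c IH; case: ifP => //= ->. Qed.

Lemma mem_union u c j : (j \in union u c) = (j \in u) || (j \in c).
Proof.
elim: c => [|i c IH] /=; first by rewrite orbF.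
rewrite !inE; case: ifPn => [iu|_]; last by rewrite inE IH orbCA.
case: (eqVneq j i) => [ji|_] /=; last exact: IH.
by rewrite orbT ji iu.
Qed.

Definition cUNION := n * (cMEM + 60) + 6.

Lemma ev_UNION u c : uniq u -> size c <= n ->
  evf fUNION (Node (encs u) (encs c)) (encs (union u c)) cUNION.
Proof.
move=> uu cn; apply: ev_conv.
- apply: (evf_loop_le (V := fun c => encs (union u c)) (c := cMEM + 48) cn) => //; first by ev_exact.
  move=> x s' s0 _; apply: ev_conv.
  + apply: (ev_ite (w := encs (union u (x :: s')))).
    * by ev_step ltac:(apply: ev_MEM); exact/size_uniq_ord/union_uniq.
    * rewrite /=; case: (x \in _) => // _; exact: ev_var.
    * rewrite /=; case: (x \in _) => // _; ev_exact.
  + by [].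
  + by lia.
- by [].
- by rewrite /cUNION; lia.
Qed.

Definition cMEETS := n * (cMEM + 60) + 5.

Lemma ev_MEETS s c : size s <= n -> size c <= n ->
  evf fMEETS (Node (encs s) (encs c)) (Leaf (has (mem s) c)) cMEETS.
Proof.
move=> sn cn; apply: ev_conv.
- apply: (evf_loop_le (V := fun c => Leaf (has (mem s) c)) (c := cMEM + 48) cn) => //; first exact: ev_const.
  move=> x s' s0 _; apply: ev_conv.
  + apply: (ev_ite (w := Leaf (has (mem s) (x :: s')))).
    * ev_step ltac:(exact: ev_MEM).
    * rewrite /=; case: (x \in s) => // _; exact: ev_const.
    * rewrite /=; case: (x \in s) => // _; exact: ev_var.
  + by [].
  + by lia.
- by [].
- by rewrite /cMEETS; lia.
Qed.

(** The test uses the original set [s] and not the growing union, so only one layer of factors is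
    added. *)
Definition clos s (cs : seq (seq 'I_n)) :=
  foldr (fun c u => if has (mem s) c then union u c else u) s cs.

Lemma clos_uniq s cs : uniq s -> uniq (clos s cs).
Proof. by move=> us; elim: cs => //= c cs IH; case: ifP => // _; exact: union_uniq. Qed.

Definition cCLOS N := N * (cMEETS + cUNION + 60) + 6.

Lemma ev_CLOS N s cs : size cs <= N -> uniq s -> all uniq cs ->
  evf fCLOS (Node (encs s) (encss cs)) (encs (clos s cs)) (cCLOS N).
Proof.
move=> csN us ucs; apply: ev_conv.
- apply: (evf_loop_le (V := fun cs => encs (clos s cs)) (c := cMEETS + cUNION + 48) csN) => //; first by ev_exact.
  move=> x s' s0 E; have xn : size x <= n.
    by apply: size_uniq_ord; move: ucs; rewrite E all_cat /= => /and3P[].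
  apply: ev_conv.
  + apply: (ev_ite (w := encs (clos s (x :: s')))).
    * by ev_step ltac:(apply: ev_MEETS) => //; exact: size_uniq_ord.
    * rewrite /=; case: (has _ x) => // _; ev_step ltac:(apply: ev_UNION) => //.
      exact: clos_uniq.
    * rewrite /=; case: (has _ x) => // _; exact: ev_var.
  + by [].
  + by lia.
- by [].
- by rewrite /cCLOS; lia.
Qed.

End Sets.

Lemma ev_PREP A (ea : A -> data) N (x : A) (rest ws : seq (seq A)) : size ws <= N ->
  evf fPREP (Node (Node (ea x) (enc_list (enc_list ea) rest)) (enc_list (enc_list ea) ws))
    (enc_list (enc_list ea) ([seq x :: w | w <- ws] ++ rest)) (N * 40 + 7).
Proof.
move=> wsN; apply: ev_conv.
- apply: (evf_loop_le (V := fun ws => enc_list (enc_list ea) ([seq x :: w | w <- ws] ++ rest)) (c := 28) wsN) => //; first by ev_exact.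
  by move=> y s' s0 _; apply: ev_conv; first ev_step idtac.
- by [].
- by lia.
Qed.

Fixpoint subs A (l : seq A) : seq (seq A) :=
  if l is x :: l' then [seq x :: w | w <- subs l'] ++ subs l' else [:: [::]].

Lemma size_subs A (l : seq A) : size (subs l) = 2 ^ size l.
Proof. by elim: l => //= x l IH; rewrite size_cat size_map IH expnS mul2n addnn. Qed.

Definition cSUBS N := N * (2 ^ N * 40 + 60) + 7.

Lemma ev_SUBS A (ea : A -> data) N v (l : seq A) : size l <= N ->
  evf fSUBS (Node v (enc_list ea l)) (enc_list (enc_list ea) (subs l)) (cSUBS N).
Proof.
move=> lN; apply: ev_conv.
- apply: (evf_loop_le (V := fun l => enc_list (enc_list ea) (subs l)) (c := 2 ^ N * 40 + 48) lN) => //; first by ev_exact.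
  move=> x s' s0 E; apply: ev_conv.
  + ev_step ltac:(apply: (@ev_PREP _ ea (2 ^ N))).
    rewrite size_subs leq_exp2l //; apply: leq_trans lN; rewrite E size_cat /=; lia.
  + by [].
  + by lia.
- by [].
- by rewrite /cSUBS; lia.
Qed.

Definition letters : seq letter := [:: (0, 0); (1, 0); (0, 1); (1, 1)]%R.

Fixpoint asg I (l : seq I) : seq (seq (I * letter)) :=
  if l is j :: l' then flatten [seq [seq (j, u) :: w | w <- asg l'] | u <- letters]
  else [:: [::]].

Lemma size_asg I (l : seq I) : size (asg l) = 4 ^ size l.
Proof. by elim: l => //= x l IH; rewrite !size_cat !size_map /= IH expnS; lia. Qed.

Section Assignments.
Variable n : nat.
Implicit Types (a x : seq ('I_n * letter)) (j : 'I_n) (l : seq 'I_n).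

Definition enc_entry (p : 'I_n * letter) : data := Node (Leaf p.1) (enc_letter p.2).

Definition cASG N := N * (4 * (4 ^ N * 40) + 120) + 7.

Lemma ev_ASG N v l : size l <= N ->
  evf fASG (Node v (enc_list (@enc_ord n) l)) (enc_list (enc_list enc_entry) (asg l)) (cASG N).
Proof.
move=> lN; apply: ev_conv.
- apply: (evf_loop_le (V := fun l => enc_list (enc_list enc_entry) (asg l)) (c := 4 * (4 ^ N * 40) + 108) lN) => //; first by ev_exact.
  move=> j s' s0 E.
  have sz : size (asg s') <= 4 ^ N.
    by rewrite size_asg leq_exp2l //; apply: leq_trans lN; rewrite E size_cat /=; lia.
  apply: ev_conv.
  + rewrite /ePREPL; ev_step idtac.
    * exact: (@ev_PREP _ enc_entry _ (j, (1, 1)%R) [::] _ sz).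
    * exact: (@ev_PREP _ enc_entry _ (j, (0, 1)%R) _ _ sz).
    * exact: (@ev_PREP _ enc_entry _ (j, (1, 0)%R) _ _ sz).
    * exact: (@ev_PREP _ enc_entry _ (j, (0, 0)%R) _ _ sz).
  + by [].
  + by lia.
- by [].
- by rewrite /cASG; lia.
Qed.

End Assignments.

Definition cLEN N := N * (bitlen N + 30) + 5.

Lemma ev_LEN A (ea : A -> data) N v (s : seq A) : size s <= N ->
  evf fLEN (Node v (enc_list ea s)) (Leaf (size s)) (cLEN N).
Proof.
move=> sN; apply: ev_conv.
- apply: (evf_loop_le (V := fun s : seq A => Leaf (size s)) (c := bitlen N + 18) sN) => //; first exact: ev_const.
  move=> x s' s0 E; apply: ev_conv; first by ev_step idtac.
    by rewrite /= addn1.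
  rewrite /=; have : bitlen (size s') <= bitlen N.
    by apply: bitlen_mono; apply: leq_trans sN; rewrite E size_cat /=; lia.
  have -> : bitlen 1 = 1 by [].
  by lia.
- by [].
- by rewrite /cLEN; lia.
Qed.

Definition letter_code (u : letter) : nat := u.1 + 2 * u.2.

Lemma letter_code_le u : letter_code u <= 3.
Proof.
rewrite /letter_code; have := ltn_ord u.1; have := ltn_ord u.2.
rewrite /= /Zp_trunc /=; lia.
Qed.

Lemma letter_code_inj : injective letter_code.
Proof.
by move=> [a b] [c d]; rewrite /letter_code /=;
  case: (Z2P a) (Z2P b) (Z2P c) (Z2P d) => -> [->|->] [->|->] [->|->].
Qed.

Lemma letter_code_eq0 u : (letter_code u == 0) = (u == 0%R).
Proof. by rewrite -(inj_eq letter_code_inj). Qed.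

Lemma letter_codeE u v : (letter_code u == letter_code v) = (u == v).
Proof. exact: inj_eq letter_code_inj _ _. Qed.

Lemma is_true_letter u : is_true_data (enc_letter u) = (u != 0%R).
Proof. by rewrite -letter_code_eq0 /enc_letter -/(letter_code u); case: (letter_code u). Qed.

Lemma bitlen_letter u : bitlen (letter_code u) <= 4.
Proof. by apply: leq_trans (bitlen_leS _) _; rewrite ltnS; exact: letter_code_le. Qed.

(** Two one-qubit Paulis anticommute exactly when both differ from the identity and from each
    other. *)
Definition anti (u v : letter) : bool := [&& u != 0, v != 0 & u != v]%R.

Lemma ev_ANTI u v : evf fANTI (Node (enc_letter u) (enc_letter v)) (Leaf (anti u v)) 60.
Proof.
apply: ev_conv.
- apply: (ev_ite (w := Leaf (anti u v))); first by ev_step idtac.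
  + rewrite [nth _ _ _]/= [fst_data _]/= is_true_letter => u0.
    apply: (ev_ite (w := Leaf (anti u v))); first by ev_step idtac.
    * rewrite [nth _ _ _]/= [snd_data _]/= is_true_letter => v0.
      apply: (ev_ite (w := Leaf (anti u v))); first by ev_step idtac.
      - rewrite /= letter_codeE /anti u0 v0; case: eqP => // _ _; exact: ev_const.
      - rewrite /= letter_codeE /anti u0 v0; case: eqP => // _ _; exact: ev_const.
    * rewrite [nth _ _ _]/= [snd_data _]/= is_true_letter negbK => v0.
      rewrite /anti v0 andbF; exact: ev_const.
  + rewrite [nth _ _ _]/= [fst_data _]/= is_true_letter negbK => u0.
    rewrite /anti u0; exact: ev_const.
- by [].
- rewrite /=; have := bitlen_letter u; have := bitlen_letter v; rewrite /letter_code; lia.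
Qed.

(** * Counting over the list of runs *)

Section Samples.
Variable n : nat.
Implicit Types (a x : seq ('I_n * letter)) (j : 'I_n) (g r : pauli n).

Local Notation enca := (enc_list (@enc_entry n)).

Definition cNTH := n.+1 * (n + 40).

Lemma ev_NTH j g : evf fNTH (Node (Leaf j) (enc_pauli g)) (enc_letter (g j)) cNTH.
Proof.
have H (s : seq 'I_n) k : k < size s -> size s <= n ->
    evf fNTH (Node (Leaf k) (enc_list (fun j => enc_letter (g j)) s))
      (enc_letter (g (nth j s k))) (k.+1 * (n + 40)).
  elim: s k => // i s IH [|k] ks sn; rewrite /evf.
    apply: ev_conv.
    + apply: (ev_ite (w := enc_letter (g (nth j (i :: s) 0)))); first by ev_step idtac.
        by apply: ev_absurd.
      by move=> _; ev_exact.
    + by [].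
    + by rewrite /=; lia.
  apply: ev_conv.
  + apply: (ev_ite (w := enc_letter (g (nth j (i :: s) k.+1)))); first by ev_step idtac.
      move=> _; ev_step idtac; rewrite subn1; apply: IH => //.
      exact: ltnW.
    by apply: ev_absurd.
  + by [].
  + rewrite /=; have := bitlen_leS k.+1; have := bitlen_leS 1.
    by move: sn ks => /=; lia.
have := H (enum 'I_n) j; rewrite size_enum_ord ltn_ord leqnn nth_ord_enum => /(_ isT isT) HH.
apply: ev_conv; first exact: HH.
  by [].
by rewrite /cNTH leq_mul2r ltnS ltnW ?orbT.
Qed.

Definition lookup j x : letter := foldr (fun p u => if j == p.1 then p.2 else u) 0%R x.

Definition cLOOKUP := n * (4 * n + 60) + 5.

Lemma ev_LOOKUP j x : size x <= n ->
  evf fLOOKUP (Node (Leaf j) (enca x)) (enc_letter (lookup j x)) cLOOKUP.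
Proof.
move=> xn; apply: ev_conv.
- apply: (evf_loop_le (V := fun x => enc_letter (lookup j x)) (c := 4 * n + 48) xn) => //; first exact: ev_const.
  move=> p s' s0 _; apply: ev_conv.
  + apply: (ev_ite (w := enc_letter (lookup j (p :: s')))).
    * ev_step idtac.
    * rewrite /= val_eqE; case: eqP => // _ _; ev_exact.
    * rewrite /= val_eqE; case: eqP => // _ _; exact: ev_var.
  + by [].
  + rewrite /=; have := bitlen_ord j; have := bitlen_ord p.1; lia.
- by [].
- by rewrite /cLOOKUP; lia.
Qed.

Definition agrees_on g a := all (fun p => (p.2 == 0%R) || (p.2 == g p.1)) a.

Definition cMATCH := n * (2 * cNTH + 100) + 5.

Lemma ev_MATCH g a : size a <= n ->
  evf fMATCH (Node (enc_pauli g) (enca a)) (Leaf (agrees_on g a)) cMATCH.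
Proof.
move=> an; apply: ev_conv.
- apply: (evf_loop_le (V := fun a => Leaf (agrees_on g a)) (c := 2 * cNTH + 88) an) => //; first exact: ev_const.
  move=> p s' s0 _; apply: ev_conv.
  + apply: (ev_ite (w := Leaf (agrees_on g (p :: s')))); first by ev_step idtac.
    * rewrite [is_true_data _]is_true_letter => p0.
      apply: (ev_ite (w := Leaf (agrees_on g (p :: s')))).
      - ev_step ltac:(exact: ev_NTH).
      - rewrite /= letter_codeE (negbTE p0) /=; case: eqP => // _ _; exact: ev_var.
      - rewrite /= letter_codeE (negbTE p0) /=; case: eqP => // _ _; exact: ev_const.
    * rewrite [is_true_data _]is_true_letter negbK => p0.
      rewrite /= p0; exact: ev_var.
  + by [].
  + rewrite /=; have := bitlen_letter p.2; have := bitlen_letter (g p.1).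
    rewrite /letter_code; lia.
- by [].
- by rewrite /cMATCH; lia.
Qed.

Definition sign_on (f : 'I_n -> letter) a : bool := odd (count (fun p => anti p.2 (f p.1)) a).

Lemma sign_on_cons f p a : sign_on f (p :: a) = anti p.2 (f p.1) (+) sign_on f a.
Proof. by rewrite /sign_on /= oddD; case: (anti _ _). Qed.

Definition cSIGN := n * (cNTH + 150) + 5.

Lemma ev_SIGN r a : size a <= n ->
  evf fSIGN (Node (enc_pauli r) (enca a)) (Leaf (sign_on r a)) cSIGN.
Proof.
move=> an; apply: ev_conv.
- apply: (evf_loop_le (V := fun a => Leaf (sign_on r a)) (c := cNTH + 138) an) => //; first exact: ev_const.
  move=> p s' s0 _; rewrite sign_on_cons; apply: ev_conv.
  + apply: (ev_ite (w := Leaf (anti p.2 (r p.1) (+) sign_on r s'))).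
    * ev_step idtac; first exact: ev_NTH. exact: ev_ANTI.
    * rewrite /=; case: (anti _ _) => // _; apply: ev_conv; first ev_step idtac.
        by case: (sign_on r s').
      exact: leqnn.
    * rewrite /=; case: (anti _ _) => // _; exact: ev_var.
  + by [].
  + have b1 : bitlen (sign_on r s') <= 2 by apply: leq_trans (bitlen_leS _) _; case: sign_on.
    have b2 := bitlen_leS 1; cbn [leaf nth]; lia.
- by [].
- by rewrite /cSIGN; lia.
Qed.

Definition cSIGN0 := n * (cLOOKUP + 150) + 5.

Lemma ev_SIGN0 x a : size x <= n -> size a <= n ->
  evf fSIGN0 (Node (enca x) (enca a)) (Leaf (sign_on (lookup^~ x) a)) cSIGN0.
Proof.
move=> xn an; apply: ev_conv.
- apply: (evf_loop_le (V := fun a => Leaf (sign_on (lookup^~ x) a)) (c := cLOOKUP + 138) an) => //; first exact: ev_const.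
  move=> p s' s0 _; rewrite sign_on_cons; apply: ev_conv.
  + apply: (ev_ite (w := Leaf (anti p.2 (lookup p.1 x) (+) sign_on (lookup^~ x) s'))).
    * ev_step idtac; first exact: ev_LOOKUP. exact: ev_ANTI.
    * rewrite /=; case: (anti _ _) => // _; apply: ev_conv; first ev_step idtac.
        by case: (sign_on _ s').
      exact: leqnn.
    * rewrite /=; case: (anti _ _) => // _; exact: ev_var.
  + by [].
  + have b1 : bitlen (sign_on (lookup^~ x) s') <= 2 by apply: leq_trans (bitlen_leS _) _; case: sign_on.
    have b2 := bitlen_leS 1; cbn [leaf nth]; lia.
- by [].
- by rewrite /cSIGN0; lia.
Qed.

(* A sample: the generators (at least one), the length and the outcome. *)
Definition sample : Type := ((pauli n * seq (pauli n)) * (nat * pauli n))%type.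

Definition enc_sample (t : sample) : data :=
  Node (enc_list (@enc_pauli n) (t.1.1 :: t.1.2)) (Node (Leaf t.2.1) (enc_pauli t.2.2)).

Definition cnt l (e : bool) a (s : seq sample) : nat :=
  count (fun t : sample => [&& t.2.1 == l, agrees_on t.1.1 a & sign_on t.2.2 a == e]) s.

Definition cCNT N := N * (cMATCH + cSIGN + 2 * bitlen N + 150) + 7.

Lemma ev_CNT N l a s : size s <= N -> l <= 1 -> size a <= n ->
  all (fun t : sample => t.2.1 <= 2) s ->
  evf fCNT (Node (Node (enca a) (Leaf l)) (enc_list enc_sample s))
    (Node (Leaf (cnt l false a s)) (Leaf (cnt l true a s))) (cCNT N).
Proof.
move=> sN l1 an lens; apply: ev_conv.
- apply: (evf_loop_le (V := fun s => Node (Leaf (cnt l false a s)) (Leaf (cnt l true a s)))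
    (c := cMATCH + cSIGN + 2 * bitlen N + 138) sN) => //; first by ev_exact.
  move=> t s' s0 E.
  have t2 : t.2.1 <= 2 by move: lens; rewrite E all_cat /= => /and3P[].
  have bN e : bitlen (cnt l e a s') <= bitlen N.
    apply: bitlen_mono; apply: leq_trans (count_size _ _) _.
    by apply: leq_trans sN; rewrite E size_cat /=; lia.
  pose w := Node (Leaf (cnt l false a (t :: s'))) (Leaf (cnt l true a (t :: s'))).
  apply: ev_conv.
  + apply: (ev_ite (w := w)); first by ev_step idtac.
    * rewrite /= => tl.
      apply: (ev_ite (w := w)); first by ev_step ltac:(exact: ev_MATCH).
      - rewrite /= => ta.
        apply: (ev_ite (w := w)); first by ev_step ltac:(exact: ev_SIGN).
        + rewrite /= => ts; apply: ev_conv; first ev_step idtac.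
            rewrite /w /cnt /=; move: tl ta ts; case: (_ == l) => // _.
            by case: (agrees_on _ _) => // _; case: (sign_on _ _) => // _; rewrite addn1.
          exact: leqnn.
        + rewrite /= => ts; apply: ev_conv; first ev_step idtac.
            rewrite /w /cnt /=; move: tl ta ts; case: (_ == l) => // _.
            by case: (agrees_on _ _) => // _; case: (sign_on _ _) => // _; rewrite addn1.
          exact: leqnn.
      - rewrite /= => ta; rewrite /w /cnt /=; move: tl ta; case: (_ == l) => // _.
        by case: (agrees_on _ _) => // _; exact: ev_var.
    * rewrite /= => tl; rewrite /w /cnt /=; move: tl; case: (_ == l) => // _.
      exact: ev_var.
  + by [].
  + have b1 := bitlen_leS 1; rewrite /=.
    have := bitlen_leS t.2.1; have := bitlen_leS l; have := bN true; have := bN false; lia.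
- by [].
- by rewrite /cCNT; lia.
Qed.

Lemma ev_DIFF (a b : nat) : evf fDIFF (Node (Leaf a) (Leaf b)) (Leaf (a - b)) (4 + bitlen a + bitlen b).
Proof. by rewrite /evf /= /eDIFF; apply: ev_conv; [ev_step idtac|by []|rewrite /=; lia]. Qed.

(** Number of runs times the ratio of the signed sums at lengths 1 and 0. With equally many runs of
    both lengths compatible with the label, this is the ratio of the empirical means. *)
Definition eigenvalue_estimate a s : nat :=
  (size s * (cnt 1 false a s - cnt 1 true a s)) %/ (cnt 0 false a s - cnt 0 true a s).

Definition cFHAT N := cLEN N + 2 * cCNT N + 10 * bitlen N + 60.

Lemma ev_FHAT N a s : size s <= N -> size a <= n -> all (fun t : sample => t.2.1 <= 2) s ->
  evf fFHAT (Node (enca a) (enc_list enc_sample s)) (Leaf (eigenvalue_estimate a s)) (cFHAT N).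
Proof.
move=> sN an lens.
have bN l e : bitlen (cnt l e a s) <= bitlen N.
  by apply: bitlen_mono; apply: leq_trans (count_size _ _) _.
apply: ev_conv.
- rewrite /evf /= /eFHAT /eCOUNT; ev_step idtac.
  + exact: ev_LEN sN.
  + exact: (ev_CNT (l := 1) sN).
  + exact: ev_DIFF.
  + exact: (ev_CNT (l := 0) sN).
  + exact: ev_DIFF.
- by [].
- rewrite /=; set m1 := cnt 1 false a s - _; set m0 := cnt 0 false a s - _.
  have h1 : bitlen m1 <= bitlen N by apply: leq_trans (bN 1 false); apply: bitlen_mono; exact: leq_subr.
  have h0 : bitlen m0 <= bitlen N by apply: leq_trans (bN 0 false); apply: bitlen_mono; exact: leq_subr.
  have := bitlen_mono sN; have := bitlenM (size s) m1.
  have := bN 1 true; have := bN 1 false; have := bN 0 true; have := bN 0 false.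
  by rewrite /cFHAT; lia.
Qed.

(** Deliberately crude: the running time is claimed for every outcome, also for those where the
    denominator is 1 by bad luck. *)
Lemma eigenvalue_estimate_le N a s : size s <= N -> eigenvalue_estimate a s <= N * N.
Proof.
move=> sN; apply: leq_trans (leq_div _ _) _; apply: leq_mul => //.
by apply: leq_trans (leq_subr _ _) _; apply: leq_trans (count_size _ _) _.
Qed.

End Samples.

Lemma subs_subseq (A : eqType) (s l : seq A) : (s \in subs l) = subseq s l.
Proof.
elim: l s => [|x l IH] s; first by rewrite mem_seq1 subseq0.
rewrite /= mem_cat IH; case: s => [|y s].
  by rewrite sub0seq orbT.
case: eqP => [->|yx].
  rewrite mem_map => [|? ? []//]; rewrite IH.
  apply/idP/idP => [/orP[//|H]|->//]; exact: subseq_trans (subseq_cons s x) H.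
rewrite (_ : _ \in map _ _ = false) //; apply/negbTE/mapP => -[w _ [/yx]].
by [].
Qed.

Lemma asg_unzip1 (I : eqType) (l : seq I) a : a \in asg l -> unzip1 a = l.
Proof.
elim: l a => [|j l IH] a /=; first by rewrite mem_seq1 => /eqP ->.
rewrite !mem_cat !orbA orbF.
by case/orP => [/orP[/orP[]|]|] /mapP[w /IH <- ->].
Qed.

Lemma size_mem_asg (I : eqType) (l : seq I) a : a \in asg l -> size a = size l.
Proof. by move=> /asg_unzip1 <-; rewrite size_map. Qed.

(** * Fourier sums and the tables of the factors *)

Section Output.
Variables (n : nat) (samples : seq (sample n)) (Cs : seq (seq 'I_n)).
Implicit Types (a x : seq ('I_n * letter)) (S D c l : seq 'I_n).

Local Notation encs := (enc_list (@enc_ord n)).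
Local Notation encss := (enc_list (enc_list (@enc_ord n))).
Local Notation enca := (enc_list (@enc_entry n)).
Local Notation encaa := (enc_list (enc_list (@enc_entry n))).
Local Notation encd := (enc_list (@enc_sample n)).
Local Notation enct := (enc_list (@enc_table n)).

Definition part (e : bool) x (s : seq (seq ('I_n * letter))) : nat :=
  \sum_(a <- s | sign_on (fun j => lookup j x) a == e) eigenvalue_estimate a samples.

(** The marginal on the closure of [S] at [x] on [S] and the identity on the blanket; the latter
    comes from the default value 0 of [lookup]. *)
Definition local_estimate S x : nat :=
  let s := asg (clos S Cs) in (part false x s - part true x s).+1.

Definition local_table (o : bool) S : table n :=
  (S, [seq (unzip2 x, if o then (1, local_estimate S x) else (local_estimate S x, 1))
      | x <- asg S]).

Fixpoint output (cs : seq (seq 'I_n)) : seq (table n) :=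
  if cs is c :: rest then
    foldr (fun D acc => if (D != [::]) && ~~ has (fun c => all (mem c) D) rest then
                          [seq local_table (odd (size D - size U)) U | U <- subs D] ++ acc
                        else acc) (output rest) (subs c)
  else [::].

Variables (N T k : nat).
Hypotheses (samplesT : size samples <= T) (lens : all (fun t : sample n => t.2.1 <= 2) samples).
Hypotheses (CsN : size Cs <= N) (Cs_uniq : all uniq Cs).

Definition bVAL M := bitlen M + 2 * bitlen T.

Lemma part_le M e x s : size s <= M -> bitlen (part e x s) <= bVAL M.
Proof.
move=> sM; apply: (@leq_trans (bitlen (M * (T * T)))); last first.
  by have := bitlenM M (T * T); have := bitlenM T T; rewrite /bVAL; lia.
apply: bitlen_mono; apply: (@leq_trans (\sum_(a <- s) T * T)).
  rewrite /part big_mkcond; apply: leq_sum => a _; case: ifP => // _.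
  exact: eigenvalue_estimate_le.
by rewrite big_const_seq count_predT iter_addn_0 mulnC leq_mul2r sM orbT.
Qed.

Definition cVAL M := M * (cSIGN0 n + 2 * cFHAT n T + 2 * (bVAL M + 2 * bitlen T) + 100) + 7.

Lemma ev_VAL M x s : size s <= M -> size x <= n -> (forall a, a \in s -> size a <= n) ->
  evf fVAL (Node (Node (enca x) (encd samples)) (encaa s))
    (Node (Leaf (part false x s)) (Leaf (part true x s))) (cVAL M).
Proof.
move=> sM xn sizes; apply: ev_conv.
- apply: (evf_loop_le (V := fun s => Node (Leaf (part false x s)) (Leaf (part true x s)))
    (c := cSIGN0 n + 2 * cFHAT n T + 2 * (bVAL M + 2 * bitlen T) + 88) sM) => //.
    by rewrite /part !big_nil; ev_exact.
  move=> a s' s0 E.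
  have an : size a <= n by apply: sizes; rewrite E mem_cat mem_head orbT.
  have s'M : size s' <= M by apply: leq_trans sM; rewrite E size_cat /=; lia.
  have eb : bitlen (eigenvalue_estimate a samples) <= 2 * bitlen T.
    apply: leq_trans (bitlen_mono (eigenvalue_estimate_le a samplesT)) _.
    by have := bitlenM T T; lia.
  pose w := Node (Leaf (part false x (a :: s'))) (Leaf (part true x (a :: s'))).
  apply: ev_conv.
  + apply: (ev_ite (w := w)); first by ev_step ltac:(exact: ev_SIGN0).
    * rewrite /= => sg; apply: ev_conv; first by ev_step ltac:(exact: (ev_FHAT samplesT an lens)).
        rewrite /w /part !big_cons /=; move: sg; case: (sign_on _ a) => //= _.
        by rewrite addnC.
      exact: leqnn.
    * rewrite /= => sg; apply: ev_conv; first by ev_step ltac:(exact: (ev_FHAT samplesT an lens)).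
        rewrite /w /part !big_cons /=; move: sg; case: (sign_on _ a) => //= _.
        by rewrite addnC.
      exact: leqnn.
  + by [].
  + rewrite /=; have := part_le true x s'M; have := part_le false x s'M; lia.
- by [].
- by rewrite /cVAL; lia.
Qed.

Definition cSNDS := n * 40 + 5.

Lemma ev_SNDS v x : size x <= n ->
  evf fSNDS (Node v (enca x)) (enc_list enc_letter (unzip2 x)) cSNDS.
Proof.
move=> xn; apply: ev_conv.
- apply: (evf_loop_le (V := fun x => enc_list enc_letter (unzip2 x)) (c := 28) xn) => //; first by ev_exact.
  by move=> y s' s0 _; apply: ev_conv; first ev_step idtac.
- by [].
- by rewrite /cSNDS; lia.
Qed.

Definition cROWS M := M * (cSNDS + 2 * (cVAL M + 3 * bVAL M + 100) + 60) + 5.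

Let enc_row (r : seq letter * (nat * nat)) : data :=
  Node (enc_list enc_letter r.1) (Node (Leaf r.2.1) (Leaf r.2.2)).

Lemma ev_ROWS M (o : bool) S l : size (asg (clos S Cs)) <= M -> size (asg l) <= M ->
  size (clos S Cs) <= n -> size l <= n ->
  evf fROWS (Node (Node (Leaf o) (Node (encaa (asg (clos S Cs))) (encd samples))) (encaa (asg l)))
    (enc_list enc_row [seq (unzip2 x, if o then (1, local_estimate S x) else (local_estimate S x, 1))
      | x <- asg l]) (cROWS M).
Proof.
move=> cM lM cn ln; set F := fun x => _; apply: ev_conv.
- apply: (evf_loop_le (V := fun xs => enc_list enc_row [seq F x | x <- xs])
    (c := cSNDS + 2 * (cVAL M + 3 * bVAL M + 100) + 48) lM) => //; first by ev_exact.
  move=> x s' s0 E.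
  have xn : size x <= n.
    by rewrite (@size_mem_asg _ l) // E mem_cat mem_head orbT.
  have an a : a \in asg (clos S Cs) -> size a <= n by move=> /size_mem_asg ->.
  have g0 := part_le false x cM; have g1 := part_le true x cM.
  have gd : bitlen (part false x (asg (clos S Cs)) - part true x (asg (clos S Cs))) <= bVAL M.
    by apply: leq_trans g0; apply: bitlen_mono; exact: leq_subr.
  have EG : local_estimate S x = part false x (asg (clos S Cs)) - part true x (asg (clos S Cs)) + 1.
    by rewrite addn1.
  apply: ev_conv.
  + apply: ev_cons; last exact: ev_var.
    apply: ev_cons; first by ev_step ltac:(exact: ev_SNDS).
    apply: (ev_ite (w := Node (Leaf (F x).2.1) (Leaf (F x).2.2))); first by ev_step idtac.
    * rewrite /F /= => o1; apply: ev_conv.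
      - ev_step idtac; first exact: (ev_VAL cM xn an). exact: ev_DIFF.
      - by rewrite /=; case: (o) o1 => // _; rewrite EG.
      - exact: leqnn.
    * rewrite /F /= => o1; apply: ev_conv.
      - ev_step idtac; first exact: (ev_VAL cM xn an). exact: ev_DIFF.
      - by rewrite /=; case: (o) o1 => // _; rewrite EG.
      - exact: leqnn.
  + by [].
  + have b1 := bitlen_leS 1; rewrite /=; lia.
- by [].
- by rewrite /cROWS; lia.
Qed.

Definition cPAR := 2 * cLEN n + 10 * n + 80.

Lemma ev_PAR D S : size D <= n -> size S <= n ->
  evf fPAR (Node (encs D) (encs S)) (Leaf (odd (size D - size S))) cPAR.
Proof.
move=> Dn Sn; apply: ev_conv.
- rewrite /evf /=; apply: ev_let.
    by ev_step ltac:(first [exact: (ev_LEN _ _ Dn)|exact: (ev_LEN _ _ Sn)]).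
  by ev_step idtac.
- rewrite /=; congr Leaf; rewrite -modn2.
  by rewrite {1}(divn_eq (size D - size S) 2) addnC addnK.
- have b2 := bitlen_leS 2; rewrite /=.
  have b m : m <= n -> bitlen m <= n.+1 by move=> mn; apply: leq_trans (bitlen_leS _) _.
  have h1 := b _ Dn; have h2 := b _ Sn.
  have h3 : bitlen (size D - size S) <= n.+1 by apply: b; lia.
  have h4 : bitlen ((size D - size S) %/ 2) <= n.+1 by apply: b; apply: leq_trans (leq_div _ _) _; lia.
  have h5 : bitlen ((size D - size S) %/ 2 * 2) <= n.+1.
    by apply: b; apply: leq_trans (leq_trunc_div _ _) _; lia.
  by rewrite /cPAR; lia.
Qed.

Hypothesis factor_size : forall c, c \in Cs -> size c <= k.
Hypothesis clos_size : forall c S, c \in Cs -> subseq S c -> size (clos S Cs) <= k.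

Definition cTABS := 2 ^ k * (cPAR + cCLOS n N + 2 * cASG k + cROWS (4 ^ k) + 100) + 8.

(** Every set that occurs has at most [k] qubits, its closure included, so tables have at most
    [4 ^ k] rows and Fourier sums at most [4 ^ k] terms. *)
Lemma ev_TABS c D acc : c \in Cs -> subseq D c ->
  evf fTABS (Node (Node (encs D) (Node (enct acc) (Node (encss Cs) (encd samples)))) (encss (subs D)))
    (enct ([seq local_table (odd (size D - size U)) U | U <- subs D] ++ acc)) cTABS.
Proof.
move=> cC Dc.
have cu : uniq c by move/allP: Cs_uniq; apply.
have Du : uniq D := subseq_uniq Dc cu.
have Dk : size D <= k := leq_trans (size_subseq Dc) (factor_size cC).
have sDk : size (subs D) <= 2 ^ k by rewrite size_subs leq_exp2l.
apply: ev_conv.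
- apply: (evf_loop_le (V := fun Ss => enct ([seq local_table (odd (size D - size U)) U | U <- Ss] ++ acc))
    (c := cPAR + cCLOS n N + 2 * cASG k + cROWS (4 ^ k) + 88) sDk) => //; first by ev_exact.
  move=> S s' s0 E.
  have SD : subseq S D by rewrite -subs_subseq E mem_cat mem_head orbT.
  have Su := subseq_uniq SD Du.
  have Sk : size S <= k := leq_trans (size_subseq SD) Dk.
  have ck : size (clos S Cs) <= k by apply: clos_size cC _; exact: subseq_trans Dc.
  have clu : uniq (clos S Cs) by exact: clos_uniq.
  apply: ev_conv.
  + ev_step idtac.
    * by apply: ev_PAR; exact: size_uniq_ord.
    * exact: (ev_CLOS CsN Su Cs_uniq).
    * exact: (ev_ASG _ ck).
    * exact: (ev_ASG _ Sk).
    * apply: (@ev_ROWS (4 ^ k) (odd (size D - size S)) S S); rewrite ?size_asg ?leq_exp2l //; exact: size_uniq_ord.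
  + by [].
  + by lia.
- by [].
- by rewrite /cTABS; lia.
Qed.

Definition cDLOOP := 2 ^ k * (cINREST n N + cTABS + cSUBS k + 100) + 8.

Lemma ev_DLOOP c rest acc : c \in Cs -> size rest <= N -> all uniq rest ->
  evf fDLOOP (Node (Node (encss rest) (Node (enct acc) (Node (encss Cs) (encd samples)))) (encss (subs c)))
    (enct (foldr (fun D acc => if (D != [::]) && ~~ has (fun c => all (mem c) D) rest then
                          [seq local_table (odd (size D - size U)) U | U <- subs D] ++ acc
                        else acc) acc (subs c))) cDLOOP.
Proof.
move=> cC restN ru; set F := fun D acc => _.
have cu : uniq c by move/allP: Cs_uniq; apply.
have sck : size (subs c) <= 2 ^ k by rewrite size_subs leq_exp2l // factor_size.
apply: ev_conv.
- apply: (evf_loop_le (V := fun Ds => enct (foldr F acc Ds))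
    (c := cINREST n N + cTABS + cSUBS k + 88) sck) => //; first by ev_exact.
  move=> D s' s0 E.
  have Dc : subseq D c by rewrite -subs_subseq E mem_cat mem_head orbT.
  have Dn : size D <= n by apply: size_uniq_ord; exact: subseq_uniq cu.
  have Dk : size D <= k := leq_trans (size_subseq Dc) (factor_size cC).
  pose w := enct (foldr F acc (D :: s')).
  apply: ev_conv.
  + apply: (ev_ite (w := w)); first by ev_step idtac.
    * rewrite /= => D0; apply: (ev_ite (w := w)).
      - by ev_step ltac:(exact: (ev_INREST restN Dn ru)).
      - move=> hh; rewrite /w; have -> : foldr F acc (D :: s') = foldr F acc s'; last exact: ev_var.
        by transitivity (F D (foldr F acc s')) => //; rewrite {1}/F; move: hh; rewrite /=; case: (has _ rest) => // _; rewrite andbF.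
      - move=> nh; apply: ev_conv; first ev_step idtac.
        + exact: ev_SUBS Dk.
        + exact: ev_TABS cC Dc.
        + rewrite /w; congr (enc_list _ _).
          have nohas : has (fun c => all (mem c) D) rest = false.
            by move: nh; rewrite /=; case: (has _ rest).
          apply/esym; transitivity (F D (foldr F acc s')) => //.
          by rewrite {1}/F nohas; case: (D) D0.
        + exact: leqnn.
    * rewrite /= => D0; rewrite /w; have -> : foldr F acc (D :: s') = foldr F acc s'; last exact: ev_var.
      by transitivity (F D (foldr F acc s')) => //; rewrite {1}/F; case: (D) D0.
  + by [].
  + by lia.
- by [].
- by rewrite /cDLOOP; lia.
Qed.

Definition cFAC := N * (cDLOOP + cSUBS k + 60) + 5.

Lemma ev_FAC : evf fFAC (Node (Node (encss Cs) (encd samples)) (encss Cs)) (enct (output Cs)) cFAC.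
Proof.
apply: ev_conv.
- apply: (evf_loop_le (V := fun cs => enct (output cs)) (c := cDLOOP + cSUBS k + 48) CsN) => //; first by ev_exact.
  move=> c s' s0 E.
  have cC : c \in Cs by rewrite E mem_cat mem_head orbT.
  apply: ev_conv.
  + ev_step idtac; first exact: ev_SUBS (factor_size cC).
    apply: (ev_DLOOP (output s') cC).
      by apply: leq_trans CsN; rewrite E size_cat /=; lia.
    by move: Cs_uniq; rewrite E all_cat /= => /and3P[].
  + by [].
  + by lia.
- by [].
- by rewrite /cFAC; lia.
Qed.

Lemma estimator_runs v : exists2 t,
  runs estimator (Node v (Node (encss Cs) (encd samples))) (enct (output Cs)) t & t <= cFAC + 20.
Proof.
have [t et tb] : evf fMAIN (Node v (Node (encss Cs) (encd samples))) (enct (output Cs)) (cFAC + 20).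
  apply: ev_conv; first by rewrite /evf /= /eMAIN; ev_step ltac:(exact: ev_FAC).
    by [].
  by lia.
by exists t.
Qed.

End Output.

(** * Polynomial growth of the cost expressions *)

Definition scale (n T : nat) := n.+1 * bitlen T.

Definition polylog (f : nat -> nat -> nat) :=
  exists K, forall n T, f n T <= K * scale n T ^ K.

(** The running time is to be linear in [T] up to logarithms, so a product may contain at most one
    factor of this kind; the others must be [polylog]. *)
Definition linlog (f : nat -> nat -> nat) :=
  exists K, forall n T, f n T <= K * scale n T ^ K * T.+1.

Lemma scale_gt0 n T : 0 < scale n T.
Proof. by rewrite muln_gt0. Qed.

Lemma scale_mono n T K L : K <= L -> scale n T ^ K <= scale n T ^ L.
Proof. exact: leq_pexp2l (scale_gt0 n T). Qed.

Lemma polylog_const c : polylog (fun _ _ => c).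
Proof. by exists c => n T; rewrite -{1}[c]muln1 leq_mul2l expn_gt0 scale_gt0 orbT. Qed.

Lemma polylog_n : polylog (fun n _ => n).
Proof. by exists 1 => n T; rewrite mul1n expn1 /scale (leq_trans (leqnSn n)) // leq_pmulr. Qed.

Lemma polylog_bitlen : polylog (fun _ T => bitlen T).
Proof. by exists 1 => n T; rewrite mul1n expn1 /scale leq_pmull. Qed.

Lemma polylog_add f g : polylog f -> polylog g -> polylog (fun n T => f n T + g n T).
Proof.
move=> [K Kf] [L Lg]; exists (K + L) => n T; rewrite mulnDl leq_add //.
  by apply: leq_trans (Kf n T) _; rewrite leq_mul2l scale_mono ?orbT // leq_addr.
by apply: leq_trans (Lg n T) _; rewrite leq_mul2l scale_mono ?orbT // leq_addl.
Qed.

Lemma polylog_mul f g : polylog f -> polylog g -> polylog (fun n T => f n T * g n T).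
Proof.
move=> [K Kf] [L Lg]; exists (K * L + (K + L)) => n T.
apply: leq_trans (leq_mul (Kf n T) (Lg n T)) _.
by rewrite mulnACA -expnD leq_mul ?leq_addr // scale_mono // leq_addl.
Qed.

Lemma linlog_add f g : linlog f -> linlog g -> linlog (fun n T => f n T + g n T).
Proof.
move=> [K Kf] [L Lg]; exists (K + L) => n T; rewrite !mulnDl leq_add //.
  by apply: leq_trans (Kf n T) _; rewrite leq_mul2r leq_mul2l scale_mono ?orbT // leq_addr.
by apply: leq_trans (Lg n T) _; rewrite leq_mul2r leq_mul2l scale_mono ?orbT // leq_addl.
Qed.

Lemma linlog_mul f g : polylog f -> linlog g -> linlog (fun n T => f n T * g n T).
Proof.
move=> [K Kf] [L Lg]; exists (K * L + (K + L)) => n T.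
apply: leq_trans (leq_mul (Kf n T) (Lg n T)) _.
by rewrite mulnA leq_mul2r mulnACA -expnD leq_mul ?leq_addr ?orbT // scale_mono // leq_addl.
Qed.

Lemma linlog_polylog f : polylog f -> linlog f.
Proof. by move=> [K Kf]; exists K => n T; rewrite (leq_trans (Kf n T)) // leq_pmulr. Qed.

Lemma linlog_T f : polylog f -> linlog (fun n T => T * f n T).
Proof. by move=> [K Kf]; exists K => n T; rewrite mulnC leq_mul. Qed.

Ltac poly := repeat first
  [ exact: polylog_const | exact: polylog_n | exact: polylog_bitlen
  | apply: polylog_add | apply: polylog_mul ].

(** Linear in [T] because only [fLEN] and [fCNT] traverse the list of runs and neither calls the
    other. The number of factors has been replaced by its bound [n * 2 ^ nu + 1]. *)
Lemma cFAC_linlog nu : linlog (fun n T => cFAC n (n * 2 ^ nu + 1) T nu + 20).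
Proof.
have cnt : linlog (fun n T => cCNT n T).
  rewrite /cCNT /cMATCH /cSIGN /cNTH; apply: linlog_add; last by apply: linlog_polylog; poly.
  by apply: linlog_T; poly.
have len : linlog (fun _ T => cLEN T).
  rewrite /cLEN; apply: linlog_add; last by apply: linlog_polylog; poly.
  by apply: linlog_T; poly.
have fh : linlog (fun n T => cFHAT n T).
  rewrite /cFHAT; apply: linlog_add; last by apply: linlog_polylog; poly.
  apply: linlog_add; last by apply: linlog_polylog; poly.
  apply: linlog_add; first exact: len.
  by apply: linlog_mul; [poly|exact: cnt].
have rows M : linlog (fun n T => cROWS n T M).
  rewrite /cROWS /cVAL /bVAL /cSIGN0 /cLOOKUP /cSNDS.
  apply: linlog_add; last by apply: linlog_polylog; poly.
  apply: linlog_mul; first by poly.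
  apply: linlog_add; last by apply: linlog_polylog; poly.
  apply: linlog_add; first by apply: linlog_polylog; poly.
  apply: linlog_mul; first by poly.
  apply: linlog_add; last by apply: linlog_polylog; poly.
  apply: linlog_add; last by apply: linlog_polylog; poly.
  apply: linlog_add; last by apply: linlog_polylog; poly.
  apply: linlog_mul; first by poly.
  apply: linlog_add; last by apply: linlog_polylog; poly.
  apply: linlog_add; last by apply: linlog_polylog; poly.
  apply: linlog_add; first by apply: linlog_polylog; poly.
  by apply: linlog_mul => //; poly.
have lenn : polylog (fun n _ => cLEN n).
  rewrite /cLEN; apply: polylog_add; last by poly.
  apply: polylog_mul; first by poly.
  apply: polylog_add; last by poly.
  exists 1 => n T; rewrite mul1n expn1; apply: leq_trans (bitlen_leS n) _.
  by rewrite /scale leq_pmulr.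
have tabs : linlog (fun n T => cTABS n (n * 2 ^ nu + 1) T nu).
  rewrite /cTABS /cPAR /cCLOS /cMEETS /cUNION /cMEM /cASG.
  apply: linlog_add; last by apply: linlog_polylog; poly.
  apply: linlog_mul; first by poly.
  apply: linlog_add; last by apply: linlog_polylog; poly.
  apply: linlog_add => //; apply: linlog_polylog.
  by repeat first [exact: lenn | exact: polylog_const | exact: polylog_n | apply: polylog_add | apply: polylog_mul].
rewrite /cFAC /cDLOOP /cINREST /cSUBSET /cMEM /cSUBS.
apply: linlog_add; last by apply: linlog_polylog; poly.
apply: linlog_add; last by apply: linlog_polylog; poly.
apply: linlog_mul; first by poly.
apply: linlog_add; last by apply: linlog_polylog; poly.
apply: linlog_add; last by apply: linlog_polylog; poly.
apply: linlog_add; last by apply: linlog_polylog; poly.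
apply: linlog_mul; first by poly.
apply: linlog_add; last by apply: linlog_polylog; poly.
apply: linlog_add; last by apply: linlog_polylog; poly.
by apply: linlog_add => //; apply: linlog_polylog; poly.
Qed.

Lemma cFAC_time nu : exists k, forall n N T, N <= n * 2 ^ nu + 1 ->
  cFAC n (n * 2 ^ nu + 1) T nu + 20 <= k * n.+1 ^ k * (T.+1 * bitlen T ^ k).
Proof.
have [k H] := cFAC_linlog nu; exists k => n N T _.
by apply: leq_trans (H n T) _; rewrite /scale expnMn; lia.
Qed.

(** * The twirled channel and the law of a sample *)

Local Open Scope ring_scope.
Local Open Scope complex_scope.

Section Twirl.
Variables (R : realType) (n : nat).
Implicit Types (a b h g : pauli n) (u v w : basis n) (M : op R n).
Local Notation er := (@enum_rank (basis n)).

Lemma hsE M N : hs M N = \sum_i \sum_j Num.conj (M i j) * N i j.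
Proof.
rewrite /hs /mxtrace exchange_big; apply: eq_bigr => j _ /=.
by rewrite mxE; apply: eq_bigr => i _; rewrite !mxE.
Qed.

Lemma hs_sumr (I : finType) (c : I -> R[i]) (F : I -> op R n) M :
  hs M (\sum_i c i *: F i) = \sum_i c i * hs M (F i).
Proof.
rewrite /hs mulmx_sumr linear_sum; apply: eq_bigr => i _.
by rewrite -scalemxAr linearZ.
Qed.

Lemma hsZr (c : R[i]) M N : hs M (c *: N) = c * hs M N.
Proof. by rewrite /hs -scalemxAr linearZ. Qed.

Lemma hsZl (c : R[i]) M N : hs (c *: M) N = Num.conj c * hs M N.
Proof.
rewrite !hsE mulr_sumr; apply: eq_bigr => i _; rewrite mulr_sumr; apply: eq_bigr => j _.
by rewrite mxE rmorphM mulrA.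
Qed.

Lemma adjE m k (A : 'M[R[i]]_(m, k)) i j : adj A i j = Num.conj (A j i).
Proof. by rewrite !mxE. Qed.

Lemma hs_pauli_op h M :
  hs (pauli_op R h) M =
  Num.conj (phase R h) * \sum_w chi _ (zpart h) w * M (er (w + xpart h)) (er w).
Proof.
rewrite hsE exchange_big sum_basis mulr_sumr; apply: eq_bigr => w _.
rewrite sum_basis (bigD1 (w + xpart h)) //= big1 ?addr0 => [|u uw].
  by rewrite pauli_opE eqxx mulr1 rmorphM /= chi_conj mulrA.
by rewrite pauli_opE (negbTE uw) mulr0 mul0r conjC0 mul0r.
Qed.

(** Each of the two matrix products has a single nonzero term, and the phases cancel against their
    conjugates. *)
Lemma conj_pauli_opE g M u v :
  (pauli_op R g *m M *m adj (pauli_op R g)) (er u) (er v) =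
  chi _ (zpart g) (u + v) * M (er (u + xpart g)) (er (v + xpart g)).
Proof.
have shift w : w = (w + xpart g) + xpart g by rewrite -addrA basis_addxx addr0.
rewrite mxE sum_basis (bigD1 (v + xpart g)) //= [X in _ + X]big1 ?addr0 => [|w wv]; last first.
  rewrite adjE pauli_opE (_ : (v == _) = false) ?mulr0 ?mul0r ?conjC0 ?mulr0 //.
  by apply: contraNF wv => /eqP ->; rewrite -shift.
rewrite mxE sum_basis (bigD1 (u + xpart g)) //= [X in _ + X]big1 ?addr0 => [|w wu]; last first.
  rewrite pauli_opE (_ : (u == _) = false) ?mulr0 ?mul0r //.
  by apply: contraNF wu => /eqP ->; rewrite -shift.
rewrite adjE !pauli_opE -!shift !eqxx !mulr1 rmorphM /= chi_conj !chiD.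
transitivity (phase R g * Num.conj (phase R g) * (chi _ (zpart g) (xpart g) * chi _ (zpart g) (xpart g))
  * chi _ (zpart g) u * chi _ (zpart g) v * M (er (u + xpart g)) (er (v + xpart g))).
  by ring.
by rewrite phase_norm chi_sq !mul1r.
Qed.

Lemma norm_const : ((Num.sqrt ((2 ^ n)%:R : R))^-1)%:C ^+ 2 * (4 ^ n)%:R = (2 ^ n)%:R :> R[i].
Proof.
have p2 : (0 < (2 ^ n)%:R :> R) by rewrite ltr0n expn_gt0.
rewrite -rmorphXn /= exprVn sqr_sqrtr ?ltW // -(rmorph_nat (real_complex R)).
rewrite -[RHS](rmorph_nat (real_complex R)) -rmorphM /=; congr (_%:C).
by rewrite (_ : 4 = 2 * 2)%N // expnMn natrM mulrA mulVf ?gt_eqF // mul1r.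
Qed.

Lemma conj_real_complex (x : R) : Num.conj (x%:C) = x%:C.
Proof. by apply/CrealP; rewrite complex_real. Qed.

(** Summing over the Z part of [g] keeps only the entries with [u = v + xpart h], by orthogonality
    of characters; these are the entries where the Pauli [h] is supported. Summing over the X part
    makes them the coefficient of [M] along that Pauli. *)
Lemma twirl h M :
  \sum_g (-1) ^+ symp h g *: (pauli_op R g *m M *m adj (pauli_op R g)) =
  ((4 ^ n)%:R * hs (pauli_ket R h) M) *: pauli_ket R h.
Proof.
apply/matrixP => k l; rewrite -[k]enum_valK -[l]enum_valK.
move: (enum_val k) (enum_val l) => u v {k l}.
rewrite summxE.
under eq_bigr => g _ do rewrite mxE conj_pauli_opE symp_chi.
rewrite (sum_pauli_parts (fun x z => chi _ (xpart h) z * chi _ (zpart h) x *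
  (chi _ z (u + v) * M (er (u + x)) (er (v + x))))).
transitivity ((xpart h + (u + v) == 0)%:R * (2 ^ n)%:R *
    \sum_x chi _ (zpart h) x * M (er (u + x)) (er (v + x))).
  rewrite mulr_sumr; apply: eq_bigr => x _; rewrite -chi_sum mulr_suml.
  by apply: eq_bigr => z _; rewrite chiD [chi _ z (xpart h)]chiC; ring.
rewrite /pauli_ket hsZl hs_pauli_op conj_real_complex mxE mxE pauli_opE.
have -> : (xpart h + (u + v) == 0) = (u == v + xpart h).
  rewrite addrCA; apply/eqP/eqP => [E|->].
    by rewrite -[u]addr0 -(basis_addxx (v + xpart h)) addrA [v + _]addrC E add0r.
  by rewrite [xpart h + v]addrC basis_addxx.
case: eqP => [uE|_]; last by rewrite !(mul0r, mulr0).
rewrite (_ : true%:R = 1 :> R[i]) // !mul1r mulr1.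
transitivity (((Num.sqrt ((2 ^ n)%:R : R))^-1)%:C ^+ 2 * (4 ^ n)%:R *
   (phase R h * Num.conj (phase R h)) * chi _ (zpart h) v *
  \sum_w chi _ (zpart h) w * M (er (w + xpart h)) (er w)); last first.
  by move: (4 ^ n)%:R (\sum_w _) => d4 s; ring.
rewrite norm_const phase_norm mulr1 -mulrA; congr (_ * _).
rewrite [in RHS](reindex_inj (addrI v)) mulr_sumr; apply: eq_bigr => x _ /=.
rewrite chiD uE -[v + x + _]addrA [x + _]addrC addrA.
by rewrite !mulrA chi_sq mul1r.
Qed.

End Twirl.

(** * Positive operators and Hermitian images *)

Section Positivity.
Variables (R : realType) (n : nat).
Implicit Types (M : op R n).

Lemma adjK m k (A : 'M[R[i]]_(m, k)) : adj (adj A) = A.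
Proof. by apply/matrixP => i j; rewrite !adjE conjCK. Qed.

Lemma adj_mul m k l (A : 'M[R[i]]_(m, k)) (B : 'M[R[i]]_(k, l)) :
  adj (A *m B) = adj B *m adj A.
Proof. by rewrite /adj map_mxM trmx_mul. Qed.

Lemma adjD m k (A B : 'M[R[i]]_(m, k)) : adj (A + B) = adj A + adj B.
Proof. by apply/matrixP => i j; rewrite !mxE rmorphD. Qed.

Lemma adjZ m k c (A : 'M[R[i]]_(m, k)) : adj (c *: A) = Num.conj c *: adj A.
Proof. by apply/matrixP => i j; rewrite !mxE rmorphM. Qed.

Lemma adj_delta k (i : 'I_k) (A : 'M[R[i]]_k) j :
  (adj (delta_mx i 0 : 'cV_k) *m A *m delta_mx j (0 : 'I_1)) 0 0 = A i j.
Proof.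
rewrite (_ : adj _ = delta_mx 0 i); first by rewrite -rowE -colE !mxE.
by apply/matrixP => a b; rewrite !mxE rmorph_nat andbC.
Qed.

Lemma addr_rot (V : zmodType) (x y z t : V) : x + y + (z + t) = x + t + (z + y).
Proof. by rewrite -!addrA; congr (_ + _); rewrite addrCA [RHS]addrCA; congr (_ + _); rewrite addrC. Qed.

(** Polarization: the form on [v + c *: w] relates the entries [B i j] and [B j i] for every complex
    [c]. *)
Lemma form_eq0 k (B : 'M[R[i]]_k) :
  (forall v : 'cV_k, (adj v *m B *m v) 0 0 = 0) -> B = 0.
Proof.
move=> B0; apply/matrixP => i j; rewrite [RHS]mxE.
set v : 'cV[R[i]]_k := delta_mx i 0; set w : 'cV[R[i]]_k := delta_mx j 0.
have pol (c : R[i]) : Num.conj c * B j i + c * B i j = 0.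
  have := B0 (v + c *: w).
  have -> : adj (v + c *: w) *m B *m (v + c *: w) =
      (adj v *m B *m v + (Num.conj c * c) *: (adj w *m B *m w)) +
      (Num.conj c *: (adj w *m B *m v) + c *: (adj v *m B *m w)).
    rewrite adjD adjZ !mulmxDl !mulmxDr -!scalemxAl -!scalemxAr scalerA.
    exact: addr_rot.
  have entries (X Y Z W : 'M[R[i]]_1) (d e f : R[i]) : X 0 0 = 0 -> Y 0 0 = 0 ->
      ((X + d *: Y) + (e *: Z + f *: W)) 0 0 = e * Z 0 0 + f * W 0 0.
    by move=> X0 Y0; rewrite !mxE X0 Y0 mulr0 !add0r.
  by rewrite entries ?B0 // !adj_delta.
(* The case [c = 1] gives [B j i = - B i j]; inserted into the case [c = 'i] this gives
   [2 * 'i * B i j = 0]. *)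
have := pol 'i; have := pol 1; rewrite conjC1 conjCi !mul1r => /eqP.
rewrite addr_eq0 => /eqP -> /eqP; rewrite mulNr mulrN opprK -mulr2n mulrn_eq0 /=.
by rewrite mulf_eq0 (negbTE (neq0Ci _)) => /eqP.
Qed.

(** The values of the form of [M] are real, so the form of [adj M - M] vanishes. *)
Lemma psd_adj M : psd M -> adj M = M.
Proof.
move=> Mpsd; apply/eqP; rewrite -subr_eq0; apply/eqP/form_eq0 => v.
have -> : adj v *m (adj M - M) *m v = adj (adj v *m M *m v) - adj v *m M *m v.
  by rewrite mulmxBr mulmxBl !adj_mul adjK mulmxA.
rewrite mxE [X in _ + X]mxE adjE.
by have /ger0_real/CrealP -> := Mpsd v; rewrite subrr.
Qed.

Lemma psd_mul_adj M : psd (M *m adj M).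
Proof.
move=> v; rewrite (_ : _ *m _ = adj (adj M *m v) *m (adj M *m v)); last first.
  by rewrite adj_mul adjK !mulmxA.
rewrite mxE; apply: sumr_ge0 => i _; rewrite adjE mulrC -normCK.
by rewrite exprn_ge0.
Qed.

Lemma psd_conj (M N : op R n) : psd M -> psd (N *m M *m adj N).
Proof.
by move=> Mpsd v; have := Mpsd (adj N *m v); rewrite adj_mul adjK !mulmxA.
Qed.

Lemma cp_psd (L : op R n -> op R n) M : completely_positive L -> psd M -> psd (L M).
Proof.
move=> cp Mpsd v; have := cp 1 (fun _ _ => M).
by move=> /(_ _ (fun _ => v)); rewrite !big_ord1; apply => w; rewrite !big_ord1.
Qed.

(** In an orthonormal eigenbasis of [A] the trace is the sum of eigenvalues of [A] times diagonal
    entries of [B], all nonnegative. *)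
Lemma tr_psd_ge0 (A B : op R n) : psd A -> psd B -> 0 <= \tr (A *m B).
Proof.
move=> Apsd Bpsd; have Aadj := psd_adj Apsd.
have Ah : A \is hermsymmx.
  apply/is_hermitianmxP; rewrite expr0 scale1r -{1}Aadj.
  by apply/matrixP => i j; rewrite !mxE.
have := hermitian_normalmx Ah => /orthomx_spectralP.
set P := spectralmx A; set D := spectral_diag A => AE.
have Pu : P \is unitarymx := spectral_unitarymx A.
have PV : invmx P = adj P.
  by rewrite invmx_unitary //; apply/matrixP => i j; rewrite !mxE.
have PP : P *m adj P = 1%:M by rewrite -PV mulmxV // spectral_unit.
have DE : P *m A *m adj P = diag_mx D.
  by rewrite AE PV -!mulmxA PP mulmx1 !mulmxA PP mul1mx.
have diag_ge0 (M : op R n) (i : 'I_#|basis n|) : psd M -> 0 <= (P *m M *m adj P) i i.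
  by move=> Mpsd; have := psd_conj P Mpsd (delta_mx i 0); rewrite adj_delta.
have -> : \tr (A *m B) = \tr (diag_mx D *m (P *m B *m adj P)).
  transitivity (\tr (adj P *m (diag_mx D *m P *m B))).
    by congr (\tr _); rewrite {1}AE PV !mulmxA.
  by rewrite mxtrace_mulC; congr (\tr _); rewrite !mulmxA.
rewrite /mxtrace; apply: sumr_ge0 => i _; rewrite mul_diag_mx mxE mulr_ge0 //; last exact: diag_ge0.
  by have := diag_ge0 A i Apsd; rewrite DE mxE eqxx mulr1n.
Qed.

(** For Hermitian [M] the square of [1 + M] is [1 + M^2 + 2 M]. This writes [2 M] as a combination
    of positive operators, whose images are positive and hence Hermitian. *)
Lemma cp_adj (L : op R n -> op R n) M :
  (forall A B : op R n, L (A + B) = L A + L B) -> completely_positive L -> adj M = M -> adj (L M) = L M.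
Proof.
move=> LD cp Mh; have psd1 : psd (1%:M : op R n).
  by have := @psd_mul_adj 1%:M; rewrite mul1mx (_ : adj 1%:M = 1%:M) //;
     apply/matrixP => i j; rewrite !mxE rmorph_nat eq_sym.
have sq : (1%:M + M) *m adj (1%:M + M) = 1%:M + M *m adj M + (M + M).
  rewrite adjD Mh (_ : adj 1%:M = 1%:M); last first.
    by apply/matrixP => i j; rewrite !mxE rmorph_nat eq_sym.
  by rewrite mulmxDl !mulmxDr !mul1mx mulmx1 -!addrA; congr (_ + _);
     rewrite addrA addrC.
have := psd_adj (cp_psd cp (psd_mul_adj (1%:M + M))).
 rewrite sq !LD !adjD.
rewrite (psd_adj (cp_psd cp psd1)) (psd_adj (cp_psd cp (psd_mul_adj M))).
move/addrI => /matrixP E; apply/matrixP => i j; move: (E i j).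
by rewrite [LHS]mxE [RHS]mxE -[LHS]mulr2n -[RHS]mulr2n => /eqP; rewrite eqr_pMn2r // => /eqP.
Qed.

Lemma pauli_ket_adj (a : pauli n) : adj (pauli_ket R a) = pauli_ket R a.
Proof.
rewrite /pauli_ket adjZ conj_real_complex; congr (_ *: _).
apply/matrixP => k l; rewrite -[k]enum_valK -[l]enum_valK adjE !pauli_opE.
move: (enum_val k) (enum_val l) => u v; rewrite rmorphM rmorphM /= chi_conj phase_conj rmorph_nat.
have -> : (v == u + xpart a) = (u == v + xpart a).
  by apply/eqP/eqP => ->; rewrite -addrA basis_addxx addr0.
case: eqP => [->|_]; last by rewrite !mulr0 !mul0r.
by rewrite chiD !mulr1 -mulrA [X in _ * X]mulrC -[X in _ * X]mulrA chi_sq mulr1.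
Qed.

Lemma hs_conj (A B : op R n) : adj A = A -> adj B = B -> Num.conj (hs A B) = hs A B.
Proof.
move=> Ah Bh; rewrite /hs Ah; transitivity (\tr (adj (A *m B))).
  by rewrite /mxtrace rmorph_sum; apply: eq_bigr => i _; rewrite adjE.
by rewrite adj_mul Ah Bh mxtrace_mulC.
Qed.

End Positivity.

Lemma sympC n (a b : pauli n) : symp a b = symp b a.
Proof. by apply: eq_bigr => j _; rewrite addrC mulrC [X in _ + X]mulrC. Qed.

Lemma sympDr n (h a b : pauli n) : symp h (a + b) = symp h a + symp h b.
Proof.
rewrite -big_split; apply: eq_bigr => j _; rewrite !ffunE /= !mulrDr.
exact: addrACA.
Qed.

Lemma symp0 n (h : pauli n) : symp h 0 = 0.
Proof. by apply: big1 => j _; rewrite ffunE !mulr0 addr0. Qed.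

Lemma sgn_sympC (R : realType) n (a b : pauli n) : sgn_symp R a b = sgn_symp R b a.
Proof. by rewrite /sgn_symp sympC. Qed.

Lemma syndromeP n (S : {set pauli n}) b :
  reflect (exists a, b = syndrome_class S a) (b \in syndromes S).
Proof. by apply: (iffP imsetP) => [[a _]|[a]] ->; exists a. Qed.

(** Members of a class differ by elements of the centralizer, which have symplectic product 0 with
    [h]; the choice made by [rep] is therefore harmless. *)
Lemma rep_syndrome n (S : {set pauli n}) h a :
  h \in S -> symp h (rep (syndrome_class S a)) = symp h a.
Proof.
move=> hS; rewrite /rep; case: pickP => [x|/(_ a)] /=.
  case/imsetP => c; rewrite inE => /forall_inP /(_ h hS) /eqP E ->.
  by rewrite sympDr [symp h c]sympC E addr0.
case/imsetP; exists 0; last by rewrite addr0.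
by rewrite inE; apply/forall_inP => s _; rewrite sympC symp0.
Qed.

Lemma syndrome_shift n (S : {set pauli n}) (a d : pauli n) :
  [set x + d | x : pauli n in syndrome_class S a] = syndrome_class S (a + d).
Proof.
rewrite /syndrome_class -imset_comp; apply: eq_imset => x /=.
by rewrite addrAC.
Qed.

(** * Expectation of the sign of a returned class *)

Section Sampling.
Variables (R : realType) (n : nat) (L : op R n -> op R n).
Hypotheses (LD : forall A B : op R n, L (A + B) = L A + L B)
  (LZ : forall c (A : op R n), L (c *: A) = c *: L A).
Variables (rho : {set pauli n} -> op R n) (E : {set pauli n} -> {set pauli n} -> op R n).
Implicit Types (a b h g : pauli n) (M : op R n).

Definition noisy_gate M g := pauli_op R g *m L M *m adj (pauli_op R g).

(** Up to the factor [4 ^ n], a noisy gate summed with the signs of [h]: the noise followed by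
    projection onto the Pauli [h]. *)
Let filtered h M := hs (pauli_ket R h) (L M) *: pauli_ket R h.

Lemma iter_filtered_sum h k (I : finType) (c : I -> R[i]) (F : I -> op R n) :
  iter k (filtered h) (\sum_i c i *: F i) = \sum_i c i *: iter k (filtered h) (F i).
Proof.
have L0 : L 0 = 0 by rewrite -[X in L X](scale0r (0 : op R n)) LZ scale0r.
elim: k => // k IH; rewrite iterS IH {1}/filtered (big_morph L LD L0).
rewrite (eq_bigr _ (fun x _ => LZ _ _)) hs_sumr scaler_suml; apply: eq_bigr => x _.
by rewrite iterS /filtered scalerA.
Qed.

(** The sign is multiplicative in the gates, so the gate applied first can be summed by [twirl] on
    its own; linearity carries this sum through the remaining gates. *)
Lemma sum_noisy_gates h k M :
  \sum_(a : k.-tuple (pauli n)) (-1) ^+ symp h (\sum_(i < k) tnth a i) *: foldl noisy_gate M a =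
  (4 ^ n)%:R ^+ k *: iter k (filtered h) M.
Proof.
elim: k M => [|k IH] M.
  rewrite (big_pred1 [tuple]) => [|a]; last by apply/esym/eqP; exact: tuple0.
  by rewrite big_ord0 symp0 expr0 /= !scale1r.
rewrite (reindex (fun p : pauli n * k.-tuple (pauli n) => [tuple of p.1 :: p.2])) /=; last first.
  exists (fun t => (thead t, [tuple of behead t])) => [[g a]|t] _ /=.
    by congr pair; apply/val_inj.
  by rewrite -tuple_eta.
transitivity (\sum_(g : pauli n) (-1) ^+ symp h g *:
    \sum_(a : k.-tuple (pauli n)) (-1) ^+ symp h (\sum_(i < k) tnth a i) *:
      foldl noisy_gate (noisy_gate M g) a).
  under [RHS]eq_bigr do rewrite scaler_sumr.
  rewrite pair_bigA; apply: eq_bigr => -[g a] _ /=.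
  rewrite scalerA -sign_Z2D -sympDr big_ord_recl tnth0.
  congr ((-1) ^+ symp h (g + _) *: _); apply: eq_bigr => i _.
  by rewrite !(tnth_nth 0).
under eq_bigr do rewrite IH scalerA mulrC -scalerA.
rewrite -scaler_sumr -iter_filtered_sum twirl -scalerA -/(filtered h M).
have := iter_filtered_sum h k (fun _ : 'I_1 => (4 ^ n)%:R) (fun _ => filtered h M).
by rewrite !big_ord1 => ->; rewrite scalerA -exprSr -iterSr.
Qed.

(** Only the first gate meets the prepared state. Each later one acts on a multiple of the Pauli [h]
    and contributes one eigenvalue, which is why [m + 1] gates yield the power [m]. *)
Lemma iter_filteredE h k M :
  iter k.+1 (filtered h) M =
  (hs (pauli_ket R h) (L M) * hs (pauli_ket R h) (L (pauli_ket R h)) ^+ k) *: pauli_ket R h.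
Proof.
have step (c : R[i]) : filtered h (c *: pauli_ket R h) =
    (c * hs (pauli_ket R h) (L (pauli_ket R h))) *: pauli_ket R h.
  by rewrite /filtered; move: (pauli_ket R h) => K; rewrite LZ hsZr.
elim: k => [|k IH]; first by rewrite expr0 mulr1.
by rewrite iterS IH step exprSr mulrA.
Qed.

Lemma Re_sum (I : Type) (r : seq I) (P : pred I) (F : I -> R[i]) :
  complex.Re (\sum_(x <- r | P x) F x) = \sum_(x <- r | P x) complex.Re (F x).
Proof. by apply: (big_morph (@complex.Re R)) => // -[a b] [c d]. Qed.

Lemma Re_realM (x : R) (z : R[i]) : complex.Re (x%:C * z) = x * complex.Re z.
Proof. by case: z => u v /=; rewrite mul0r subr0. Qed.

Hypothesis gtmL : gtm L rho E.

Lemma pauli_eigenvalueE h :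
  hs (pauli_ket R h) (L (pauli_ket R h)) = (pauli_eigenvalue L h)%:C.
Proof.
have [cp _ _] := gtmL.
have : Num.conj (hs (pauli_ket R h) (L (pauli_ket R h))) = hs (pauli_ket R h) (L (pauli_ket R h)).
  by apply: hs_conj; [exact: pauli_ket_adj | exact: (cp_adj LD cp (pauli_ket_adj R h))].
move/CrealP; rewrite /pauli_eigenvalue.
by case: (hs _ _) => u v /complex_realP [w ->].
Qed.

(** Returning [b] shifted by the sum of the gates multiplies the sign of [b] by the sign of that
    sum. The average over gates is then the twirled sequence, and what remains of preparation and
    measurement is the SPAM parameter. *)
Lemma sample_expect (S : {set pauli n}) m h : h \in S ->
  \sum_c sample_prob L rho E S m c * sgn_symp R h (rep c) =
  spam L rho E S h * pauli_eigenvalue L h ^+ m.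
Proof.
move=> hS; rewrite /sample_prob.
under eq_bigr do rewrite -mulrA mulr_suml.
rewrite -mulr_sumr exchange_big /=.
have inner (a : m.+1.-tuple (pauli n)) :
  \sum_c (\sum_(b in syndromes S | [set x + \sum_(i < m.+1) tnth a i | x : pauli n in b] == c)
     complex.Re (hs (E S b) (foldl noisy_gate (rho S) a))) * sgn_symp R h (rep c) =
  \sum_(b in syndromes S) sgn_symp R h (rep b) *
    complex.Re ((-1) ^+ symp h (\sum_(i < m.+1) tnth a i) * hs (E S b) (foldl noisy_gate (rho S) a)).
  under eq_bigr do rewrite big_mkcondr mulr_suml.
  rewrite exchange_big /=; apply: eq_bigr => _ /syndromeP[x ->].
  rewrite syndrome_shift (bigD1 (syndrome_class S (x + \sum_(i < m.+1) tnth a i))) //= eqxx.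
  rewrite [X in _ + X]big1 ?addr0; last by move=> c; rewrite eq_sym => /negbTE ->; rewrite mul0r.
  rewrite {1}/sgn_symp rep_syndrome // sympDr sign_Z2D {1}/sgn_symp rep_syndrome //.
  have -> : (-1) ^+ symp h (\sum_(i < m.+1) tnth a i) = ((-1) ^+ symp h (\sum_(i < m.+1) tnth a i) : R)%:C :> R[i].
    by rewrite rmorphXn rmorphN1.
  by rewrite Re_realM mulrC -mulrA.
under eq_bigr => a _ do rewrite (inner a).
rewrite exchange_big /=.
have total (b : {set pauli n}) : \sum_(a : m.+1.-tuple (pauli n)) sgn_symp R h (rep b) *
    complex.Re ((-1) ^+ symp h (\sum_(i < m.+1) tnth a i) * hs (E S b) (foldl noisy_gate (rho S) a)) =
  (4 ^ n)%:R ^+ m.+1 * pauli_eigenvalue L h ^+ m * (sgn_symp R h (rep b) *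
    complex.Re (hs (E S b) (pauli_ket R h) * hs (pauli_ket R h) (L (rho S)))).
  rewrite -mulr_sumr -Re_sum -hs_sumr sum_noisy_gates iter_filteredE pauli_eigenvalueE.
  move: (pauli_eigenvalue L h) (pauli_ket R h) => f K; rewrite !hsZr.
  have -> : (4 ^ n)%:R ^+ m.+1 * (hs K (L (rho S)) * f%:C ^+ m * hs (E S b) K) =
    ((4 ^ n)%:R ^+ m.+1 * f ^+ m)%:C * (hs (E S b) K * hs K (L (rho S))).
    rewrite rmorphM !rmorphXn rmorph_nat /=.
    by move: (4 ^ n)%:R (hs K _) (f%:C) (hs _ K) => d4 x y z; ring.
  by rewrite Re_realM; ring.
under eq_bigr do rewrite total.
rewrite -mulr_sumr mulrA mulrA mulVf ?mul1r; last first.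
  by rewrite expf_neq0 // pnatr_eq0 -lt0n expn_gt0.
by rewrite mulrC.
Qed.

Lemma sample_prob_ge0 (S : {set pauli n}) m c : stabilizer_group S -> 0 <= sample_prob L rho E S m c.
Proof.
move=> stab; have [cp _ /(_ S stab) [[rho_psd _] [Epsd _]]] := gtmL.
apply: mulr_ge0; first by rewrite invr_ge0 exprn_ge0.
apply: sumr_ge0 => a _; apply: sumr_ge0 => b /andP[bS _].
have fold_psd (s : seq (pauli n)) M : psd M -> psd (foldl noisy_gate M s).
  elim: s M => // g s IH M Mpsd; apply: IH; rewrite /noisy_gate.
  by move: (L M) (cp_psd cp Mpsd) => N; exact: psd_conj.
have := tr_psd_ge0 (Epsd b bS) (fold_psd a _ rho_psd).
by rewrite /hs (psd_adj (Epsd b bS)) lecE => /andP[].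
Qed.

Lemma pauli_op0 : pauli_op R (0 : pauli n) = 1%:M.
Proof.
apply/matrixP => k l; rewrite -[k]enum_valK -[l]enum_valK pauli_opE.
move: (enum_val k) (enum_val l) => u v.
have -> : xpart (0 : pauli n) = 0 by apply/ffunP => j; rewrite !ffunE.
have -> : zpart (0 : pauli n) = 0 by apply/ffunP => j; rewrite !ffunE.
rewrite addr0 chiC chi0 mulr1 /phase big1 ?expr0 ?mul1r; last by move=> j _; rewrite ffunE.
by rewrite !mxE (inj_eq enum_rank_inj); case: eqP.
Qed.

Lemma sqr_norm_const : ((Num.sqrt ((2 ^ n)%:R : R))^-1)%:C ^+ 2 = ((2 ^ n)%:R)^-1 :> R[i].
Proof.
rewrite -rmorphXn /= exprVn sqr_sqrtr ?ler0n // -(rmorph_nat (real_complex R)).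
by rewrite -fmorphV.
Qed.

Lemma hs_ket0 M : hs (pauli_ket R (0 : pauli n)) M = ((Num.sqrt ((2 ^ n)%:R : R))^-1)%:C * \tr M.
Proof.
rewrite /pauli_ket hsZl conj_real_complex pauli_op0 /hs (_ : adj 1%:M = 1%:M) ?mul1mx //.
by apply/matrixP => i j; rewrite !mxE rmorph_nat eq_sym.
Qed.

Lemma tr_ket0 : \tr (pauli_ket R (0 : pauli n)) = ((Num.sqrt ((2 ^ n)%:R : R))^-1)%:C * (2 ^ n)%:R.
Proof. by rewrite /pauli_ket linearZ /= pauli_op0 mxtrace1 card_ffun !card_ord. Qed.

Lemma pauli_eigenvalue0 : pauli_eigenvalue L 0 = 1.
Proof.
have [_ tp _] := gtmL.
rewrite /pauli_eigenvalue hs_ket0 tp tr_ket0 mulrA -expr2 sqr_norm_const mulVf //.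
by rewrite pnatr_eq0 -lt0n expn_gt0.
Qed.

Lemma spam0 (S : {set pauli n}) : stabilizer_group S -> spam L rho E S 0 = 1.
Proof.
move=> stab; have [_ tp /(_ S stab) [[_ tr_rho] [Epsd Esum]]] := gtmL.
transitivity (\sum_(b in syndromes S) complex.Re (((2 ^ n)%:R)^-1 * \tr (E S b))).
  apply: eq_bigr => b bS; rewrite /sgn_symp sympC symp0 expr0 mul1r hs_ket0 tp tr_rho mulr1.
  rewrite /hs (psd_adj (Epsd b bS)) /pauli_ket pauli_op0 -scalemxAr mulmx1 linearZ /=.
  by rewrite mulrAC -expr2 sqr_norm_const.
have tr1 : \tr (1%:M : op R n) = (2 ^ n)%:R by rewrite mxtrace1 card_ffun !card_ord.
rewrite -Re_sum -mulr_sumr.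
have -> : \sum_(b in syndromes S) \tr (E S b) = (2 ^ n)%:R by rewrite -tr1 -Esum raddf_sum.
by rewrite mulVf // pnatr_eq0 -lt0n expn_gt0.
Qed.

(** The expectation for [h = 0], where all signs are 1: both the eigenvalue and the SPAM parameter
    equal 1, by trace preservation and completeness of the POVM. *)
Lemma sample_prob_sum1 (S : {set pauli n}) m : stabilizer_group S -> \sum_c sample_prob L rho E S m c = 1.
Proof.
move=> stab; have [S0 _ _] := stab.
have := sample_expect m S0; rewrite spam0 // pauli_eigenvalue0 expr1n mulr1 => <-.
by apply: eq_bigr => c _; rewrite /sgn_symp sympC symp0 expr0 mulr1.
Qed.

End Sampling.

Local Close Scope complex_scope.

(** * Marginals and concentration *)

Section Marginals.
Variables (R : realType) (n : nat).
Implicit Types (x y a : pauli n) (B : {set 'I_n}).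

Definition letter_sign (u v : 'Z_2 * 'Z_2) : R := (-1) ^+ (u.1 * v.2 + u.2 * v.1 : 'Z_2)%R.

Lemma sgn_sympE x a : sgn_symp R x a = \prod_j letter_sign (x j) (a j).
Proof. exact: sign_Z2sum. Qed.

Lemma big_letters (V : nmodType) (F : 'Z_2 * 'Z_2 -> V) :
  \sum_u F u = F (0, 0) + F (0, 1) + F (1, 0) + F (1, 1).
Proof.
transitivity (\sum_(u : 'Z_2) \sum_(v : 'Z_2) F (u, v)).
  by rewrite pair_bigA; apply: eq_bigr => -[].
rewrite !big_ord_recl !big_ord0 !addr0 !addrA.
by rewrite (_ : lift ord0 ord0 = 1 :> 'Z_2) //; apply/val_inj.
Qed.

Lemma letter_sign_sum v : \sum_u letter_sign u v = 4 * (v == 0)%:R.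
Proof.
rewrite big_letters /letter_sign.
case: v => a b; case: (Z2P a) (Z2P b) => -> [->|->].
- by rewrite [LHS](_ : _ = (-1) ^+ 0%N + (-1) ^+ 0%N + (-1) ^+ 0%N + (-1) ^+ 0%N) // (_ : (_ == _)%:R = 1 :> R) //; ring.
- by rewrite [LHS](_ : _ = (-1) ^+ 0%N + (-1) ^+ 0%N + (-1) ^+ 1%N + (-1) ^+ 1%N) // (_ : (_ == _)%:R = 0 :> R) //; ring.
- by rewrite [LHS](_ : _ = (-1) ^+ 0%N + (-1) ^+ 1%N + (-1) ^+ 0%N + (-1) ^+ 1%N) // (_ : (_ == _)%:R = 0 :> R) //; ring.
- by rewrite [LHS](_ : _ = (-1) ^+ 0%N + (-1) ^+ 1%N + (-1) ^+ 1%N + (-1) ^+ 0%N) // (_ : (_ == _)%:R = 0 :> R) //; ring.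
Qed.

(** Writes the fibre as a product of one-qubit conditions, the form in which sum and product can be
    exchanged. *)
Lemma restr_eqP B x y : (restr B x == y) = (x \in family (fun j => if j \in B then pred1 (y j) else predT)) && (restr B y == y).
Proof.
apply/eqP/andP => [<-|[/familyP xB /eqP <-]].
  split; last by apply/eqP/ffunP => j; rewrite !ffunE; case: (j \in B).
  by apply/familyP => j; case: ifP => // jB; rewrite !ffunE jB inE.
apply/ffunP => j; rewrite !ffunE; case: ifP => // jB.
by have := xB j; rewrite jB inE => /eqP.
Qed.

Lemma restr_idP B x : reflect (forall j, j \notin B -> x j = 0) (restr B x == x).
Proof.
apply: (iffP eqP) => [<- j jB|x0]; first by rewrite ffunE (negbTE jB).
by apply/ffunP => j; rewrite ffunE; case: ifP => // /negbT /x0.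
Qed.

(** The sign factorizes over qubits. A qubit outside [B] is summed freely and gives 4 or 0,
    according to whether [a] is trivial on it. *)
Lemma sum_sgn_restr B y a : restr B y = y ->
  \sum_(x | restr B x == y) sgn_symp R x a =
  (restr B a == a)%:R * sgn_symp R y a * 4 ^+ (n - #|B|).
Proof.
move=> yB.
transitivity (\sum_(x in family (fun j => if j \in B then pred1 (y j) else predT)) \prod_j letter_sign (x j) (a j)).
  apply: eq_big => [x|x _]; last exact: sgn_sympE.
  by rewrite restr_eqP yB eqxx andbT.
rewrite -(bigA_distr_big_dep (fun j => if j \in B then pred1 (y j) else predT) (fun j u => letter_sign u (a j))).
transitivity (\prod_j (letter_sign (y j) (a j) * (if j \in B then 1 else 4 * (a j == 0)%:R))).
  apply: eq_bigr => j _; case: ifP => jB; first by rewrite big_pred1_eq mulr1.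
  have yj : y j = 0 by move/eqP/restr_idP: yB; apply; rewrite jB.
  rewrite (_ : \sum_(u | _) _ = \sum_u letter_sign u (a j)); last by apply: eq_bigl.
  by rewrite letter_sign_sum yj /letter_sign !mul0r addr0 expr0 mul1r.
rewrite big_split /= -sgn_sympE mulrAC [RHS]mulrC; congr (_ * _).
rewrite (bigID (mem B)) /= big1 ?mul1r => [|j ->] //.
case: restr_idP => [a0|aB].
  rewrite mul1r (eq_bigr (fun _ => 4)) => [|j jB]; last by rewrite (negbTE jB) a0 // eqxx mulr1.
  rewrite prodr_const; congr (_ ^+ _); 
  have E : (#|B| + #|[predC B]| = n)%N by rewrite cardC card_ord.
  by rewrite -[X in (X - _)%N]E addKn.
rewrite mul0r; have [j /andP[jB aj]] : exists j, (j \notin B) && (a j != 0).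
  apply/existsP; apply: contra_notT aB => /existsPn H j jB.
  by have := H j; rewrite jB /= negbK => /eqP.
by rewrite (bigD1 j) //= (negbTE jB) (negbTE aj) mulr0 mul0r.
Qed.

Lemma marginal_fourier (p f : pauli n -> R) B y : restr B y = y ->
  (forall x, p x = ((4 ^ n)%:R)^-1 * \sum_b sgn_symp R x b * f b) ->
  marginal p B y = (4 ^+ #|B|)^-1 * \sum_(b | restr B b == b) sgn_symp R y b * f b.
Proof.
move=> yB pE; rewrite /marginal; under eq_bigr do rewrite pE.
rewrite -mulr_sumr exchange_big /=.
under eq_bigr do rewrite -mulr_suml sum_sgn_restr //.
have Bn : (#|B| <= n)%N by rewrite -[X in (_ <= X)%N]card_ord max_card.
transitivity ((4 ^ n)%:R^-1 * (4 ^+ (n - #|B|) * \sum_(b | restr B b == b) sgn_symp R y b * f b)).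
  congr (_ * _); rewrite [in RHS]big_mkcond mulr_sumr; apply: eq_bigr => b _.
  by case: ifP => _; rewrite ?mul0r ?mul1r ?mulr0 // mulrAC mulrC.
rewrite mulrA; congr (_ * _).
have n0 k : (4 ^+ k : R) != 0 by rewrite expf_neq0 // pnatr_eq0.
by rewrite natrX -{1}(subnK Bn) exprD invfM mulrAC mulVf ?mul1r.
Qed.

End Marginals.

(** * Exponential tail bounds for independent runs *)

Section Concentration.
Variables (R : realType).

(** From [expR (- x) >= 1 - x], multiplied by [expR x]; the upper bound on [x] makes
    [(1 + x + 2 x^2) (1 - x) >= 1]. *)
Lemma expR_quadratic (x : R) : x <= 2^-1 -> expR x <= 1 + x + 2 * x ^+ 2.
Proof.
move=> x2; have h : expR x * (1 - x) <= 1.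
  have := expR_ge1Dx (- x) => /(ler_wpM2l (ltW (expR_gt0 x))).
  by rewrite -expRD subrr expR0.
have x1 : 0 < 1 - x by lra.
rewrite -(ler_pM2r x1); apply: le_trans h _.
have -> : (1 + x + 2 * x ^+ 2) * (1 - x) = 1 + x ^+ 2 * (1 - 2 * x) by ring.
by rewrite lerDl mulr_ge0 ?sqr_ge0 //; lra.
Qed.

Variables (Omega : finType) (T : nat) (mu : 'I_T -> Omega -> R).
Hypotheses (mu_ge0 : forall t o, 0 <= mu t o) (mu_sum : forall t, \sum_o mu t o = 1).

Lemma expect_prod (F : 'I_T -> Omega -> R) :
  \sum_(w : {ffun 'I_T -> Omega}) \prod_t mu t (w t) * \prod_t F t (w t) =
  \prod_t \sum_o mu t o * F t o.
Proof.
rewrite (bigA_distr_bigA (fun t o => mu t o * F t o)).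
by apply: eq_bigr => w _; rewrite big_split.
Qed.

Lemma total_prob : \sum_(w : {ffun 'I_T -> Omega}) \prod_t mu t (w t) = 1.
Proof. by rewrite -(bigA_distr_bigA mu); apply: big1. Qed.

Definition mean (X : 'I_T -> Omega -> R) t : R := \sum_o mu t o * X t o.

Lemma norm_mean_le1 X t : (forall t o, `|X t o| <= 1) -> `|mean X t| <= 1.
Proof.
move=> X1; apply: le_trans (ler_norm_sum _ _ _) _.
rewrite -[leRHS](mu_sum t); apply: ler_sum => o _.
by rewrite normrM (ger0_norm (mu_ge0 t o)) -[leRHS]mulr1 ler_wpM2l.
Qed.

Lemma chernoff (A : {set 'I_T}) (X : 'I_T -> Omega -> R) (eta : R) :
  0 < eta <= 1 -> (forall t o, `|X t o| <= 1) ->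
  \sum_(w : {ffun 'I_T -> Omega} | eta * #|A|%:R < \sum_(t in A) (X t (w t) - mean X t))
     \prod_t mu t (w t) <= expR (- (eta ^+ 2 / 32 * #|A|%:R)).
Proof.
move=> /andP[eta0 eta1] X1; have m1 t := norm_mean_le1 t X1.
(* Centred variables are at most 2 in modulus, so [l] times them is at most 1/8 and their
   second-order term at most [8 l^2]. The exponent per run is [- l eta + 8 l^2 = - eta^2 / 32]. *)
pose l := eta / 16; set m := mean X in m1 *.
pose F t o := if t \in A then expR (l * (X t o - m t)) else 1.
have step : \sum_(w : {ffun 'I_T -> Omega} | eta * #|A|%:R < \sum_(t in A) (X t (w t) - m t))
     \prod_t mu t (w t) <= \sum_(w : {ffun 'I_T -> Omega}) expR (- (l * (eta * #|A|%:R))) * (\prod_t mu t (w t) * \prod_t F t (w t)).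
  rewrite big_mkcond; apply: ler_sum => w _.
  have mu0 : 0 <= \prod_t mu t (w t) by apply: prodr_ge0.
  have FE : \prod_t F t (w t) = expR (l * (\sum_(t in A) (X t (w t) - m t))).
    by rewrite -big_mkcond -expR_sum -mulr_sumr.
  case: ifP => [dev|_]; last first.
    by rewrite mulr_ge0 ?expR_ge0 // mulr_ge0 // FE expR_ge0.
  rewrite mulrCA -[leLHS]mulr1 ler_wpM2l // FE -expRD -[leLHS]expR0 ler_expR addrC subr_ge0.
  by rewrite ler_wpM2l ?ltW // /l divr_gt0.
apply: (le_trans step); rewrite -mulr_sumr expect_prod.
have factor : \prod_t \sum_o mu t o * F t o <= \prod_(t in A) expR (8 * l ^+ 2).
  rewrite [leRHS]big_mkcond; apply: ler_prod => t _.
  rewrite sumr_ge0 => [|o _]; last by rewrite mulr_ge0 // /F; case: ifP => // _; apply: expR_ge0.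
  rewrite /F /=; case: ifP => tA; last by under eq_bigr do rewrite mulr1; rewrite mu_sum.
  apply: le_trans (expR_ge1Dx _).
  have -> : 1 + 8 * l ^+ 2 = \sum_o mu t o * (1 + l * (X t o - m t) + 8 * l ^+ 2).
    rewrite (eq_bigr (fun o => mu t o * (1 + 8 * l ^+ 2 - l * m t) + l * (mu t o * X t o))); last first.
      by move=> o _; ring.
    by rewrite big_split /= -mulr_suml -mulr_sumr mu_sum -/(mean X t) -/m mul1r; ring.
  apply: ler_sum => o _; rewrite ler_wpM2l //.
  have l0 : 0 < l by rewrite divr_gt0.
  have Xm : `|X t o - m t| <= 2.
    by rewrite (le_trans (ler_normB _ _)) // (_ : 2 = 1 + 1) // lerD.
  apply: le_trans (expR_quadratic _) _.
    apply: le_trans (ler_norm _) _; rewrite normrM (gtr0_norm l0).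
    have : l * `|X t o - m t| <= l * 2 by rewrite ler_wpM2l // ltW.
    by rewrite /l; lra.
  rewrite lerD2l exprMn.
  have : (X t o - m t) ^+ 2 <= 4.
    by rewrite -real_normK ?num_real // (_ : 4 = 2 ^+ 2) ?lerXn2r ?nnegrE //; ring.
  by have := sqr_ge0 l; nra.
apply: le_trans (ler_wpM2l (expR_ge0 _) factor) _.
rewrite -expR_sum -expRD ler_expR sumr_const -[in leLHS]mulr_natr /l.
by rewrite le_eqVlt; apply/orP; left; apply/eqP; field.
Qed.

End Concentration.

(** * Gibbs random fields *)

Section Moebius.
Variables (R : pzRingType) (T : finType).
Implicit Types (A D S : {set T}) (h : {set T} -> R).

(** Inserting or removing [x] is a sign-reversing involution on the index set. *)
Lemma sum_toggle (x : T) (P : pred {set T}) h :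
  (forall D, x \notin D -> P (x |: D) = P D) ->
  (forall D, x \notin D -> P D -> h (x |: D) = - h D) ->
  \sum_(D | P D) h D = 0.
Proof.
move=> PE hE; rewrite (bigID (fun D => x \in D)) /=.
rewrite (reindex_onto (fun D => x |: D) (fun D => D :\ x)) /=; last first.
  by move=> D /andP[_ xD]; rewrite setD1K.
rewrite (eq_bigl (fun D => P D && (x \notin D))) => [|D]; last first.
  rewrite setU11 andbT; have [xD|xD] := boolP (x \in D); last first.
    by rewrite PE // setU1K // eqxx.
  rewrite andbF; apply/negbTE; rewrite negb_and; apply/orP; right.
  by apply: contraTneq xD => <-; rewrite !inE eqxx.
rewrite -big_split /= big1 // => D /andP[PD xD].
by rewrite hE // addNr.
Qed.

Lemma sign_cardU1 (m : nat) (x : T) D : x \notin D -> (#|D| < m)%N ->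
  (-1) ^+ (m - #|x |: D|)%N = - (-1) ^+ (m - #|D|)%N :> R.
Proof.
move=> xD Dm; rewrite cardsU1 xD add1n.
by rewrite -(subnSK Dm) exprS mulN1r opprK.
Qed.

Lemma sign_sum_eq0 D (x : T) h : x \in D ->
  (forall S, x \notin S -> h (x |: S) = h S) ->
  \sum_(S in powerset D) (-1) ^+ (#|D| - #|S|)%N * h S = 0.
Proof.
move=> xD hE; apply: (sum_toggle (x := x)) => [S xS|S xS].
  by rewrite !powersetE subUset sub1set xD.
rewrite powersetE => SD; rewrite hE // sign_cardU1 // ?mulNr //.
apply: proper_card; rewrite properE SD; apply/subsetPn; by exists x.
Qed.

(** After exchanging the sums, a set [S] other than [A] has coefficient 0: toggle an element of [A]
    outside [S]. *)
Lemma moebius A h :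
  \sum_(D in powerset A) \sum_(S in powerset D) (-1) ^+ (#|D| - #|S|)%N * h S = h A.
Proof.
rewrite (exchange_big_dep (fun S => S \subset A)) /=; last first.
  by move=> D S; rewrite !powersetE => DA SD; apply: subset_trans DA.
rewrite (bigD1 A) //= [X in _ + X]big1 ?addr0.
  rewrite (big_pred1 A) ?subnn ?expr0 ?mul1r // => D; rewrite !powersetE /=.
  by rewrite eqEsubset.
move=> S /andP[SA neq]; have [x xA xS] : exists2 x, x \in A & x \notin S.
  by apply/subsetPn; apply: contraNN neq => AS; rewrite eqEsubset SA.
apply: (sum_toggle (x := x)) => [D xD|D xD].
  rewrite !powersetE subUset sub1set xA /=; congr (_ && _).
  apply/idP/idP => [/subsetP SD|SD]; last exact: subset_trans SD (subsetU1 _ _).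
  apply/subsetP => y yS; have := SD y yS; rewrite !inE => /orP[/eqP yx|//].
  by rewrite -yx yS in xS.
rewrite powersetE => /andP[DA]; rewrite powersetE => SD.
by rewrite cardsU1 xD add1n subSn ?subset_leq_card // exprS mulN1r mulNr.
Qed.

End Moebius.

Lemma sumr_gt0 (R : numDomainType) (I : finType) (P : pred I) (F : I -> R) i :
  P i -> 0 < F i -> (forall j, P j -> 0 <= F j) -> 0 < \sum_(j | P j) F j.
Proof.
move=> Pi Fi F0; rewrite (bigD1 i) //= ltr_pwDl // sumr_ge0 // => j /andP[Pj _].
exact: F0.
Qed.

Section Gibbs.
Variables (R : realType) (n : nat) (C : {set {set 'I_n}}).
Implicit Types (B D S : {set 'I_n}) (x y : pauli n).

Lemma restr_restr B D x : restr B (restr D x) = restr (B :&: D) x.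
Proof. by apply/ffunP => j; rewrite !ffunE inE; case: (j \in B). Qed.

Lemma restr0 B : restr B (0 : pauli n) = 0.
Proof. by apply/ffunP => j; rewrite !ffunE; case: ifP. Qed.

Lemma restr_set0 x : restr set0 x = 0.
Proof. by apply/ffunP => j; rewrite !ffunE inE. Qed.

Lemma restrD B x y : restr B (x + y) = restr B x + restr B y.
Proof. by apply/ffunP => j; rewrite !ffunE; case: ifP => // _; rewrite addr0. Qed.

Lemma mem_subfactors S : (S \in subfactors C) = (S != set0) && [exists D in C, S \subset D].
Proof.
rewrite !inE; congr (_ && _); apply/bigcupP/exists_inP => -[D DC SD]; exists D => //.
  by rewrite powersetE in SD.
by rewrite powersetE.
Qed.

Lemma sub_mb_closure D S : D \in C -> D :&: S != set0 -> D \subset mb_closure C S.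
Proof.
move=> DC DS; apply/subsetP => j jD; rewrite !inE.
have [//|jS] := boolP (j \in S).
by rewrite orFb; apply/bigcupP; exists D; rewrite ?DC.
Qed.

Lemma mb_closureS S D : S \subset D -> mb_closure C S \subset mb_closure C D.
Proof.
move=> SD; apply/subsetP => j; rewrite !inE => /orP[jS|/andP[_ /bigcupP[E /andP[EC ES] jE]]].
  by rewrite (subsetP SD).
have [//|jD] := boolP (j \in D); rewrite orFb /=.
apply/bigcupP; exists E => //; rewrite EC.
by apply: contraNneq ES => ED; rewrite -subset0 -ED setIS.
Qed.

(** The canonical product with arbitrary values [c S x] for the conditionals, so that the
    distribution, its estimate and the integers of the program are instances of one expression. *)
Definition weight (c : {set 'I_n} -> pauli n -> R) x : R :=
  \prod_(D in subfactors C)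
    expR (\sum_(S in powerset D) (-1) ^+ (#|D| - #|S|)%N * ln (c S x)).

Lemma canonical_weightE phat x :
  canonical_weight C phat x =
  weight (fun S => cond0 (phat (mb_closure C S)) S (blanket C S)) x.
Proof. by []. Qed.

Lemma weight_gt0 c x : 0 < weight c x.
Proof. by apply: prodr_gt0 => D _; apply: expR_gt0. Qed.

Lemma ln_weight c x : ln (weight c x) =
  \sum_(D in subfactors C) \sum_(S in powerset D) (-1) ^+ (#|D| - #|S|)%N * ln (c S x).
Proof. by rewrite /weight -expR_sum expRK. Qed.

Variable p : pauli n -> R.

Lemma gibbs_pos : gibbs C p -> (forall x, 0 < p x) /\ \sum_x p x = 1.
Proof.
case=> phi [phi0 pE].
have pos x : 0 < \prod_(D in C) phi D (restr D x) by apply: prodr_gt0.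
have Z0 : 0 < \sum_y \prod_(D in C) phi D (restr D y).
  by apply: (sumr_gt0 (i := (0 : pauli n))) => // y _; exact: ltW.
split=> [x|]; first by rewrite pE divr_gt0.
by under eq_bigr do rewrite pE; rewrite -mulr_suml mulfV // gt_eqF.
Qed.

Lemma marginal_gt0 B y : (forall x, 0 < p x) -> restr B y = y -> 0 < marginal p B y.
Proof.
move=> p0 yB; apply: (sumr_gt0 (i := y)) => [||x _]; rewrite ?yB //.
exact: ltW.
Qed.

Lemma restr_id_sub S B x : S \subset B -> restr B (restr S x) = restr S x.
Proof. by move=> SB; rewrite restr_restr (setIidPr SB). Qed.

Lemma cond0_gt0 S B x : (forall x, 0 < p x) -> 0 < cond0 p S B x.
Proof.
by move=> p0; rewrite divr_gt0 // marginal_gt0 // ?restr0 // restr_id_sub // subsetUl.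
Qed.

(** With the blanket set to the identity, factors meeting [S] lie in the closure and see only [x] on
    [S], while the other factors do not see [S] at all; the sum over the remaining variables is thus
    independent of [x]. *)
Lemma gibbs_markov (phi : {set 'I_n} -> pauli n -> R) :
  (forall D x, 0 < phi D x) ->
  (forall x, p x = (\prod_(D in C) phi D (restr D x)) /
                   (\sum_y \prod_(D in C) phi D (restr D y))) ->
  forall S, exists2 K : R, 0 < K & forall x,
    cond0 p S (blanket C S) x = K * \prod_(D in C) phi D (restr D (restr S x)).
Proof.
move=> phi0 pE S.
have [p0 _] : (forall x, 0 < p x) /\ \sum_x p x = 1 by apply: gibbs_pos; exists phi.
set Z := \sum_y _ in pE.
have Z0 : 0 < Z.
  by apply: (sumr_gt0 (i := (0 : pauli n))) => // [|y _]; [|apply: ltW]; apply: prodr_gt0.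
set B := mb_closure C S.
(* [K1] is the free sum over the outside. [K2] compensates for letting the product in the conclusion
   run over all factors: those away from [S] are evaluated there at the identity. *)
pose K1 := \sum_(z | restr B z == 0) \prod_(D in C | D :&: S == set0) phi D (restr D z).
pose K2 := \prod_(D in C | D :&: S == set0) phi D 0.
pose K3 := marginal p (blanket C S) 0.
have K1p : 0 < K1.
  apply: (sumr_gt0 (i := (0 : pauli n))) => [||y _]; first by rewrite restr0.
    exact: prodr_gt0.
  by apply: ltW; apply: prodr_gt0.
have K2p : 0 < K2 by apply: prodr_gt0.
have K3p : 0 < K3 by apply: marginal_gt0 => //; exact: restr0.
exists (K1 / K2 / Z / K3); first by rewrite !divr_gt0.
move=> x; rewrite /cond0 -/K3; rewrite mulrAC; congr (_ / _).
(* Translation by [restr S x] moves the fibre over [restr S x] to the fibre over 0, which no longer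
   depends on [x]. *)
rewrite /marginal (reindex_inj (addIr (restr S x))) /=.
transitivity (\sum_(z | restr B z == 0) (\prod_(D in C | D :&: S == set0) phi D (restr D z)) *
    (\prod_(D in C | D :&: S != set0) phi D (restr D (restr S x))) / Z).
  apply: eq_big => [z|z].
    rewrite restrD restr_id_sub ?subsetUl // -/B.
    by rewrite -[X in _ == X]add0r (inj_eq (addIr _)).
  rewrite restrD restr_id_sub ?subsetUl //.
  rewrite -[X in _ == X]add0r (inj_eq (addIr _)) -/B => /eqP zB.
  rewrite pE -/Z; congr (_ / _).
  rewrite (bigID (fun D => D :&: S == set0)) /=; congr (_ * _); apply: eq_bigr => D /andP[DC DS].
    by rewrite restrD restr_restr (eqP DS) restr_set0 addr0.
  rewrite restrD; have DB : D \subset B by exact: sub_mb_closure.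
  have -> : restr D z = 0 by rewrite -(setIidPl DB) -restr_restr zB restr0.
  by rewrite add0r.
rewrite -mulr_suml -mulr_suml -/K1.
rewrite [in RHS](bigID (fun D => D :&: S == set0)) /=.
have -> : \prod_(D in C | D :&: S == set0) phi D (restr D (restr S x)) = K2.
  by apply: eq_bigr => D /andP[_ /eqP DS]; rewrite restr_restr DS restr_set0.
by field; rewrite !gt_eqF.
Qed.

Lemma hammersley_clifford : gibbs C p ->
  exists2 k : R, 0 < k & forall x, p x = k * weight (fun S => cond0 p S (blanket C S)) x.
Proof.
case=> phi [phi0 pE]; have markov := gibbs_markov phi0 pE.
have [p0 _] : (forall x, 0 < p x) /\ \sum_x p x = 1 by apply: gibbs_pos; exists phi.
set Z := \sum_y _ in pE.
have Z0 : 0 < Z.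
  by apply: (sumr_gt0 (i := (0 : pauli n))) => // [|y _]; [|apply: ltW]; apply: prodr_gt0.
pose psi D x := ln (phi D (restr D x)).
pose kappa S := ln (cond0 p S (blanket C S) 0) - \sum_(D in C) psi D 0.
have lnprod y : ln (\prod_(D in C) phi D (restr D y)) = \sum_(D in C) psi D y.
  rewrite -[RHS]expRK expR_sum; congr ln; apply: eq_bigr => D _.
  by rewrite lnK // posrE.
have lncond S x : ln (cond0 p S (blanket C S) x) = kappa S + \sum_(D in C) psi D (restr S x).
  have [K K0 KE] := markov S; rewrite /kappa !KE !lnM ?posrE //; try exact: prodr_gt0.
  by rewrite !lnprod restr0; ring.
(* As a function of [S], the potential of [D] depends on [S :&: D] only. The alternating sum over
   subsets of [E] therefore vanishes unless [E] lies in [D], and Moebius inversion on [D] sums the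
   rest; the empty set, not being a subfactor, accounts for [psi D 0]. *)
have local D x : D \in C ->
    \sum_(E in subfactors C) \sum_(S in powerset E) (-1) ^+ (#|E| - #|S|)%N * psi D (restr S x) =
    psi D x - psi D 0.
  move=> DC; pose h S := psi D (restr S x).
  have hI S : h S = h (S :&: D).
    by rewrite /h /psi !restr_restr [S :&: D]setIC setIA setIid.
  have big0 (E : {set 'I_n}) : ~~ (E \subset D) -> \sum_(S in powerset E) (-1) ^+ (#|E| - #|S|)%N * h S = 0.
    case/subsetPn => j jE jD; apply: (sign_sum_eq0 jE) => S jS.
    rewrite hI [RHS]hI; congr h; apply/setP => i; rewrite !inE.
    by case: eqP => [->|//]; rewrite (negbTE jD) !andbF.
  transitivity (\sum_(E in powerset D | E != set0) \sum_(S in powerset E) (-1) ^+ (#|E| - #|S|)%N * h S).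
    rewrite (bigID (fun E : {set 'I_n} => E \subset D)) /= [X in _ + X]big1 ?addr0; last first.
      by move=> E /andP[_ ED]; exact: big0.
    apply: eq_bigl => E; rewrite powersetE mem_subfactors.
    have [ED|] := boolP (E \subset D); last by rewrite andbF.
    by rewrite andbT; case: (E != set0) => //=; apply/exists_inP; exists D.
  have := moebius D h; rewrite (bigD1 set0) ?powersetE ?sub0set //=.
  rewrite powerset0 big_set1 subnn expr0 mul1r => E.
  have -> : psi D x = h D by rewrite /h /psi restr_restr setIid.
  have -> : psi D 0 = h set0 by rewrite /h restr_set0.
  by rewrite -E addrAC subrr add0r.
pose kap := \sum_(E in subfactors C) \sum_(S in powerset E) (-1) ^+ (#|E| - #|S|)%N * kappa S.
have lnw x : ln (weight (fun S => cond0 p S (blanket C S)) x) =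
    kap + \sum_(D in C) (psi D x - psi D 0).
  rewrite ln_weight.
  have -> : \sum_(D in C) (psi D x - psi D 0) = \sum_(D in C) \sum_(E in subfactors C)
      \sum_(S in powerset E) (-1) ^+ (#|E| - #|S|)%N * psi D (restr S x).
    by apply: eq_bigr => D DC; rewrite local.
  rewrite [X in _ + X]exchange_big /= -big_split /=; apply: eq_bigr => E _.
  rewrite [X in _ + X]exchange_big /= -big_split /=; apply: eq_bigr => S _.
  by rewrite lncond mulrDr mulr_sumr.
exists (expR (\sum_(D in C) psi D 0 - kap - ln Z)); first exact: expR_gt0.
move=> x; have w0 := weight_gt0 (fun S => cond0 p S (blanket C S)) x.
rewrite -[weight _ _]lnK ?posrE // -expRD lnw.
rewrite -[LHS]lnK ?posrE // pE ln_div ?posrE //; last exact: prodr_gt0.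
by rewrite lnprod sumrB; congr expR; rewrite -/Z; ring.
Qed.

End Gibbs.

(** * Stability of canonical products under small errors *)

Section Perturbation.
Variables (R : realType) (n : nat) (C : {set {set 'I_n}}).
Implicit Types (B D S : {set 'I_n}) (x y : pauli n) (p q : pauli n -> R).

(** Only the product [a * b] survives, so a common unknown scale in the two comparisons cancels. *)
Lemma normalized_le (X : finType) (u v : X -> R) (a b : R) (w : X) :
  (forall w, 0 < u w) -> (forall w, 0 < v w) -> 0 <= a ->
  (forall w, u w <= a * v w) -> (forall w, v w <= b * u w) ->
  u w / \sum_w' u w' <= a * b * (v w / \sum_w' v w').
Proof.
move=> u0 v0 a0 uv vu.
have U0 : 0 < \sum_w' u w' by apply: (sumr_gt0 (i := w)) => // w' _; exact: ltW.
have V0 : 0 < \sum_w' v w' by apply: (sumr_gt0 (i := w)) => // w' _; exact: ltW.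
rewrite mulrA ler_pdivrMr // mulrAC ler_pdivlMr //.
have VU : \sum_w' v w' <= b * \sum_w' u w' by rewrite mulr_sumr ler_sum.
apply: le_trans (ler_wpM2r (ltW V0) (uv w)) _.
rewrite -!mulrA ler_wpM2l // mulrCA; apply: ler_wpM2l; [exact: ltW|exact: VU].
Qed.

Lemma l1dist_le p q c : 1 <= c -> (forall x, 0 <= p x) -> (forall x, 0 <= q x) ->
  \sum_x p x = 1 -> (forall x, p x <= c * q x) -> (forall x, q x <= c * p x) ->
  l1dist p q <= c - 1.
Proof.
move=> c1 p0 q0 p1 pq qp; rewrite -[leRHS]mulr1 -p1 mulr_sumr.
apply: ler_sum => x _; have := pq x; have := qp x; have := p0 x; have := q0 x.
by case: (ger0P (p x - q x)) => ? ? ? ? ?; nra.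
Qed.

Lemma marginal_le p q c B y : (forall x, p x <= c * q x) ->
  marginal p B y <= c * marginal q B y.
Proof. by move=> pq; rewrite mulr_sumr ler_sum. Qed.

Lemma cond0_le p q c S B x : 0 <= c -> (forall x, 0 < p x) -> (forall x, 0 < q x) ->
  (forall x, p x <= c * q x) -> (forall x, q x <= c * p x) ->
  cond0 p S B x <= c ^+ 2 * cond0 q S B x.
Proof.
move=> c0 p0 q0 pq qp; rewrite /cond0 mulrA.
have mp := marginal_gt0 p0 (restr0 B); have mq := marginal_gt0 q0 (restr0 B).
rewrite ler_pdivrMr // mulrAC ler_pdivlMr // expr2 -!mulrA.
have ms : 0 <= marginal q (S :|: B) (restr S x).
  by rewrite ltW // marginal_gt0 // restr_id_sub // subsetUl.
apply: le_trans (ler_wpM2r (ltW mq) (marginal_le _ _ pq)) _.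
rewrite -!mulrA ler_wpM2l // mulrCA ler_wpM2l //.
exact: marginal_le.
Qed.

(** The analogue of [Gparam] that involves no estimate, available before the outcomes are known. *)
Definition Gmin p : R :=
  \big[Num.min/1]_(D in subfactors C) \big[Num.min/1]_(x : pauli n) cond0 p D (blanket C D) x.

Lemma Gmin_le p S x : S \in subfactors C -> Gmin p <= cond0 p S (blanket C S) x.
Proof.
move=> SC; apply: le_trans (bigmin_le_cond _ _ SC) _.
exact: bigmin_le_cond.
Qed.

Lemma Gmin_le1 p : Gmin p <= 1. Proof. exact: bigmin_le_id. Qed.

Lemma Gmin_gt0 p : (forall x, 0 < p x) -> 0 < Gmin p.
Proof.
move=> p0; apply/bigmin_gtP; split=> // D _; apply/bigmin_gtP; split=> // x _.
exact: cond0_gt0.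
Qed.

Lemma Gparam_gt0 p q : (forall x, 0 < p x) -> (forall x, 0 < q x) -> 0 < Gparam C p q.
Proof.
move=> p0 q0; apply/bigmin_gtP; split=> // D _; apply/bigmin_gtP; split=> // x _.
by rewrite sqrtr_gt0 mulr_gt0 // cond0_gt0.
Qed.

(** A factor [c] between the distributions becomes [c ^+ 2] between conditionals, which are
    quotients of marginals; the square root in [Gparam] brings it back to [c]. *)
Lemma Gparam_le p q c : 1 <= c -> (forall x, 0 < p x) -> (forall x, 0 < q x) ->
  (forall x, p x <= c * q x) -> (forall x, q x <= c * p x) ->
  Gparam C p q <= c * Gmin p.
Proof.
move=> c1 p0 q0 pq qp; have c0 : 0 < c by apply: lt_le_trans c1.
rewrite -ler_pdivrMl //.
have G1 : Gparam C p q <= 1 by exact: bigmin_le_id.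
have cG1 : c^-1 * Gparam C p q <= 1 by rewrite ler_pdivrMl // mulr1 (le_trans G1).
apply/bigmin_geP; split=> // D DC; apply/bigmin_geP; split=> // x _.
rewrite ler_pdivrMl //.
apply: le_trans (bigmin_le_cond _ _ DC) _.
apply: (@le_trans _ _ (Num.sqrt (cond0 p D (blanket C D) x * cond0 q D (blanket C D) x))).
  exact: bigmin_le_cond.
have d0 := cond0_gt0 D (blanket C D) x p0.
rewrite -[leRHS](gtr0_norm (mulr_gt0 c0 d0)) -sqrtr_sqr ler_sqrt ?sqr_ge0 //.
have -> : (c * cond0 p D (blanket C D) x) ^+ 2 =
    cond0 p D (blanket C D) x * (c ^+ 2 * cond0 p D (blanket C D) x) by ring.
apply: ler_wpM2l; first exact: ltW.
exact: cond0_le (ltW c0) q0 p0 qp pq.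
Qed.

Variable nu : nat.
Hypothesis closure_le : forall D, D \in C -> (#|mb_closure C D| <= nu)%N.

Lemma subfactor_closure_le D : D \in subfactors C -> (#|mb_closure C D| <= nu)%N.
Proof.
rewrite mem_subfactors => /andP[_ /exists_inP[E EC DE]].
exact: leq_trans (subset_leq_card (mb_closureS C DE)) (closure_le EC).
Qed.

Lemma card_subfactor_le D : D \in subfactors C -> (#|D| <= nu)%N.
Proof.
move=> DC; apply: leq_trans (subfactor_closure_le DC).
by apply/subset_leq_card/subsetUl.
Qed.

Lemma card_subfactors_le : (#|subfactors C| <= #|C| * 2 ^ nu)%N.
Proof.
apply: (leq_trans (subset_leq_card (subsetDl _ _))).
apply: (@leq_trans (\sum_(D in C) #|powerset D|)).
  elim/big_rec2: _ => [|D m A DC IH]; first by rewrite cards0.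
  by apply: (@leq_trans (#|powerset D| + #|A|)); rewrite ?leq_add2l // cardsU leq_subr.
rewrite -sum_nat_const; apply: leq_sum => D DC; rewrite card_powerset leq_exp2l //.
exact: leq_trans (subset_leq_card (subsetUl _ _)) (closure_le DC).
Qed.

(** The shifts [kappa S] do not involve [x] and add up to the constant [k]. There are at most
    [#|C| * 2 ^ nu] subfactors, with at most [2 ^ nu] subsets each. *)
Lemma ln_weight_diff (c c' : {set 'I_n} -> pauli n -> R) (kappa : {set 'I_n} -> R) (rho : R) :
  0 <= rho ->
  (forall D S x, D \in subfactors C -> S \subset D ->
    `|ln (c S x) - ln (c' S x) - kappa S| <= rho) ->
  exists k, forall x,
    `|ln (weight C c x) - ln (weight C c' x) - k| <= (#|C| * 2 ^ nu * 2 ^ nu)%:R * rho.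
Proof.
move=> rho0 H; exists (\sum_(D in subfactors C) \sum_(S in powerset D) (-1) ^+ (#|D| - #|S|)%N * kappa S).
move=> x; rewrite !ln_weight -!sumrB.
apply: (@le_trans _ _ (\sum_(D in subfactors C) (2 ^ nu)%:R * rho)).
  apply: le_trans (ler_norm_sum _ _ _) _; apply: ler_sum => D DC.
  rewrite -!sumrB; apply: (@le_trans _ _ (\sum_(S in powerset D) rho)).
    apply: le_trans (ler_norm_sum _ _ _) _; apply: ler_sum => S; rewrite powersetE => SD.
    by rewrite -!mulrBr normrM normrX normrN1 expr1n mul1r; apply: H DC SD.
  rewrite sumr_const card_powerset -[leLHS]mulr_natl ler_wpM2r // ler_nat leq_exp2l //.
  exact: card_subfactor_le.
rewrite sumr_const -[leLHS]mulr_natl mulrA -natrM ler_wpM2r // ler_nat leq_mul2r.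
by rewrite card_subfactors_le orbT.
Qed.

End Perturbation.

(** * Colouring the qubits *)

Section Colouring.
Variables (T : finType) (e : rel T) (d : nat).
Hypotheses (e_sym : symmetric e) (degree : forall v, (#|[set u | e v u]| <= d)%N).

(** A vertex has at most [d] neighbours, so one of the [d + 1] colours is free when it is added. *)
Lemma greedy_colouring : exists col : T -> 'I_d.+1,
  forall u v, u != v -> e u v -> col u != col v.
Proof.
suff [col colP] : exists col : T -> 'I_d.+1,
    forall u v, u \in enum T -> v \in enum T -> u != v -> e u v -> col u != col v.
  by exists col => u v; apply: colP; rewrite mem_enum.
elim: (enum T) => [|w s [col colP]]; first by exists (fun _ => ord0).
have [c cP] : exists c, c \notin [set col u | u in [set u | e w u]].
  apply/existsP; rewrite -negb_forall; apply/negP => /forallP H.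
  have : (#|[set: 'I_d.+1]| <= d)%N.
    apply: leq_trans (degree w); apply: leq_trans (leq_imset_card col _).
    by apply/subset_leq_card/subsetP => c _.
  by rewrite cardsT card_ord ltnn.
have free v : e w v -> col v != c.
  by move=> ewv; apply: contraNneq cP => <-; apply: imset_f; rewrite inE.
exists (fun u => if u == w then c else col u) => u v; rewrite !inE.
case: (eqVneq u w) => [->|uw]; case: (eqVneq v w) => [->|vw] //=.
- by move=> _ _ _ /free; rewrite eq_sym.
- by move=> _ _ _; rewrite e_sym => /free.
- exact: colP.
Qed.

End Colouring.

Lemma card_bigcup_le (I T : finType) (A : {set I}) (F : I -> {set T}) m :
  (forall i, i \in A -> (#|F i| <= m)%N) -> (#|\bigcup_(i in A) F i| <= #|A| * m)%N.
Proof.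
move=> Fm; rewrite -sum_nat_const; elim/big_rec2: _ => [|i k B iA IH]; first by rewrite cards0.
by apply: leq_trans (leq_add (Fm i iA) IH); rewrite cardsU leq_subr.
Qed.

Section FactorGraph.
Variables (n : nat) (C : {set {set 'I_n}}) (nu : nat).
Hypothesis closure_le : forall D, D \in C -> (#|mb_closure C D| <= nu)%N.

Definition nbhd (i : 'I_n) : {set 'I_n} := \bigcup_(D in C | i \in D) D.

(** All factors through [i] lie in the closure of any one of them. *)
Lemma card_nbhd i : (#|nbhd i| <= nu)%N.
Proof.
have [/existsP[D /andP[DC iD]]|/existsPn H] := boolP [exists D, (D \in C) && (i \in D)].
  apply: leq_trans (closure_le DC); apply/subset_leq_card/bigcupsP => E /andP[EC iE].
  by apply: sub_mb_closure => //; apply/set0Pn; exists i; rewrite inE iE.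
rewrite /nbhd big1 ?cards0 // => D /andP[DC iD].
by have := H D; rewrite DC iD.
Qed.

Lemma mb_closure_nbhd D i : D \in C -> i \in mb_closure C D ->
  exists2 u, u \in D & (u \in nbhd i) && (i \in nbhd u).
Proof.
move=> DC; rewrite !inE => /orP[iD|/andP[_ /bigcupP[E /andP[EC /set0Pn[u]]]]].
  by exists i => //; rewrite andbb; apply/bigcupP; exists D; rewrite ?DC.
rewrite inE => /andP[uE uD] iE; exists u => //.
by apply/andP; split; apply/bigcupP; exists E; rewrite ?EC ?iE ?uE.
Qed.

Definition conflict (i j : 'I_n) : bool :=
  [exists D in C, (i \in mb_closure C D) && (j \in mb_closure C D)].

(** Two qubits in the closure of [D] are joined by three steps between neighbours: from [i] to some
    [u] in [D], inside [D] to [v], and from [v] to [j]. *)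
Lemma conflict_degree i : (#|[set j | conflict i j]| <= nu * nu * nu)%N.
Proof.
apply: (@leq_trans #|\bigcup_(v in \bigcup_(u in nbhd i) nbhd u) nbhd v|); last first.
  apply: leq_trans (card_bigcup_le (fun i _ => card_nbhd i)) _; rewrite leq_mul2r.
  apply/orP; right; apply: leq_trans (card_bigcup_le (fun i _ => card_nbhd i)) _.
  by rewrite leq_mul2r card_nbhd orbT.
apply/subset_leq_card/subsetP => j; rewrite inE => /exists_inP[D DC /andP[iD jD]].
have [u uD /andP[ui _]] := mb_closure_nbhd DC iD.
have [v vD /andP[_ jv]] := mb_closure_nbhd DC jD.
apply/bigcupP; exists v => //; apply/bigcupP; exists u => //.
by apply/bigcupP; exists D; rewrite ?DC.
Qed.

Lemma closure_colouring : exists col : 'I_n -> 'I_(nu * nu * nu).+1,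
  forall D, D \in C -> {in mb_closure C D &, injective col}.
Proof.
have sym : symmetric conflict.
  by move=> i j; apply: eq_existsb => D; rewrite [(i \in _) && _]andbC.
have [col colP] := greedy_colouring sym conflict_degree.
exists col => D DC i j iD jD; apply: contra_eq => ij.
by apply: colP => //; apply/exists_inP; exists D; rewrite ?iD.
Qed.

(** Makes the running time polynomial in [n] alone: a factor through [i] is a subset of the
    neighbourhood of [i]. The extra 1 is for the empty factor. *)
Lemma card_factors_le : (#|C| <= n * 2 ^ nu + 1)%N.
Proof.
have sub : C \subset set0 |: \bigcup_(i in [set: 'I_n]) [set D in C | i \in D].
  apply/subsetP => D DC; rewrite !inE; have [->|/set0Pn[i iD]] := eqVneq D set0; first by [].
  by apply/orP; right; apply/bigcupP; exists i; rewrite ?inE ?DC.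
apply: leq_trans (subset_leq_card sub) _.
rewrite cardsU1 addnC leq_add ?leq_b1 //.
have le1 i : (#|[set D in C | i \in D]| <= 2 ^ nu)%N.
  apply: (@leq_trans #|powerset (nbhd i)|); last by rewrite card_powerset leq_exp2l ?card_nbhd.
  apply/subset_leq_card/subsetP => D; rewrite inE powersetE => /andP[DC iD].
  by apply/subsetP => j jD; apply/bigcupP; exists D; rewrite ?DC.
by apply: leq_trans (card_bigcup_le (fun i _ => le1 i)) _; rewrite cardsT card_ord.
Qed.

End FactorGraph.

(** * Stabilizer groups of product bases *)

Section LocalBasis.
Variables (n : nat) (g : pauli n).

Definition single (j : 'I_n) : pauli n := [ffun i => if i == j then g j else 0].

(** The label [g] lies in the span of the others; it is put in front so that the program can read
    the whole basis from the first generator. *)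
Definition basis_gens : seq (pauli n) := g :: [seq single j | j <- enum 'I_n].

Definition agrees (a : pauli n) : bool := [forall j, (a j == 0) || (a j == g j)].

Lemma stab_span_singles (s : seq 'I_n) : uniq s ->
  stab_span [seq single j | j <- s] =
  [set a : pauli n | agrees a && [forall j, (j \notin s) ==> (a j == 0)]].
Proof.
elim: s => [_|i s IH /= /andP[si us]].
  apply/setP => a; rewrite !inE; apply/eqP/andP => [->|[_ /forallP H]].
    by split; apply/forallP => j; rewrite ffunE eqxx.
  by apply/ffunP => j; rewrite ffunE; apply/eqP/(implyP (H j)).
rewrite /= in IH *; rewrite IH //; apply/setP => a; rewrite !inE.
apply/orP/andP.
  case=> [/andP[ag /forallP H]|/imsetP[b]].
    split=> //; apply/forallP => j; apply/implyP; rewrite inE negb_or => /andP[_ js].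
    exact: (implyP (H j)).
  rewrite inE => /andP[/forallP ag /forallP H] ->; split.
    apply/forallP => j; rewrite !ffunE; case: (eqVneq j i) => [ji|_]; last by rewrite add0r; exact: ag.
    rewrite ji; have /eqP -> := implyP (H i) si; by rewrite addr0 eqxx orbT.
  apply/forallP => j; apply/implyP; rewrite inE negb_or => /andP[ji js].
  by rewrite !ffunE (negbTE ji) add0r; exact: (implyP (H j)).
move=> [/forallP ag /forallP H].
have [ai|ai] := eqVneq (a i) 0.
  left; apply/andP; split; first exact/forallP.
  apply/forallP => j; apply/implyP => js; have [->|ji] := eqVneq j i; first exact/eqP.
  by apply: (implyP (H j)); rewrite inE negb_or ji.
have ag' : a i = g i by apply/eqP; have := ag i; rewrite (negbTE ai).
right; apply/imsetP; exists (single i + a); last by rewrite addrA pauli_addxx add0r.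
rewrite inE; apply/andP; split; apply/forallP => j; rewrite ?ffunE ?[_ j]ffunE.
  by case: (eqVneq j i) => [->|_]; rewrite ?add0r ?ag' ?letter_addxx ?eqxx.
apply/implyP => js; case: (eqVneq j i) => [->|ji]; first by rewrite ag' letter_addxx.
by rewrite add0r; apply: (implyP (H j)); rewrite inE negb_or ji.
Qed.

Lemma stab_span_basis : stab_span basis_gens = [set a | agrees a].
Proof.
have E : stab_span [seq single j | j <- enum 'I_n] = [set a | agrees a].
  rewrite stab_span_singles ?enum_uniq //; apply/setP => a; rewrite !inE.
  by rewrite (_ : [forall j, _]) ?andbT //; apply/forallP => j; rewrite mem_enum.
rewrite /basis_gens /= -/(stab_span _) E; apply/setP => a; rewrite !inE.
apply/orP/idP => [[//|/imsetP[b]]|]; last by left.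
rewrite inE => /forallP ag ->; apply/forallP => j; rewrite ffunE.
by have /orP[/eqP ->|/eqP ->] := ag j; rewrite ?addr0 ?letter_addxx ?eqxx ?orbT.
Qed.

Lemma basis_stabilizer : stabilizer_group (stab_span basis_gens).
Proof.
rewrite stab_span_basis; split=> [|a b|a b]; rewrite !inE.
- by apply/forallP => j; rewrite ffunE eqxx.
- move=> /forallP aP /forallP bP; apply/forallP => j; rewrite ffunE.
  have /orP[/eqP ->|/eqP ->] := aP j; first by rewrite add0r; exact: bP.
  by have /orP[/eqP ->|/eqP ->] := bP j; rewrite ?addr0 ?letter_addxx ?eqxx ?orbT.
- move=> /forallP aP /forallP bP; apply: big1 => j _.
  have /orP[/eqP ->|/eqP ->] := aP j; first by rewrite !mul0r addr0.
  have /orP[/eqP ->|/eqP ->] := bP j; first by rewrite !mulr0 addr0.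
  by rewrite [X in X + _]mulrC; exact: Z2_addxx.
Qed.

End LocalBasis.

(** * Meaning of the output of the program *)

Section Lists.
Variable n : nat.
Implicit Types (x y a r : pauli n) (l : seq 'I_n) (B S : {set 'I_n}).

Definition graph_on l x : seq ('I_n * letter) := [seq (j, x j) | j <- l].

Lemma mem_letters (u : letter) : u \in letters.
Proof. by case: u => a b; case: (Z2P a) (Z2P b) => -> [->|->]. Qed.

Lemma graph_on_asg l x : graph_on l x \in asg l.
Proof.
elim: l => [|j l IH] //.
by apply/allpairsPdep; exists (x j), (graph_on l x); split=> //; exact: mem_letters.
Qed.

Lemma lookup_graph_on l x j : lookup j (graph_on l x) = if j \in l then x j else 0.
Proof.
elim: l => [|i l IH] //=; rewrite inE IH.
by case: eqP => [->|].
Qed.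

Lemma asg_graph l (a : seq ('I_n * letter)) : uniq l -> a \in asg l -> a = graph_on l [ffun j => lookup j a].
Proof.
elim: l a => [|j l IH] a; first by rewrite mem_seq1 => _ /eqP ->.
rewrite cons_uniq => /andP[jl ul] /allpairsPdep[u [w [_ wl ->]]].
rewrite /graph_on /= ffunE /= eqxx; congr (_ :: _).
rewrite {1}(IH w ul wl); apply/eq_in_map => i il; rewrite !ffunE /=.
by case: eqP => // ij; rewrite -ij il in jl.
Qed.

Lemma uniq_asg l : uniq (asg l).
Proof.
elim: l => [|j l IH] //; rewrite -[asg _]/[seq (j, u) :: w | u <- letters, w <- asg l].
by apply: allpairs_uniq => // -[u w] [u' w'] _ _ [-> ->].
Qed.

(** Turns a loop over the assignments of a list of qubits into a sum over the labels supported
    there. *)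
Lemma big_asg (V : Type) (idx : V) (op : Monoid.com_law idx) l
    (P : pred (seq ('I_n * letter))) (F : seq ('I_n * letter) -> V) : uniq l ->
  \big[op/idx]_(a <- asg l | P a) F a =
  \big[op/idx]_(x : pauli n | (restr [set j in l] x == x) && P (graph_on l x)) F (graph_on l x).
Proof.
move=> ul; transitivity (\big[op/idx]_(a <- [seq graph_on l x | x <- enum [pred x : pauli n | restr [set j in l] x == x]] | P a) F a).
  apply: perm_big; apply: uniq_perm; first exact: uniq_asg.
    rewrite map_inj_in_uniq ?enum_uniq // => x y; rewrite !mem_enum !inE => /eqP xl /eqP yl E.
    rewrite -xl -yl; apply/ffunP => j; rewrite !ffunE inE.
    by have := congr1 (lookup j) E; rewrite !lookup_graph_on.
  move=> a; apply/idP/mapP => [al|[x _ ->]]; last exact: graph_on_asg.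
  exists [ffun j => lookup j a]; last exact: asg_graph.
  rewrite mem_enum inE; apply/restr_idP => j; rewrite inE ffunE => jl.
  by rewrite (asg_graph ul al) lookup_graph_on (negbTE jl).
by rewrite big_map big_enum_cond.
Qed.

Lemma anti_symp (u v : letter) : u.1 * v.2 + u.2 * v.1 = (anti u v)%:R :> 'Z_2.
Proof.
case: u v => [a b] [c d] /=.
by case: (Z2P a) (Z2P b) (Z2P c) (Z2P d) => -> [->|->] [->|->] [->|->]; apply/val_inj.
Qed.

Lemma natr_Z2 m : m%:R = (odd m)%:R :> 'Z_2.
Proof.
elim: m => // m IH; rewrite -natr1 IH /=.
by case: (odd m); apply/val_inj.
Qed.

Lemma sign_on_symp l x r : uniq l -> restr [set j in l] x = x ->
  symp x r = (sign_on r (graph_on l x))%:R.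
Proof.
move=> ul /eqP/restr_idP xl; rewrite /sign_on count_map -natr_Z2.
rewrite /symp (eq_bigr (fun j => (anti (x j) (r j))%:R)) => [|j _]; last exact: anti_symp.
rewrite -natr_sum -sum1_count; congr (_%:R).
rewrite (bigID (mem l)) /= [X in (_ + X)%N]big1 ?addn0 => [|j jl]; last first.
  by rewrite xl ?inE // /anti eqxx.
rewrite -big_uniq //= [RHS]big_mkcond /=; apply: eq_bigr => j _.
by case: (anti _ _).
Qed.

Lemma sign_on_sympE l x r : uniq l -> restr [set j in l] x = x ->
  sign_on r (graph_on l x) = (symp x r != 0).
Proof. by move=> ul xl; rewrite (sign_on_symp _ ul xl); case: (sign_on _ _). Qed.

Lemma agrees_onE l g x : restr [set j in l] x = x ->
  agrees_on g (graph_on l x) = agrees g x.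
Proof.
move=> /eqP/restr_idP xl; rewrite /agrees_on all_map; apply/allP/forallP => [H j|H j _].
  have [jl|jl] := boolP (j \in l); first exact: H.
  by rewrite xl ?inE ?eqxx.
exact: H.
Qed.

Definition full_graph x := graph_on (enum 'I_n) x.

Lemma restr_enum x : restr [set j in enum 'I_n] x = x.
Proof. by apply/ffunP => j; rewrite ffunE inE mem_enum. Qed.

Definition fhat (s : seq (sample n)) x : nat := eigenvalue_estimate (full_graph x) s.

(** Identity letters affect neither the compatibility with a basis nor the sign, so the estimate
    depends on the label and not on the list on which it is written. *)
Lemma eigenvalue_estimate_graph l x s : uniq l -> restr [set j in l] x = x ->
  eigenvalue_estimate (graph_on l x) s = fhat s x.
Proof.
move=> ul xl.
have E k e : cnt k e (graph_on l x) s = cnt k e (full_graph x) s.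
  apply: eq_count => t; rewrite !agrees_onE ?restr_enum //.
  by rewrite !sign_on_sympE ?restr_enum ?enum_uniq.
by rewrite /fhat /eigenvalue_estimate !E.
Qed.

(* Estimates [T * 4 ^ #|B|] times the marginal on [B]; the truncated subtraction
   only helps, marginals being nonnegative, and the successor keeps it positive. *)
Definition joint_estimate (s : seq (sample n)) B y : nat :=
  ((\sum_(a : pauli n | (restr B a == a) && (symp a y == 0%R)) fhat s a) -
   (\sum_(a : pauli n | (restr B a == a) && (symp a y != 0%R)) fhat s a))%N.+1.

Variable C : {set {set 'I_n}}.
Definition factor_lists : seq (seq 'I_n) := [seq enum D | D : {set 'I_n} <- enum C].

Lemma set_clos S l : [set j in l] = S -> [set j in clos l factor_lists] = mb_closure C S.
Proof.
move=> lS.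
have lP j : (j \in l) = (j \in S) by rewrite -lS inE.
have H (s : seq {set 'I_n}) j : (j \in clos l [seq enum D | D : {set 'I_n} <- s]) =
    (j \in S) || has (fun D : {set 'I_n} => (D :&: S != set0) && (j \in D)) s.
  elim: s => [|D s IH] /=; first by rewrite lP orbF.
  have -> : has (mem l) (enum D) = (D :&: S != set0).
    apply/hasP/set0Pn => [[b]|[b]]; rewrite ?mem_enum ?inE.
      by move=> bD bl; exists b; rewrite inE bD -lP.
    by case/andP => bD bS; exists b; rewrite ?mem_enum ?inE //= lP.
  case: ifP => DS /=; last exact: IH.
  by rewrite mem_union IH mem_enum -orbA; congr (_ || _); rewrite orbC.
apply/setP => j; rewrite inE H !inE; case: (j \in S) => //=.
apply/hasP/bigcupP => [[D]|[D /andP[DC DS] jD]].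
  by rewrite mem_enum => DC /andP[DS jD]; exists D; rewrite ?DC.
by exists D; rewrite ?mem_enum // DS.
Qed.

Lemma local_estimateE s l x : uniq l ->
  local_estimate s factor_lists l (graph_on l x) =
  joint_estimate s (mb_closure C [set j in l]) (restr [set j in l] x).
Proof.
move=> ul; have clu : uniq (clos l factor_lists) by exact: clos_uniq.
have E e : part s e (graph_on l x) (asg (clos l factor_lists)) =
    (\sum_(a : pauli n | (restr (mb_closure C [set j in l]) a == a) &&
       ((symp a (restr [set j in l] x) != 0%R) == e)) fhat s a)%N.
  rewrite /part big_asg // (@set_clos [set j in l]) //.
  apply: eq_big => [a|a /andP[/eqP aB _]].
    case: eqP => //= aB; rewrite -(@sign_on_sympE (clos l factor_lists)) //; last by rewrite (@set_clos [set j in l]).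
    congr (_ == _); congr (odd _); apply: eq_count => p.
    by rewrite lookup_graph_on ffunE inE.
  by rewrite eigenvalue_estimate_graph // (@set_clos [set j in l]).
rewrite /local_estimate /joint_estimate !E; congr (_ - _).+1; apply: eq_bigl => a; last by rewrite eqb_id.
by rewrite eqbF_neg negbK.
Qed.

End Lists.

Section Output.
Variables (R : realType) (n : nat) (s : seq (sample n)) (C : {set {set 'I_n}}).
Implicit Types (x : pauli n) (l c : seq 'I_n) (D S : {set 'I_n}).

Definition signed_power (o : bool) (v : R) : R := if o then v^-1 else v.

Lemma table_value_local o l x : uniq l ->
  table_value R (local_table s (factor_lists C) o l) x =
  signed_power o (joint_estimate s (mb_closure C [set j in l]) (restr [set j in l] x))%:R.
Proof.
move=> ul; rewrite /table_value /local_table /=.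
rewrite /unzip1 /unzip2 -!map_comp /=.
set i := index _ _.
have yE : [seq x j | j <- l] = unzip2 (graph_on l x) by rewrite /unzip2 -map_comp.
have il : (i < size (asg l))%N.
  rewrite -(size_map (fun a => unzip2 a)) index_mem yE; apply: map_f; exact: graph_on_asg.
have nE : nth [::] (asg l) i = graph_on l x.
  have ia := mem_nth [::] il; rewrite (asg_graph ul ia).
  have := nth_index [::] (_ : [seq x j | j <- l] \in [seq unzip2 a | a <- asg l]).
  rewrite -/i (nth_map [::]) // => /(_ _) H.
  have {}H : unzip2 (nth [::] (asg l) i) = [seq x j | j <- l].
    by apply: H; rewrite yE; apply: map_f; exact: graph_on_asg.
  rewrite (asg_graph ul ia) /unzip2 -map_comp in H.
  apply/eq_in_map => j jl; congr pair.
  by move/eq_in_map: H => /(_ j jl).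
rewrite (nth_map [::]) //= nE local_estimateE //.
by rewrite /signed_power; case: (o); rewrite /= ?divr1 ?div1r.
Qed.

Lemma uniq_subs l : uniq l -> uniq (subs l).
Proof.
elim: l => //= j l IH /andP[jl ul]; rewrite cat_uniq map_inj_uniq ?IH //= => [|? ? []//].
rewrite andbT; apply/hasPn => w wl; apply/mapP => -[w' _ E].
by move: wl; rewrite subs_subseq E => /mem_subseq /(_ j (mem_head _ _)); rewrite (negbTE jl).
Qed.

Lemma big_subs (V : Type) (idx : V) (op : Monoid.com_law idx) l (P : pred {set 'I_n}) (F : {set 'I_n} -> V) :
  uniq l ->
  \big[op/idx]_(w <- subs l | P [set j in w]) F [set j in w] =
  \big[op/idx]_(S in powerset [set j in l] | P S) F S.
Proof.
move=> ul; transitivity (\big[op/idx]_(S <- [seq [set j in w] | w <- subs l] | P S) F S).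
  by rewrite big_map.
rewrite -[RHS]big_enum_cond; apply: perm_big; apply: uniq_perm; last first.
- move=> S; rewrite mem_enum powersetE; apply/mapP/idP => [[w]|Sl].
    rewrite subs_subseq => /mem_subseq wl ->; apply/subsetP => j; rewrite !inE; exact: wl.
  exists [seq j <- l | j \in S]; first by rewrite subs_subseq filter_subseq.
  apply/setP => j; rewrite inE mem_filter; case jS : (j \in S) => //=.
  by have := subsetP Sl j jS; rewrite inE.
- exact: enum_uniq.
- rewrite map_inj_in_uniq ?uniq_subs // => w w'; rewrite !subs_subseq.
  move=> /(subseq_uniqP ul) -> /(subseq_uniqP ul) -> E.
  apply: eq_in_filter => j jl; have := congr1 (fun A : {set 'I_n} => j \in A) E.
  by rewrite !inE !mem_filter jl !andbT.
Qed.

(** Along the list of factors, a set contained in a later factor is already in the product by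
    induction, and any other subset of [c] is added now; hence each subfactor occurs once. *)
Lemma output_prod (v : bool -> {set 'I_n} -> R) (h : table n -> R) (cs : seq (seq 'I_n)) :
  (forall o l, uniq l -> h (local_table s (factor_lists C) o l) = v o [set j in l]) ->
  all uniq cs ->
  \prod_(f <- output s (factor_lists C) cs) h f =
  \prod_(D | (D != set0) && has (fun c => D \subset [set j in c]) cs)
    \prod_(S in powerset D) v (odd (#|D| - #|S|)) S.
Proof.
move=> hv; elim: cs => [|c cs IH] /=.
  by rewrite big_nil big_pred0 // => D; rewrite andbF.
case/andP => uc ucs.
pose W D := \prod_(S in powerset D) v (odd (#|D| - #|S|)) S.
have fold_prod (A : eqType) (ls : seq A) (P : pred A) (F : A -> seq (table n)) acc :
  \prod_(f <- foldr (fun d acc => if P d then F d ++ acc else acc) acc ls) h f =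
  (\prod_(d <- ls | P d) \prod_(f <- F d) h f) * \prod_(f <- acc) h f.
  elim: ls => [|d ls IHl] /=; first by rewrite big_nil mul1r.
  by rewrite [in RHS]big_cons; case: (P d) => //; rewrite big_cat /= IHl mulrA.
rewrite fold_prod IH // -/W.
have -> : \prod_(d <- subs c | (d != [::]) && ~~ has (fun c0 => all (mem c0) d) cs)
    \prod_(f <- [seq local_table s (factor_lists C) (odd (size d - size U)) U | U <- subs d]) h f =
  \prod_(D in powerset [set j in c] | (D != set0) && ~~ has (fun c => D \subset [set j in c]) cs) W D.
  rewrite -(big_subs _ (fun D => (D != set0) && ~~ has (fun c => D \subset [set j in c]) cs) W uc).
  rewrite big_seq_cond [RHS]big_seq_cond; apply: eq_big => [d|d].
    congr (_ && _); congr (~~ _ && ~~ _).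
      apply/eqP/eqP => [->|]; first by apply/setP => j; rewrite !inE.
      by case: d => // j d /setP /(_ j); rewrite !inE eqxx.
    apply: eq_has => c'; apply/allP/subsetP => H j; first by rewrite !inE; exact: H.
    by have := H j; rewrite !inE.
  case/andP; rewrite subs_subseq => dc _.
  have ud := subseq_uniq dc uc.
  transitivity (\prod_(w <- subs d) v (odd (#|[set j in d]| - #|[set j in w]|)) [set j in w]).
    rewrite big_map big_seq_cond [RHS]big_seq_cond.
    apply: eq_bigr => w; rewrite andbT subs_subseq => wd.
    have uw := subseq_uniq wd ud.
    by rewrite hv // !cardsE (card_uniqP ud) (card_uniqP uw).
  rewrite (big_subs _ xpredT (fun S => v (odd (#|[set j in d]| - #|S|)) S) ud).
  by apply: eq_bigl => S; rewrite andbT.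
rewrite [RHS](bigID (fun D => has (fun c => D \subset [set j in c]) cs)) /= mulrC; congr (_ * _).
  apply: eq_bigl => D; case: (D != set0) => //=.
  by case: (has _ cs); rewrite ?orbT ?andbT ?andbF.
apply: eq_bigl => D; rewrite powersetE; case: (D != set0); rewrite ?andbF //=.
by case: (has _ cs); rewrite ?orbT ?andbT ?andbF ?orbF.
Qed.

Lemma output_weight x :
  \prod_(f <- output s (factor_lists C) (factor_lists C)) table_value R f x =
  weight C (fun S x => (joint_estimate s (mb_closure C S) (restr S x))%:R) x.
Proof.
rewrite (@output_prod (fun o S => signed_power o (joint_estimate s (mb_closure C S) (restr S x))%:R)); last first.
- by apply/allP => _ /mapP[D _ ->]; exact: enum_uniq.
- by move=> o l ul; exact: table_value_local.
apply: eq_big => [D|D _].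
  rewrite mem_subfactors; congr (_ && _); apply/hasP/exists_inP => [[w /mapP[E EC wE] DE]|[E EC DE]].
    exists E; first by rewrite -mem_enum.
    rewrite wE in DE; by apply: subset_trans DE _; apply/subsetP => j; rewrite inE mem_enum.
  exists (enum E); first by apply: map_f; rewrite mem_enum.
  by apply: subset_trans DE _; apply/subsetP => j; rewrite inE mem_enum.
rewrite expR_sum; apply: eq_bigr => S _.
rewrite -signr_odd /signed_power; case: (odd _).
  by rewrite expr1 mulN1r expRN lnK // posrE ltr0n.
by rewrite expr0 mul1r lnK // posrE ltr0n.
Qed.

End Output.

(** * The experiments *)

Lemma sum_parity (V : nmodType) (F : nat -> V) m l : (l < 2)%N ->
  \sum_(0 <= t < 2 * m | (t %% 2 == l)%N) F t = \sum_(0 <= u < m) F (2 * u + l)%N.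
Proof.
move=> l2; elim: m => [|m IH]; first by rewrite !big_geq.
rewrite [RHS]big_nat_recr //= -IH (_ : 2 * m.+1 = (2 * m).+2)%N; last by rewrite mulnS.
rewrite big_mkcond big_nat_recr //= big_nat_recr //= -big_mkcond /= -addrA; congr (_ + _).
have -> : ((2 * m) %% 2 = 0)%N by rewrite modnMr.
have -> : ((2 * m).+1 %% 2 = 1)%N by rewrite -addn1 mulnC modnMDl.
by case: l l2 {IH} => [|[|//]] _; rewrite /= ?addr0 ?add0r ?addn0 ?addn1.
Qed.

Lemma sum_periodic (V : nmodType) (F : nat -> V) M q :
  \sum_(0 <= u < M * q) F (u %% M)%N = (\sum_(0 <= i < M) F i) *+ q.
Proof.
elim: q => [|q IH]; first by rewrite muln0 big_geq.
rewrite mulnS addnC (big_cat_nat (n := M * q)) ?leq_addr //= IH mulrSr; congr (_ + _).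
rewrite -{1}[(M * q)%N]add0n [(M * q + M)%N]addnC big_addn addnK.
by apply: eq_big_nat => i /andP[_ iM]; rewrite addnC mulnC modnMDl modn_small.
Qed.

Notation assignment nu := {ffun 'I_(nu * nu * nu).+1 -> letter}.

Section Design.
Variables (n nu : nat) (col : 'I_n -> 'I_(nu * nu * nu).+1).

Definition period : nat := #|{: assignment nu}|.

Lemma period_gt0 : (0 < period)%N.
Proof. by apply/card_gt0P; exists [ffun => 0]. Qed.

(** Qubits of equal colour share their letter, so the number of different bases does not depend on
    [n]. *)
Definition basis_string (u : nat) : pauli n :=
  [ffun j => (nth [ffun => 0] (enum {: assignment nu}) (u %% period)) (col j)].

Definition rounds (T : nat) : nat := (T %/ (2 * period))%N.

(* Runs [2u] and [2u + 1] use the basis of index [u] with lengths 0 and 1; the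
   leftover runs get length 2 and are ignored. *)
Definition design_len (T t : nat) : nat :=
  if (t < 2 * (period * rounds T))%N then (t %% 2)%N else 2%N.

Definition design (T : nat) (t : 'I_T) : setting n :=
  Setting (basis_gens (basis_string (t %/ 2))) (design_len T t).

Definition slots (T : nat) (l : nat) (a : pauli n) : {set 'I_T} :=
  [set t : 'I_T | (design_len T t == l) && agrees (basis_string (t %/ 2)) a].

Lemma rounds_le T : (2 * (period * rounds T) <= T)%N.
Proof. by rewrite mulnA mulnC leq_trunc_div. Qed.

(** The right-hand side is free of [l]: lengths 0 and 1 are run in the same bases. Hence their slots
    are equally many and carry the same SPAM parameters, which cancel in the ratio. *)
Lemma sum_slots (V : nmodType) (F : nat -> V) T l a : (l < 2)%N ->
  \sum_(t in slots T l a) F (t %/ 2)%N =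
  \sum_(0 <= u < period * rounds T | agrees (basis_string u) a) F u.
Proof.
move=> l2; pose G t := if agrees (basis_string (t %/ 2)) a then F (t %/ 2)%N else 0.
transitivity (\sum_(0 <= t < 2 * (period * rounds T) | (t %% 2 == l)%N) G t).
  rewrite (eq_bigl (fun t : 'I_T => (design_len T t == l) && agrees (basis_string (t %/ 2)) a)); last by move=> t; rewrite inE.
  rewrite big_mkcondr /= -(big_mkord (fun t => design_len T t == l) G).
  rewrite (big_cat_nat (n := 2 * (period * rounds T))) ?rounds_le //= [X in _ + X]big1_seq ?addr0.
    rewrite big_nat_cond [RHS]big_nat_cond; apply: eq_bigl => t.
    by rewrite /design_len; case: (ltnP t (2 * (period * rounds T))) => h; rewrite ?andbT ?andbF.
  move=> t /andP[]; rewrite mem_index_iota /design_len => + /andP[lt _].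
  by rewrite ltnNge lt /= => /eqP tl; rewrite -tl in l2.
rewrite sum_parity // [RHS]big_mkcond; apply: eq_bigr => u _.
by rewrite /G mulnC divnMDl // divn_small // addn0.
Qed.

Variable C : {set {set 'I_n}}.
Hypothesis col_inj : forall D, D \in C -> {in mb_closure C D &, injective col}.

(** On a closure the colours are distinct, so some assignment of letters to colours reproduces [a];
    its basis recurs in every pass through the period. *)
Lemma slots_ge T l a D : (l < 2)%N -> D \in C -> restr (mb_closure C D) a = a ->
  (rounds T <= #|slots T l a|)%N.
Proof.
move=> l2 DC /eqP/restr_idP aD.
pose alpha : assignment nu :=
  [ffun c => if [pick j in mb_closure C D | col j == c] is Some j then a j else 0].
pose i0 := index alpha (enum {: assignment nu}).
have i0M : (i0 < period)%N by rewrite /period cardE index_mem mem_enum.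
have ag : agrees (basis_string i0) a.
  apply/forallP => j; have [jD|jD] := boolP (j \in mb_closure C D); last by rewrite aD ?eqxx.
  rewrite ffunE modn_small // nth_index ?mem_enum // ffunE.
  case: pickP => [i /andP[iD /eqP cij]|/(_ j)]; last by rewrite jD eqxx.
  by rewrite (col_inj DC iD jD cij) eqxx orbT.
rewrite -sum1_card (sum_slots (fun=> 1%N)) // big_mkcond /=.
rewrite (eq_bigr (fun u => (agrees (basis_string (u %% period)) a : nat))); last first.
  move=> u _; rewrite (_ : basis_string (u %% period) = basis_string u); first by case: (agrees _ a).
  by apply/ffunP => j; rewrite !ffunE modn_mod.
rewrite (sum_periodic (fun u => (agrees (basis_string u) a : nat))).
have h : (1 <= \sum_(0 <= i < period) (agrees (basis_string i) a : nat))%N.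
  by rewrite big_mkord (bigD1 (Ordinal i0M)) //= ag.
have mE (x : nat) k : x *+ k = (x * k)%N by elim: k => [|k IH]; rewrite ?muln0 // mulrS IH mulnS.
by rewrite mE; apply: leq_pmull; exact: h.
Qed.

Definition samples_of (T : nat) (w : outcomes n T) : seq (sample n) :=
  [seq ((basis_string (t %/ 2), [seq single (basis_string (t %/ 2)) j | j <- enum 'I_n]),
        (design_len T t, rep (w t))) | t : 'I_T <- enum 'I_T].

Lemma size_samples_of T (w : outcomes n T) : size (samples_of w) = T.
Proof. by rewrite size_map size_enum_ord. Qed.

Lemma samples_of_len T (w : outcomes n T) : all (fun t : sample n => t.2.1 <= 2)%N (samples_of w).
Proof.
apply/allP => _ /mapP[t _ ->] /=; rewrite /design_len; case: ifP => // _.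
by rewrite ltnW // ltn_mod.
Qed.

Lemma enc_samples_of T (w : outcomes n T) :
  enc_input C (@design T) w =
  Node (Leaf n) (Node (enc_list (enc_list (@enc_ord n)) (factor_lists C))
    (enc_list (@enc_sample n) (samples_of w))).
Proof.
have encmap A B' (f : A -> B') (g : B' -> data) s : enc_list g [seq f i | i <- s] = enc_list (g \o f) s.
  by rewrite /enc_list foldr_map.
by rewrite /enc_input /factor_lists /samples_of !encmap.
Qed.

Lemma cnt_slots T (w : outcomes n T) l e a :
  cnt l e (full_graph a) (samples_of w) =
  #|[set t in slots T l a | (symp a (rep (w t)) != 0) == e]|.
Proof.
rewrite /cnt count_map -sum1_count big_enum_cond -[RHS]sum1_card; apply: eq_bigl => t /=.
rewrite !inE -andbA /=.
by rewrite agrees_onE ?restr_enum // sign_on_sympE ?restr_enum ?enum_uniq.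
Qed.

End Design.

(** * Simultaneous accuracy of the eigenvalue estimates *)

Section Deviation.
Variables (R : realType) (n nu : nat) (col : 'I_n -> 'I_(nu * nu * nu).+1).
Variable C : {set {set 'I_n}}.
Hypothesis col_inj : forall D, D \in C -> {in mb_closure C D &, injective col}.
Hypothesis closure_le : forall D, D \in C -> (#|mb_closure C D| <= nu)%N.
Variable L : op R n -> op R n.
Hypotheses (LD : forall A B : op R n, L (A + B) = L A + L B)
  (LZ : forall c (A : op R n), L (c *: A) = c *: L A).
Variables (rho : {set pauli n} -> op R n) (E : {set pauli n} -> {set pauli n} -> op R n).
Hypotheses (gtmL : gtm L rho E) (weak : half_weak L) (stable : half_stable L rho E).
Variable T : nat.

Let group (t : nat) := stab_span (basis_gens (basis_string col (t %/ 2))).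
Let mu (t : 'I_T) (c : {set pauli n}) : R := sample_prob L rho E (group t) (design_len nu T t) c.
Let X (a : pauli n) (t : 'I_T) (c : {set pauli n}) : R := sgn_symp R a (rep c).

Lemma mu_ge0 t c : 0 <= mu t c.
Proof. by apply: sample_prob_ge0 => //; exact: basis_stabilizer. Qed.

Lemma mu_sum t : \sum_c mu t c = 1.
Proof. by apply: sample_prob_sum1 => //; exact: basis_stabilizer. Qed.

Lemma mean_slots a l t : t \in slots col T l a ->
  mean mu (X a) t = spam L rho E (group t) a * pauli_eigenvalue L a ^+ l.
Proof.
rewrite inE => /andP[/eqP tl ta]; rewrite /mean /mu tl; apply: sample_expect => //.
by rewrite /group stab_span_basis inE.
Qed.

Definition local_labels : {set pauli n} :=
  \bigcup_(D in C) [set a | restr (mb_closure C D) a == a].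

Lemma card_supported (B : {set 'I_n}) : #|[set a : pauli n | restr B a == a]| = (4 ^ #|B|)%N.
Proof.
rewrite [X in (4 ^ X)%N]cardE -size_asg -sum1_size.
rewrite (big_asg _ xpredT) ?enum_uniq // -sum1_card; apply: eq_bigl => a.
rewrite inE andbT; congr (restr _ _ == _); apply/setP => j; by rewrite inE mem_enum.
Qed.

Lemma card_local_labels : (#|local_labels| <= #|C| * 4 ^ nu)%N.
Proof.
by apply: card_bigcup_le => D DC; rewrite card_supported leq_exp2l // closure_le.
Qed.

Definition deviation a l (w : outcomes n T) : R :=
  \sum_(t in slots col T l a) (X a t (w t) - mean mu (X a) t).

Definition concentrated (eta : R) (w : outcomes n T) : bool :=
  [forall a in local_labels, [forall l : 'I_2, `|deviation a l w| <= eta * #|slots col T l a|%:R]].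

(** Union bound over two lengths, two tails and the local labels, which gives the factor 4. The
    means of the runs may differ from run to run, since the bases do. *)
Lemma prob_concentrated (eta : R) : 0 < eta <= 1 ->
  1 - (4 * (#|C| * 4 ^ nu))%:R * expR (- (eta ^+ 2 / 32 * (rounds nu T)%:R)) <=
  \sum_(w | concentrated eta w) \prod_t mu t (w t).
Proof.
move=> eta01; have W0 (w : outcomes n T) : 0 <= \prod_t mu t (w t) by apply: prodr_ge0 => t _; exact: mu_ge0.
have X1 a t c : `|X a t c| <= 1 by rewrite /X /sgn_symp normrX normrN1 expr1n.
set q := expR _.
have tail a (l : 'I_2) : a \in local_labels ->
    \sum_(w | ~~ (`|deviation a l w| <= eta * #|slots col T l a|%:R)) \prod_t mu t (w t) <= q + q.
  case/bigcupP => D DC; rewrite inE => /eqP aD.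
  have small : expR (- (eta ^+ 2 / 32 * #|slots col T l a|%:R)) <= q.
    rewrite ler_expR lerN2 ler_wpM2l ?divr_ge0 ?sqr_ge0 // ler_nat.
    exact: slots_ge aD.
  apply: (@le_trans _ _ (\sum_(w | eta * #|slots col T l a|%:R < deviation a l w) \prod_t mu t (w t)
     + \sum_(w | eta * #|slots col T l a|%:R < - deviation a l w) \prod_t mu t (w t))).
    rewrite big_mkcond [X in X + _]big_mkcond [X in _ + X]big_mkcond -big_split /=.
    apply: ler_sum => w _; rewrite -ltNge; case: ifP => [|_]; last first.
      by apply: addr_ge0; case: ifP.
    by rewrite real_ltr_normr ?num_real // => /orP[->|->]; rewrite ?lerDl ?lerDr; case: ifP.
  apply: lerD; first exact: le_trans (chernoff mu_ge0 mu_sum _ eta01 (X1 a)) small.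
  have NX1 t c : `|- X a t c| <= 1 by rewrite normrN.
  apply: le_trans small; apply: le_trans (chernoff mu_ge0 mu_sum _ eta01 NX1).
  rewrite le_eqVlt; apply/orP; left; apply/eqP; apply: eq_bigl => w; congr (_ < _).
  rewrite /deviation -sumrN; apply: eq_bigr => t _.
  rewrite opprD /mean; congr (_ - _); rewrite -sumrN; apply: eq_bigr => o _.
  by rewrite mulrN.
rewrite lerBlDr -[leLHS](total_prob mu_sum) (bigID (concentrated eta)) /= lerD2l.
apply: (@le_trans _ _ (\sum_(a in local_labels) \sum_(l < 2)
    \sum_(w | ~~ (`|deviation a l w| <= eta * #|slots col T l a|%:R)) \prod_t mu t (w t))).
  under [leRHS]eq_bigr => a _ do under eq_bigr do rewrite big_mkcond.
  rewrite (eq_bigr (fun a => \sum_w \sum_(l < 2) if ~~ (`|deviation a l w| <= eta * #|slots col T l a|%:R)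
      then \prod_t mu t (w t) else 0)); last by move=> a _; rewrite exchange_big.
  rewrite [leRHS]exchange_big /= big_mkcond; apply: ler_sum => w _.
  have nn a (l : 'I_2) : 0 <= if ~~ (`|deviation a l w| <= eta * #|slots col T l a|%:R)
      then \prod_t mu t (w t) else 0 by case: ifP.
  case: ifP => [|_]; last by apply: sumr_ge0 => a _; exact: sumr_ge0.
  rewrite negb_forall => /existsP[a]; rewrite negb_imply => /andP[aL].
  rewrite negb_forall => /existsP[l dev].
  rewrite (bigD1 a) //= (bigD1 l) //= dev -addrA lerDl addr_ge0 //; first exact: sumr_ge0.
  by apply: sumr_ge0 => b _; exact: sumr_ge0.
apply: (@le_trans _ _ (\sum_(a in local_labels) (q + q) *+ 2)).
  apply: ler_sum => a aL; rewrite -[X in _ *+ X](card_ord 2) -sumr_const.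
  by apply: ler_sum => l _; exact: tail.
have -> : \sum_(a in local_labels) (q + q) *+ 2 = (4 * #|local_labels|)%:R * q.
  by rewrite sumr_const -[LHS]mulr_natr natrM; ring.
by rewrite ler_wpM2r ?expR_ge0 // ler_nat leq_mul2l card_local_labels.
Qed.

(** Both empirical sums are within [eta * K] of [S0] and [f * S0], with the same [S0 >= K / 2]. They
    are positive, so the truncated subtractions of the program are exact, and rounding down its
    quotient costs at most [1 / T]. *)
Lemma fhat_close (eta : R) (w : outcomes n T) a : 0 < eta <= 8^-1 -> (0 < rounds nu T)%N ->
  concentrated eta w -> a \in local_labels ->
  `|(fhat (samples_of col w) a)%:R / T%:R - pauli_eigenvalue L a| <= 8 * eta + T%:R^-1.
Proof.
move=> /andP[eta0 eta8] r0 /forall_inP /(_ a) conc aL.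
have /forallP dev := conc aL.
set f := pauli_eigenvalue L a.
have /andP[f1 f2] : 2^-1 <= f <= 1 := weak a.
have [D DC /[!inE]/eqP aD] := bigcupP aL.
pose K := #|slots col T 0 a|.
have K1 : #|slots col T 1 a| = K.
  by rewrite /K -!sum1_card !(sum_slots col (fun=> 1%N)).
have K0 : 0 < K%:R :> R.
  by rewrite ltr0n; apply: leq_trans r0 (slots_ge col_inj T _ DC aD).
pose sp u := spam L rho E (stab_span (basis_gens (basis_string col u))) a.
pose S0 := \sum_(t in slots col T 0 a) sp (t %/ 2)%N.
have S1E : \sum_(t in slots col T 1 a) sp (t %/ 2)%N = S0 by rewrite /S0 !sum_slots.
have S0ge : K%:R / 2 <= S0.
  apply: (@le_trans _ _ (\sum_(t in slots col T 0 a) 2^-1)).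
    by rewrite sumr_const -[leRHS]mulr_natl.
  apply: ler_sum => t; rewrite inE => /andP[_ ta]; apply: stable; first exact: basis_stabilizer.
  by rewrite stab_span_basis inE.
pose Z l := \sum_(t in slots col T l a) X a t (w t).
have ZE l : Z l = (cnt l false (full_graph a) (samples_of col w))%:R
                  - (cnt l true (full_graph a) (samples_of col w))%:R.
  rewrite !cnt_slots /Z (bigID (fun t => symp a (rep (w t)) == 0)) /= -!sum1_card !natr_sum -sumrN.
  congr (_ + _); apply: eq_big => [t|t /andP[_]]; rewrite ?inE ?eqbF_neg ?negbK ?eqb_id //.
    by move=> /eqP s0; rewrite /X /sgn_symp s0 expr0.
  by rewrite /X /sgn_symp; case: (Z2P (symp a (rep (w t)))) => ->.
have dev0 : `|Z 0 - S0| <= eta * K%:R.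
  have := dev ord0; rewrite /deviation sumrB -/(Z 0%N) (eq_bigr _ (@mean_slots a 0)).
  by under [X in _ - X]eq_bigr do rewrite expr0 mulr1.
have dev1 : `|Z 1 - f * S0| <= eta * K%:R.
  have := dev (lift ord0 ord0); rewrite /deviation sumrB -/(Z 1%N) (eq_bigr _ (@mean_slots a 1)) K1.
  by rewrite -mulr_suml S1E expr1 mulrC.
have S0K : K%:R / 2 <= S0 by [].
move: dev0 dev1; rewrite !ler_norml => /andP[d01 d02] /andP[d11 d12].
have etaK : eta * K%:R <= K%:R / 8 by rewrite mulrC ler_pM2l // ; lra.
have Z0pos : 3 / 8 * K%:R <= Z 0 by lra.
have Z1pos : 0 < Z 1.
  have : 2^-1 * (K%:R / 2) <= f * S0 by rewrite ler_pM //; [lra|rewrite divr_ge0 // ltW].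
  by lra.
set c1 := cnt 1 false (full_graph a) (samples_of col w) in ZE *.
have natZ l : 0 <= Z l -> (cnt l false (full_graph a) (samples_of col w) - cnt l true (full_graph a) (samples_of col w))%:R = Z l.
  by move=> Zl; rewrite natrB -?ZE // -(ler_nat R) -subr_ge0 -ZE.
have T0 : 0 < T%:R :> R.
  rewrite ltr0n; case: (T) r0 => //; by rewrite /rounds div0n.
rewrite /fhat /eigenvalue_estimate size_samples_of.
set num := (_ - _)%N; set den := (_ - _)%N.
have numE : num%:R = Z 1 by apply: natZ; exact: ltW.
have Z00 : 0 < Z 0 by apply: lt_le_trans Z0pos; rewrite mulr_gt0 //; lra.
have denE : den%:R = Z 0 by apply: natZ; exact: ltW.
have den0 : (0 < den)%N by rewrite -(ltr0n R) denE.
set F := (_ %/ _)%N.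
have FE : (T * num)%:R = F%:R * Z 0 + ((T * num) %% den)%:R :> R.
  by rewrite -denE -natrM -natrD -divn_eq.
have rlt : ((T * num) %% den)%:R < Z 0 by rewrite -denE ltr_nat ltn_mod.
have rge : 0 <= ((T * num) %% den)%:R :> R by [].
rewrite natrM numE in FE.
have ratio : `|Z 1 / Z 0 - f| <= 8 * eta.
  have -> : Z 1 / Z 0 - f = (Z 1 - f * Z 0) / Z 0 by field; rewrite gt_eqF.
  rewrite normrM normfV (gtr0_norm Z00) ler_pdivrMr // ler_norml.
  (* [Z 1 - f * Z 0] is [(Z 1 - f * S0) - f * (Z 0 - S0)], at most [2 * eta * K] in modulus; and
     [Z 0 >= 3 / 8 * K] turns this into less than [8 * eta * Z 0]. *)
  have h1 : f * (Z 0 - S0) <= eta * K%:R by nra.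
  have h2 : - (eta * K%:R) <= f * (Z 0 - S0) by nra.
  have h3 : 2 * (eta * K%:R) <= 8 * eta * Z 0 by nra.
  by apply/andP; split; nra.
have Fdiff : `|F%:R / T%:R - Z 1 / Z 0| <= T%:R^-1.
  have -> : F%:R / T%:R - Z 1 / Z 0 = - (((T * num) %% den)%:R / Z 0 / T%:R).
    have -> : Z 1 = (F%:R * Z 0 + ((T * num) %% den)%:R) / T%:R by rewrite -FE mulrC mulKf // gt_eqF.
    by field; rewrite !gt_eqF.
  rewrite normrN ger0_norm; last by rewrite !divr_ge0 // ltW.
  rewrite -[leRHS]mul1r; apply: ler_wpM2r; first by rewrite invr_ge0 ltW.
  by rewrite ler_pdivrMr // mul1r ltW.
have -> : F%:R / T%:R - f = (F%:R / T%:R - Z 1 / Z 0) + (Z 1 / Z 0 - f) by ring.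
rewrite -ler_norml; apply: le_trans (ler_normD _ _) _; rewrite addrC; exact: lerD.
Qed.

End Deviation.

(** * Accuracy of the estimator *)

Section Normalization.
Variables (R : realType) (n : nat) (C : {set {set 'I_n}}).
Variable g : {set 'I_n} -> pauli n -> R.
Hypothesis g_gt0 : forall B y, 0 < g B y.
Implicit Types (B S : {set 'I_n}) (x y : pauli n).

Definition normalized B y : R :=
  if restr B y == y then g B y / \sum_(y' | restr B y' == y') g B y' else 0.

Lemma normalizer_gt0 B : 0 < \sum_(y | restr B y == y) g B y.
Proof.
apply: (@sumr_gt0 _ _ _ _ (0 : pauli n)) => // [|y _]; first by rewrite restr0.
exact: ltW.
Qed.

Lemma local_normalized B : local_distribution B (normalized B).
Proof.
split=> [y yB|y yB|].
- by rewrite /normalized yB eqxx divr_gt0 // normalizer_gt0.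
- by rewrite /normalized; case: eqP.
- rewrite -big_mkcond -mulr_suml divff // gt_eqF // normalizer_gt0 //.
Qed.

Lemma marginal_normalized B y : restr B y = y -> marginal (normalized B) B y = normalized B y.
Proof.
move=> yB; rewrite /marginal (bigD1 y) ?yB //= big1 ?addr0 // => x /andP[/eqP xy yx].
by rewrite /normalized xy eq_sym (negbTE yx).
Qed.

Let kappa S : R := (\sum_(y | restr (mb_closure C S) y == y) g (mb_closure C S) y) *
  marginal (normalized (mb_closure C S)) (blanket C S) 0.

Lemma normalized_ge0 B y : 0 <= normalized B y.
Proof.
rewrite /normalized; case: ifP => // _; rewrite divr_ge0 ?ltW //; exact: normalizer_gt0.
Qed.

Lemma kappa_gt0 S : 0 < kappa S.
Proof.
rewrite mulr_gt0 ?normalizer_gt0 //; apply: (@sumr_gt0 _ _ _ _ (0 : pauli n)) => [||y _]; first by rewrite restr0.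
  by rewrite /normalized restr0 eqxx divr_gt0 // normalizer_gt0.
exact: normalized_ge0.
Qed.

(** Conditioning a normalized table only divides it by a number that depends on [S] and not on [x];
    so the canonical estimator can be computed from the unnormalized table. *)
Lemma cond0_normalized S x :
  cond0 (normalized (mb_closure C S)) S (blanket C S) x = g (mb_closure C S) (restr S x) / kappa S.
Proof.
have sB : restr (mb_closure C S) (restr S x) = restr S x by rewrite restr_id_sub // subsetUl.
rewrite /cond0 -/(mb_closure C S) marginal_normalized // /normalized sB eqxx.
by rewrite /kappa invfM mulrA.
Qed.

Lemma canonical_weight_normalized : exists2 k, 0 < k & forall x,
  canonical_weight C normalized x = k * weight C (fun S x => g (mb_closure C S) (restr S x)) x.
Proof.
exists (\prod_(D in subfactors C) expR (- \sum_(S in powerset D) (-1) ^+ (#|D| - #|S|)%N * ln (kappa S))).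
  by apply: prodr_gt0 => D _; exact: expR_gt0.
move=> x; rewrite canonical_weightE /weight -big_split /=; apply: eq_bigr => D _.
rewrite -expRD -sumrN -big_split /=; congr expR; apply: eq_bigr => S _.
by rewrite cond0_normalized ln_div ?posrE ?kappa_gt0 // mulrBr addrC.
Qed.

Lemma canonical_normalized x : canonical C normalized x =
  weight C (fun S x => g (mb_closure C S) (restr S x)) x /
  \sum_y weight C (fun S x => g (mb_closure C S) (restr S x)) y.
Proof.
have [k k0 kE] := canonical_weight_normalized.
rewrite /canonical kE; under eq_bigr do rewrite kE.
by rewrite -mulr_sumr invfM mulrACA divff ?mul1r // gt_eqF.
Qed.

End Normalization.

(** [ln y <= y - 1], applied to [a / b] and to [b / a]. In the second case [a >= b / 2] is needed,
    which costs the factor 2. *)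
Lemma ln_ratio (R : realType) (a b tau : R) : 0 < b -> `|a - b| <= tau * b -> 0 <= tau <= 2^-1 ->
  `|ln a - ln b| <= 2 * tau.
Proof.
move=> b0 ab /andP[tau0 tau2].
have ab' := ab; move: ab'; rewrite ler_norml => /andP[h1 h2].
have tb : tau * b <= 2^-1 * b by rewrite ler_wpM2r // ltW.
have a0 : 0 < a by lra.
have lnle (y : R) : 0 < y -> ln y <= y - 1.
  by move=> y0; have := expR_ge1Dx (ln y); rewrite lnK ?posrE //; lra.
have e1 : ln a - ln b <= a / b - 1 by rewrite -ln_div ?posrE //; apply: lnle; rewrite divr_gt0.
have e2 : ln b - ln a <= b / a - 1 by rewrite -ln_div ?posrE //; apply: lnle; rewrite divr_gt0.
have f1 : a / b <= 1 + tau by rewrite ler_pdivrMr //; lra.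
have f2 : b / a <= 1 + 2 * tau.
  rewrite ler_pdivrMr //.
  have : tau * (2^-1 * b) <= tau * a by rewrite ler_wpM2l //; lra.
  by lra.
by rewrite ler_norml; apply/andP; split; lra.
Qed.

(** Replacing a negative value by 0 moves it towards [m >= 0]; the successor then costs 1. *)
Lemma truncated_close (R : realType) (d m : R) a1 a2 : d = a1%:R - a2%:R -> 0 <= m ->
  `|(a1 - a2).+1%:R - m| <= `|d - m| + 1.
Proof.
move=> dE m0; rewrite -natr1; have [a12|a21] := leqP a1 a2; last first.
  rewrite natrB 1?ltnW // -dE addrAC; apply: le_trans (ler_normD _ _) _.
  by rewrite normr1.
have -> : (a1 - a2 = 0)%N by apply/eqP; rewrite subn_eq0.
have d0 : d <= 0 by rewrite dE subr_le0 ler_nat.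
rewrite (ler0_norm (x := d - m)) ?subr_le0 ?(le_trans d0) //.
by rewrite add0r ler_norml; apply/andP; split; lra.
Qed.

(** * Accuracy of the marginals, and the lower bound on [rstar] *)

Section Accuracy.
Variables (R : realType) (n nu : nat) (col : 'I_n -> 'I_(nu * nu * nu).+1).
Variable C : {set {set 'I_n}}.
Hypothesis col_inj : forall D, D \in C -> {in mb_closure C D &, injective col}.
Variable L : op R n -> op R n.
Hypotheses (LD : forall A B : op R n, L (A + B) = L A + L B)
  (LZ : forall c (A : op R n), L (c *: A) = c *: L A).
Variables (rho : {set pauli n} -> op R n) (E : {set pauli n} -> {set pauli n} -> op R n).
Hypotheses (gtmL : gtm L rho E) (weak : half_weak L) (stable : half_stable L rho E).
Variable p : pauli n -> R.
Hypothesis p_gt0 : forall x, 0 < p x.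
Hypothesis pE : forall x, p x = pauli_error_rate L x.

Lemma marginal_pauli B y : restr B y = y ->
  marginal p B y = (4 ^+ #|B|)^-1 * \sum_(b | restr B b == b) sgn_symp R y b * pauli_eigenvalue L b.
Proof. by move=> yB; apply: marginal_fourier. Qed.

Lemma sum_supported (B : {set 'I_n}) (c : R) : \sum_(a : pauli n | restr B a == a) c = 4 ^+ #|B| * c.
Proof.
rewrite (eq_bigl (mem [set a : pauli n | restr B a == a])); last by move=> a; rewrite /= inE.
by rewrite sumr_const card_supported -[LHS]mulr_natl natrX.
Qed.

(** At the identity all signs are 1, so the marginal is the average of eigenvalues, each at least
    1/2. *)
Lemma marginal0_ge_half (B : {set 'I_n}) : 2^-1 <= marginal p B 0.
Proof.
rewrite marginal_pauli ?restr0 //.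
rewrite mulrC ler_pdivlMr ?exprn_gt0 // mulrC -sum_supported; apply: ler_sum => a _.
by rewrite sgn_sympC /sgn_symp symp0 expr0 mul1r; case/andP: (weak a).
Qed.

(** Each of the [4 ^ #|B|] eigenvalues contributes the error of [fhat_close]. The 1 from the
    successor is at most [4 ^ #|B|], which doubles the rounding term. *)
Lemma joint_close T (eta : R) (w : outcomes n T) (S D : {set 'I_n}) (y : pauli n) :
  0 < eta <= 8^-1 -> (0 < rounds nu T)%N ->
  concentrated col C L rho E eta w -> D \in C -> S \subset D ->
  restr (mb_closure C S) y = y ->
  `|(joint_estimate (samples_of col w) (mb_closure C S) y)%:R
    - T%:R * 4 ^+ #|mb_closure C S| * marginal p (mb_closure C S) y| <=
  T%:R * 4 ^+ #|mb_closure C S| * (8 * eta + 2 / T%:R).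
Proof.
move=> eta8 r0 conc DC SD; set B := mb_closure C S => yB.
set s := samples_of col w; set f := pauli_eigenvalue L.
have T0 : 0 < T%:R :> R by rewrite ltr0n; case: (T) r0 => //; rewrite /rounds div0n.
have close a : restr B a == a -> `|(fhat s a)%:R / T%:R - f a| <= 8 * eta + T%:R^-1.
  move=> /eqP aB; have BD := mb_closureS C SD.
  have aL : a \in local_labels C.
    by apply/bigcupP; exists D; rewrite // inE -aB restr_id_sub.
  exact: (fhat_close col_inj LD LZ gtmL weak stable eta8 r0 conc aL).
have B4 : 1 <= 4 ^+ #|B| :> R by rewrite exprn_ege1 // ler1n.
pose d : R := \sum_(a | restr B a == a) sgn_symp R y a * (fhat s a)%:R.
have dE : d = (\sum_(a : pauli n | (restr B a == a) && (symp a y == 0%R)) fhat s a)%N%:R -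
              (\sum_(a : pauli n | (restr B a == a) && (symp a y != 0%R)) fhat s a)%N%:R.
  rewrite /d (bigID (fun a => symp a y == 0)) /= !natr_sum -sumrN; congr (_ + _).
    by apply: eq_bigr => a /andP[_ /eqP ay]; rewrite sgn_sympC /sgn_symp ay expr0 mul1r.
  apply: eq_bigr => a /andP[_]; rewrite sgn_sympC /sgn_symp.
  by case: (Z2P (symp a y)) => -> // _; rewrite expr1 mulN1r.
have mE : T%:R * 4 ^+ #|B| * marginal p B y = \sum_(a | restr B a == a) sgn_symp R y a * (T%:R * f a).
  rewrite marginal_pauli // mulrA mulfK ?gt_eqF ?exprn_gt0 // mulr_sumr.
  by apply: eq_bigr => a _; rewrite mulrCA.
have dm : `|d - T%:R * 4 ^+ #|B| * marginal p B y| <= 4 ^+ #|B| * (T%:R * (8 * eta + T%:R^-1)).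
  rewrite mE -sumrB -sum_supported; apply: le_trans (ler_norm_sum _ _ _) _.
  apply: ler_sum => a aB; rewrite -mulrBr normrM normrX normrN1 expr1n mul1r.
  have -> : (fhat s a)%:R - T%:R * f a = T%:R * ((fhat s a)%:R / T%:R - f a).
    by rewrite mulrBr mulrCA divff ?mulr1 // gt_eqF.
  by rewrite normrM gtr0_norm // ler_pM2l //; exact: close.
have m0 : 0 <= T%:R * 4 ^+ #|B| * marginal p B y.
  rewrite !mulr_ge0 ?exprn_ge0 ?(ltW T0) //; apply: sumr_ge0 => x _; exact: ltW.
have jE : `|(joint_estimate s B y)%:R - T%:R * 4 ^+ #|B| * marginal p B y| <=
    `|d - T%:R * 4 ^+ #|B| * marginal p B y| + 1.
  exact: truncated_close.
apply: le_trans jE _; apply: le_trans (lerD dm (lexx 1)) _.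
have -> : 4 ^+ #|B| * (T%:R * (8 * eta + T%:R^-1)) = T%:R * 4 ^+ #|B| * (8 * eta) + 4 ^+ #|B| :> R.
  by move: (4 ^+ _) => c; field; rewrite gt_eqF.
have -> : T%:R * 4 ^+ #|B| * (8 * eta + 2 / T%:R) = T%:R * 4 ^+ #|B| * (8 * eta) + 2 * 4 ^+ #|B| :> R.
  by move: (4 ^+ _) => c; field; rewrite gt_eqF.
by rewrite -addrA lerD2l mulr_natl mulr2n lerD2l.
Qed.

Variable gap : R.
Hypotheses (gap_gt0 : 0 < gap) (gap_le : forall D, D \in C -> gap <= spectral_gap L (mb_closure C D)).

Lemma eigenvalue_le_gap D a : D \in C -> a != 0 -> restr (mb_closure C D) a == a ->
  pauli_eigenvalue L a <= 1 - gap.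
Proof.
move=> DC a0 aD; have := gap_le DC; rewrite /spectral_gap => h.
have : `|pauli_eigenvalue L a| <= \big[Num.max/0]_(a : pauli n | (a != 0) && (restr (mb_closure C D) a == a))
        `|pauli_eigenvalue L a| by apply: le_bigmax_cond; rewrite a0 aD.
by have := ler_norm (pauli_eigenvalue L a); lra.
Qed.

(** A label acting on a single qubit of [D] has an eigenvalue between 1/2 and [1 - gap]. *)
Lemma gap_le_half D : D \in C -> D != set0 -> gap <= 2^-1.
Proof.
move=> DC /set0Pn[j jD]; pose a : pauli n := [ffun i => if i == j then (1, 0) else 0].
have aj : a j = (1, 0) by rewrite ffunE eqxx.
have := eigenvalue_le_gap DC (a := a) _ _; case/andP: (weak a) => h _ h'.
suff : pauli_eigenvalue L a <= 1 - gap by lra.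
apply: h'; first by apply/eqP => /ffunP/(_ j); rewrite aj ffunE.
apply/restr_idP => i iD; rewrite ffunE; case: eqP => // ij.
by move: iD; rewrite ij inE jD.
Qed.

(** The marginal at the identity averages [4 ^ #|B|] eigenvalues, of which only the one of the label
    0 exceeds [1 - gap]; since [4 ^ #|B| >= 4], the average stays at least [gap / 2] below 1. *)
Lemma rstar_ge_half_gap D : D \in C -> D != set0 -> gap / 2 <= rstar C p.
Proof.
move=> DC D0.
have aux (c : R) : 4 <= c -> c * (1 - gap) + gap <= (1 - gap / 2) * c.
  by move=> c4; have := ler_wpM2l (ltW gap_gt0) c4; have := gap_gt0; nra.
set B := mb_closure C D.
have B1 : (0 < #|B|)%N.
  by rewrite card_gt0 -proper0; apply: proper_sub_trans (subsetUl _ _); rewrite proper0.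
apply: (@le_trans _ _ `|((0 : pauli n) == 0)%:R - marginal p B 0|); last first.
  rewrite /rstar; apply: le_trans (le_bigmax_cond _ _ DC).
  exact: (le_bigmax_cond 0 (fun y : pauli n => `|(y == 0)%:R - marginal p B y|)).
apply: le_trans (ler_norm _); rewrite eqxx marginal_pauli ?restr0 //.
set f := pauli_eigenvalue L.
have s1 : \sum_(b | restr B b == b) sgn_symp R 0 b * f b <= 4 ^+ #|B| * (1 - gap) + gap.
  under eq_bigr do rewrite sgn_sympC /sgn_symp symp0 expr0 mul1r.
  rewrite -sum_supported -lerBlDl -sumrB (bigD1 (0 : pauli n)) ?restr0 //=.
  have -> : f 0 = 1 by exact: pauli_eigenvalue0 gtmL.
  rewrite opprB addrCA subrr addr0 gerDl.
  apply: sumr_le0 => b /andP[bB b0].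
  by rewrite -opprB subr_le0 (eigenvalue_le_gap DC).
have B4 : 4 <= 4 ^+ #|B| :> R by rewrite -[leLHS]expr1 ler_eXn2l // ltr1n.
have B0 : 0 < 4 ^+ #|B| :> R by exact: exprn_gt0.
suff : (4 ^+ #|B|)^-1 * \sum_(b | restr B b == b) sgn_symp R 0 b * f b <= 1 - gap / 2 by rewrite mulr1n => h; rewrite lerBrDr -lerBrDl.
rewrite mulrC ler_pdivrMr //; apply: le_trans s1 _.
exact: aux.
Qed.

End Accuracy.

Section Estimator.
Variables (R : realType) (n nu : nat) (col : 'I_n -> 'I_(nu * nu * nu).+1).
Variable C : {set {set 'I_n}}.
Hypothesis closure_le : forall D, D \in C -> (#|mb_closure C D| <= nu)%N.

Definition marginal_estimate T (w : outcomes n T) : {set 'I_n} -> pauli n -> R :=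
  normalized (fun B y => (joint_estimate (samples_of col w) B y)%:R).

Lemma joint_estimate_gt0 T (w : outcomes n T) B y :
  0 < (joint_estimate (samples_of col w) B y)%:R :> R.
Proof. by rewrite ltr0n. Qed.

Lemma estimator_time k : (forall N T, (N <= n * 2 ^ nu + 1)%N ->
    (cFAC n (n * 2 ^ nu + 1) T nu + 20 <= k * n.+1 ^ k * (T.+1 * bitlen T ^ k))%N) ->
  forall T (w : outcomes n T), exists (out : seq (table n)) (t : nat),
    [/\ runs estimator (enc_input C (@design n nu col T) w) (enc_list (@enc_table n) out) t,
        (t <= k * n.+1 ^ k * (T.+1 * bitlen T ^ k))%N
      & describes_proportional out (canonical C (marginal_estimate w))].
Proof.
move=> kP T w.
have [t trun tle] : exists2 t, runs estimator (enc_input C (@design n nu col T) w)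
    (enc_list (@enc_table n) (output (samples_of col w) (factor_lists C) (factor_lists C))) t &
    (t <= cFAC n (n * 2 ^ nu + 1) T nu + 20)%N.
  rewrite enc_samples_of; apply: estimator_runs.
  - by rewrite size_samples_of.
  - exact: samples_of_len.
  - by rewrite size_map -cardE; exact: card_factors_le.
  - by apply/allP => _ /mapP[D _ ->]; exact: enum_uniq.
  - move=> c /mapP[D]; rewrite mem_enum => DC ->; rewrite -cardE.
    by apply: leq_trans (closure_le DC); apply/subset_leq_card/subsetUl.
  - move=> c S /mapP[D]; rewrite mem_enum => DC -> sub.
    have uS : uniq S by apply: subseq_uniq sub _; exact: enum_uniq.
    have uc : uniq (clos S (factor_lists C)) by exact: clos_uniq.
    have SD : [set j in S] \subset D.
      by apply/subsetP => j; rewrite inE => /(mem_subseq sub); rewrite mem_enum.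
    have <- : #|[set j in clos S (factor_lists C)]| = size (clos S (factor_lists C)).
      by rewrite cardsE; exact/card_uniqP.
    rewrite (@set_clos _ C [set j in S]) //.
    exact: leq_trans (subset_leq_card (mb_closureS C SD)) (closure_le DC).
exists (output (samples_of col w) (factor_lists C) (factor_lists C)), t; split=> //.
  exact: leq_trans tle (kP 0 T (leq0n _)).
exists (\sum_x weight C (fun S x => (joint_estimate (samples_of col w) (mb_closure C S) (restr S x))%:R) x).
  by apply: (@sumr_gt0 _ _ _ _ (0 : pauli n)) => // [|y _]; [|apply: ltW]; exact: weight_gt0.
move=> x; rewrite output_weight canonical_normalized; last by move=> B y; exact: joint_estimate_gt0.
rewrite mulrCA divff ?mulr1 // gt_eqF //.
by apply: (@sumr_gt0 _ _ _ _ (0 : pauli n)) => // [|y _]; [|apply: ltW]; exact: weight_gt0.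
Qed.

Hypothesis col_inj : forall D, D \in C -> {in mb_closure C D &, injective col}.
Variable L : op R n -> op R n.
Hypotheses (LD : forall A B : op R n, L (A + B) = L A + L B)
  (LZ : forall c (A : op R n), L (c *: A) = c *: L A).
Variables (rho : {set pauli n} -> op R n) (E : {set pauli n} -> {set pauli n} -> op R n).
Hypotheses (gtmL : gtm L rho E) (weak : half_weak L) (stable : half_stable L rho E).
Variable p : pauli n -> R.
Hypotheses (gibbsp : gibbs C p) (pE : forall x, p x = pauli_error_rate L x).

Let p_gt0 : forall x, 0 < p x. Proof. by case: (gibbs_pos gibbsp). Qed.
Let p_sum : \sum_x p x = 1. Proof. by case: (gibbs_pos gibbsp). Qed.

Lemma gibbs_canonical x : p x = weight C (fun S x => cond0 p S (blanket C S) x) x /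
  \sum_y weight C (fun S x => cond0 p S (blanket C S) x) y.
Proof.
have [k k0 kE] := hammersley_clifford gibbsp.
have := p_sum; under eq_bigr do rewrite kE.
rewrite -mulr_sumr => s1; rewrite kE; set W := \sum_y _ in s1 *.
have W0 : W != 0 by apply/eqP => h; move: s1; rewrite h mulr0 => /esym/eqP; rewrite oner_eq0.
by rewrite -(mulfK W0 k) s1 mul1r mulrC.
Qed.

Lemma cond0_marginal S x : cond0 p S (blanket C S) x * marginal p (blanket C S) 0 =
  marginal p (mb_closure C S) (restr S x).
Proof. by rewrite /cond0 divfK // gt_eqF // marginal_gt0 // restr0. Qed.

(** The integers [u S x] approximate [v S x] times a number depending on [S] only, with relative
    error [tau]. Hence the log-weights differ by a constant up to [z], and normalization leaves a
    factor [expR (2 * z)]. *)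
Lemma marginal_estimate_close T (eta : R) (w : outcomes n T) :
  0 < eta -> 32 * eta / Gmin C p <= 2^-1 -> (0 < rounds nu T)%N -> 4^-1 <= eta * T%:R ->
  concentrated col C L rho E eta w -> (#|C| * 2 ^ nu * 2 ^ nu)%:R * (2 * (32 * eta / Gmin C p)) <= 4^-1 ->
  forall c, c = 1 + 4 * ((#|C| * 2 ^ nu * 2 ^ nu)%:R * (2 * (32 * eta / Gmin C p))) ->
  let q := canonical C (marginal_estimate w) in
  [/\ forall x, 0 < q x, forall x, p x <= c * q x & forall x, q x <= c * p x].
Proof.
move=> eta0 tau2 r0 etaT conc; set tau := 32 * eta / Gmin C p; set z := _%:R * (2 * tau).
move=> z4 c cE q; have G0 := Gmin_gt0 C p_gt0; have G1 := Gmin_le1 C p.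
have T0 : 0 < T%:R :> R by rewrite ltr0n; case: (T) r0 => //; rewrite /rounds div0n.
have tau0 : 0 <= tau by rewrite divr_ge0 ?(ltW G0) // mulr_ge0 // ltW.
have etaG : 32 * eta = tau * Gmin C p by rewrite divfK // gt_eqF.
have eta8 : 0 < eta <= 8^-1.
  rewrite eta0 /=; have : tau * Gmin C p <= 2^-1 * 1 by apply: ler_pM; rewrite // ltW.
  by rewrite -etaG; lra.
(* The requirement on [eta * T] bounds the rounding term by [8 * eta]. The total of [16 * eta],
   divided by the lower bound [Gmin / 2] of the marginals, is [tau]. *)
have err : 8 * eta + 2 / T%:R <= 32 * eta * 2^-1.
  have : 2 / T%:R <= 8 * eta by rewrite ler_pdivrMr // -mulrA; move: (eta * _) etaT => ? ?; lra.
  by move: (2 / T%:R) => ?; lra.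
pose u S x : R := (joint_estimate (samples_of col w) (mb_closure C S) (restr S x))%:R.
pose v S x : R := cond0 p S (blanket C S) x.
have [k kP] : exists k, forall x, `|ln (weight C u x) - ln (weight C v x) - k| <= z.
  apply: (ln_weight_diff closure_le (kappa := fun S => ln (T%:R * 4 ^+ #|mb_closure C S| * marginal p (blanket C S) 0))).
    by rewrite mulr_ge0.
  move=> D S x; rewrite mem_subfactors => /andP[_ /exists_inP[D' D'C DD']] SD.
  have SD' := subset_trans SD DD'.
  have v0 : 0 < v S x by exact: cond0_gt0.
  have m0 : 2^-1 <= marginal p (blanket C S) 0 by exact: (marginal0_ge_half weak pE).
  have m0' : 0 < marginal p (blanket C S) 0 by exact: marginal_gt0 p_gt0 (restr0 _).
  have K0 : 0 < T%:R * 4 ^+ #|mb_closure C S| :> R by rewrite mulr_gt0 ?exprn_gt0.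
  rewrite -addrA -opprD -lnM ?posrE //; last by rewrite mulr_gt0.
  have sB : restr (mb_closure C S) (restr S x) = restr S x by rewrite restr_id_sub // subsetUl.
  have e : v S x * (T%:R * 4 ^+ #|mb_closure C S| * marginal p (blanket C S) 0) =
      T%:R * 4 ^+ #|mb_closure C S| * marginal p (mb_closure C S) (restr S x).
    by rewrite -cond0_marginal /v mulrCA -mulrA.
  have Gv : Gmin C p * 2^-1 <= marginal p (mb_closure C S) (restr S x).
    rewrite -cond0_marginal; apply: ler_pM; rewrite ?(ltW G0) ?invr_ge0 //.
    (* The Moebius sums also range over the empty set, which [Gmin] does not cover; its conditional
       probability is 1. *)
    have [S0|S0] := eqVneq S set0; last first.
      apply: Gmin_le; rewrite mem_subfactors S0; apply/exists_inP; exists D' => //.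
    rewrite /cond0 S0 restr_set0 set0U divff // gt_eqF //.
    by apply: marginal_gt0; rewrite ?restr0.
  apply: ln_ratio; rewrite ?tau0 ?tau2 //.
    by rewrite e mulr_gt0 // (lt_le_trans _ Gv) // divr_gt0.
  rewrite e; apply: le_trans (joint_close col_inj LD LZ gtmL weak stable p_gt0 pE eta8 r0 conc D'C SD' sB) _.
  rewrite mulrCA ler_pM2l //; apply: le_trans (ler_wpM2l tau0 Gv).
  by rewrite mulrA -etaG.
have z0 : 0 <= z by exact: mulr_ge0 (ler0n _ _) (mulr_ge0 (ler0n _ 2) tau0).
have c1 : 1 <= c by rewrite cE lerDl mulr_ge0.
(* [expR (2 z) <= 1 + 2 z + 8 z^2], and [8 z^2 <= 2 z] because [z <= 1/4]. *)
have ez : expR (2 * z) <= c.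
  have h : 2 * z <= 2^-1 by move: z4; lra.
  apply: le_trans (expR_quadratic h) _; rewrite cE.
  have : z * z <= z * 4^-1 by exact: ler_wpM2l.
  by rewrite exprMn expr2 [z ^+ 2]expr2; move: (z * z) => ?; lra.
have uv x : weight C u x <= expR (k + z) * weight C v x.
  rewrite -[leLHS](lnK (weight_gt0 C u x)) -[X in _ * X](lnK (weight_gt0 C v x)) -expRD ler_expR.
  by have := kP x; rewrite ler_norml; lra.
have vu x : weight C v x <= expR (z - k) * weight C u x.
  rewrite -[leLHS](lnK (weight_gt0 C v x)) -[X in _ * X](lnK (weight_gt0 C u x)) -expRD ler_expR.
  by have := kP x; rewrite ler_norml; lra.
have qE x : q x = weight C u x / \sum_y weight C u y.
  by apply: canonical_normalized => B y; exact: joint_estimate_gt0.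
have W0 : 0 < \sum_y weight C u y.
  by apply: (@sumr_gt0 _ _ _ _ (0 : pauli n)) => // [|y _]; [|apply: ltW]; exact: weight_gt0.
have q0 x : 0 < q x by rewrite qE divr_gt0 // weight_gt0.
have e1 : expR (k + z) * expR (z - k) = expR (2 * z) by rewrite -expRD; congr expR; ring.
split=> // x.
  apply: (@le_trans _ _ (expR (2 * z) * q x)); last by rewrite ler_wpM2r // ltW.
  rewrite gibbs_canonical qE -e1 [expR _ * expR _]mulrC.
  by apply: normalized_le => //; try (by move=> ?; exact: weight_gt0); exact: expR_ge0.
apply: (@le_trans _ _ (expR (2 * z) * p x)); last by rewrite ler_wpM2r // ltW.
rewrite gibbs_canonical qE -e1.
by apply: normalized_le => //; try (by move=> ?; exact: weight_gt0); exact: expR_ge0.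
Qed.

End Estimator.

(** Terms without the logarithm, or without [W], are absorbed by means of [l / l0 >= 1] and
    [W >= 1]. *)
Lemma threshold_le (R : realType) (M c l l0 l4 W : R) :
  0 <= M -> 0 <= c -> 0 <= l4 -> 0 < l0 <= l -> 1 <= W ->
  2 * M * (1 + 32 * (c * W) * (l4 + l)) + c * W + 1 <=
  ((2 * M + 64 * M * c * l4 + c + 1) / l0 + 64 * M * c) * (W * l).
Proof.
move=> M0 c0 l40 /andP[l00 l0l] W1; set r := l / l0.
have r1 : 1 <= r by rewrite ler_pdivlMr // mul1r.
have W0 : 0 <= W by apply: le_trans W1.
have Wr : W <= W * r by rewrite ler_peMr.
have Wr1 : 1 <= W * r by apply: le_trans Wr.
have -> : ((2 * M + 64 * M * c * l4 + c + 1) / l0 + 64 * M * c) * (W * l) =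
    2 * M * (W * r) + 64 * M * c * l4 * (W * r) + c * (W * r) + W * r + 64 * M * c * (W * l).
  by rewrite /r; field; rewrite gt_eqF.
have -> : 2 * M * (1 + 32 * (c * W) * (l4 + l)) + c * W + 1 =
    2 * M * 1 + 64 * M * c * l4 * W + c * W + 1 + 64 * M * c * (W * l) by ring.
by rewrite lerD2r; apply: lerD => //; apply: lerD; [apply: lerD|]; apply: ler_wpM2l => //; rewrite ?mulr_ge0.
Qed.

Lemma scale_le (R : realType) (K W X l : R) : 0 <= K -> 0 <= l -> W <= 4 * X ->
  K * (W * l) <= 4 * K * (X * l).
Proof.
move=> K0 l0 WX; have -> : 4 * K * (X * l) = K * (4 * X * l) by ring.
by rewrite ler_wpM2l // ler_wpM2r.
Qed.

(** * Choice of the constants *)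

Section Assembly.
Variables (R : realType) (n nu : nat) (col : 'I_n -> 'I_(nu * nu * nu).+1).
Variable C : {set {set 'I_n}}.
Hypothesis closure_le : forall D, D \in C -> (#|mb_closure C D| <= nu)%N.
Hypothesis col_inj : forall D, D \in C -> {in mb_closure C D &, injective col}.
Variable L : op R n -> op R n.
Hypotheses (LD : forall A B : op R n, L (A + B) = L A + L B)
  (LZ : forall c (A : op R n), L (c *: A) = c *: L A).
Variables (rho : {set pauli n} -> op R n) (E : {set pauli n} -> {set pauli n} -> op R n).
Hypotheses (gtmL : gtm L rho E) (weak : half_weak L) (stable : half_stable L rho E).
Variable p : pauli n -> R.
Hypotheses (gibbsp : gibbs C p) (pE : forall x, p x = pauli_error_rate L x).
Variables (gap dmax : R).
Hypotheses (gap_gt0 : 0 < gap) (gap_le : forall D, D \in C -> gap <= spectral_gap L (mb_closure C D)).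
Hypotheses (dmax_gt0 : 0 < dmax) (dmax_lt1 : dmax < 1).

(** Here [c] is [1 / eta^2] stripped of [N], [eps] and [Gmin]; [4 * 4 ^ nu] comes from the union
    bound, and [ln dmax^-1] is a lower bound for [ln (N / delta)]. The leading 4 pays for replacing
    [Gmin] by half of [Gparam], squared. *)
Definition sample_constant : R :=
  let M := (period nu)%:R in let c := (512 * (4 ^ nu)%:R / gap) ^+ 2 in
  4 * ((2 * M + 64 * M * c * ln (4 * (4 ^ nu)%:R) + c + 1) / ln dmax^-1 + 64 * M * c).

Let ldmax_gt0 : 0 < ln dmax^-1.
Proof. by rewrite ln_gt0 // invf_gt1. Qed.

Lemma sample_constant_gt0 : 0 < sample_constant.
Proof.
have F1 : 0 <= ln (4 * (4 ^ nu)%:R) :> R by rewrite ln_ge0 // -natrM ler1n muln_gt0 expn_gt0.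
have c0 := sqr_ge0 (512 * (4 ^ nu)%:R / gap).
rewrite /sample_constant; move: (_ ^+ 2) c0 (ln _) F1 => c c0 l4 l40.
have M0 : 0 <= (period nu)%:R :> R by [].
rewrite mulr_gt0 // ltr_wpDr ?mulr_ge0 // divr_gt0 // ltr_wpDl // !addr_ge0 // !mulr_ge0 //.
Qed.

Lemma prob_mono T (a b : pred (outcomes n T)) : (forall w, a w -> b w) ->
  prob L rho E (@design n nu col T) a <= prob L rho E (@design n nu col T) b.
Proof.
move=> ab; rewrite /prob big_mkcond [leRHS]big_mkcond; apply: ler_sum => w _.
have P0 : 0 <= \prod_(t < T) sample_prob L rho E (stab_span (gens (design col t))) (len (design col t)) (w t).
  by apply: prodr_ge0 => t _; by apply: (sample_prob_ge0 gtmL); exact: basis_stabilizer.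
by case: ifP => [/ab -> //|_]; case: ifP.
Qed.

Lemma ln_factors_ge0 delta : 0 < delta <= dmax -> (0 < #|C|)%N -> ln dmax^-1 <= ln (#|C|%:R / delta).
Proof.
move=> /andP[d0 dd] C0; have C1 : 1 <= #|C|%:R :> R by rewrite ler1n.
rewrite ler_ln ?posrE ?invr_gt0 ?divr_gt0 ?ltr0n //.
rewrite -[leLHS]mul1r; apply: ler_pM; rewrite ?invr_ge0 ?(ltW dmax_gt0) //.
by rewrite lef_pV2 ?posrE.
Qed.

Lemma accuracy_trivial eps delta : subfactors C = set0 -> 0 < eps < 1 -> 0 < delta <= dmax ->
  forall T, 1 - delta <= prob L rho E (@design n nu col T) (fun w =>
    let q := canonical C (marginal_estimate R col w) in let N : R := #|C|%:R in
    (l1dist p q <= eps * rstar C p) &&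
    (0%:R <= sample_constant * (N ^+ 2 / (Gparam C p q ^+ 2 * eps ^+ 2) * ln (N / delta)))).
Proof.
move=> sub0 /andP[e0 e1] dd T; have w1 c x : weight C c x = 1 :> R by rewrite /weight sub0 big_set0.
apply: (@le_trans _ _ (prob L rho E (@design n nu col T) xpredT)).
  rewrite /prob (total_prob (mu := fun t => sample_prob L rho E (stab_span (gens (design col t))) (len (design col t)))).
    by case/andP: dd => d0 _; rewrite gerBl ltW.
  by move=> t; apply: (sample_prob_sum1 LD LZ gtmL); exact: basis_stabilizer.
apply: prob_mono => w _ /=; apply/andP; split.
  rewrite /l1dist big1 => [|x _].
    by apply: mulr_ge0; [exact: ltW|exact: bigmax_ge_id].
  rewrite (gibbs_canonical gibbsp) canonical_normalized; last by move=> B y; exact: joint_estimate_gt0.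
  by rewrite !w1; under eq_bigr do rewrite w1; under [X in _ - _ / X]eq_bigr do rewrite w1; rewrite subrr normr0.
apply: mulr_ge0; first by rewrite ltW // sample_constant_gt0.
have [C0|C0] := posnP #|C|; first by rewrite C0 expr0n /= !mul0r.
apply: mulr_ge0; last exact: le_trans (ltW ldmax_gt0) (ln_factors_ge0 dd C0).
by apply: divr_ge0; [exact: sqr_ge0|apply: mulr_ge0; exact: sqr_ge0].
Qed.

Lemma accuracy_nontrivial eps delta D : D \in C -> D != set0 -> 0 < eps < 1 -> 0 < delta <= dmax ->
  exists T0 : nat, forall T, (T0 <= T)%N -> 1 - delta <= prob L rho E (@design n nu col T) (fun w =>
    let q := canonical C (marginal_estimate R col w) in let N : R := #|C|%:R in
    (l1dist p q <= eps * rstar C p) &&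
    (T0%:R <= sample_constant * (N ^+ 2 / (Gparam C p q ^+ 2 * eps ^+ 2) * ln (N / delta)))).
Proof.
move=> DC D0 /andP[e0 e1] dd; have /andP[d0 _] := dd.
have [p_gt0 p_sum] := gibbs_pos gibbsp.
have gap2 := gap_le_half weak gap_le DC D0.
have rst := rstar_ge_half_gap gtmL pE gap_gt0 gap_le DC D0.
have C0 : (0 < #|C|)%N by apply/card_gt0P; exists D.
have ll := ln_factors_ge0 dd C0.
have N1 : 1 <= #|C|%:R :> R by rewrite ler1n.
have F1 : 1 <= (4 ^ nu)%:R :> R by rewrite ler1n expn_gt0.
have M0 : 0 < (period nu)%:R :> R by rewrite ltr0n period_gt0.
have G0 := Gmin_gt0 C p_gt0; have G1 := Gmin_le1 C p.
have AE : (#|C| * 2 ^ nu * 2 ^ nu)%:R = #|C|%:R * (4 ^ nu)%:R :> R by rewrite -mulnA -expnMn natrM.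
have AE' : (4 * (#|C| * 4 ^ nu))%:R = 4 * (#|C|%:R * (4 ^ nu)%:R) :> R by rewrite !natrM.
move: AE AE' N1 F1 M0 G0 G1 ll.
rewrite /sample_constant; set N : R := #|C|%:R; set F : R := (4 ^ nu)%:R; set M : R := (period nu)%:R.
set G := Gmin C p; set l := ln (N / delta) => AE AE' N1 F1 M0 G0 G1 ll.
have N0 : 0 < N by apply: lt_le_trans N1.
have F0 : 0 < F by apply: lt_le_trans F1.
have A1 : 1 <= N * F by rewrite -[leLHS]mul1r ler_pM.
have A0 : 0 < N * F by rewrite mulr_gt0.
have eg0 : 0 < eps * gap by rewrite mulr_gt0.
have eg1 : eps * gap <= 2^-1 by rewrite -[leRHS]mul1r ler_pM // ltW.
(* Chosen so that the bound [z] on the log-weights is [eps * gap / 8]: the resulting factor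
   [1 + 4 z] is [1 + eps * gap / 2], within [eps * rstar] of 1. *)
pose eta := eps * gap * G / (512 * (N * F)).
have eta0 : 0 < eta by rewrite divr_gt0 ?mulr_gt0.
have eta1 : eta <= 1.
  rewrite ler_pdivrMr ?mulr_gt0 // mul1r; apply: (@le_trans _ _ (2^-1 * 1)); last by lra.
  by rewrite ler_pM // ltW.
set c := (512 * F / gap) ^+ 2; set l4 := ln (4 * F).
pose W := N ^+ 2 / (eps * G) ^+ 2.
have cW : (eta ^+ 2)^-1 = c * W.
  by rewrite /c /W /eta; field; rewrite !gt_eqF //.
have l40 : 0 <= l4 by rewrite ln_ge0 //; lra.
have lnE : ln (4 * (N * F) / delta) = l4 + l.
  have -> : 4 * (N * F) / delta = 4 * F * (N / delta) by ring.
  by rewrite lnM ?posrE ?mulr_gt0 ?invr_gt0.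
have l0 : 0 < l by apply: lt_le_trans ll.
have W1 : 1 <= W.
  rewrite ler_pdivlMr ?exprn_gt0 ?mulr_gt0 // mul1r; apply: (@le_trans _ _ 1); last by rewrite exprn_ege1.
  rewrite exprn_ile1 ?mulr_ge0 ?ltW //.
  by rewrite -[ltRHS]mul1r; apply: (@lt_le_trans _ _ (1 * G)); rewrite ?ltr_pM2r // ler_pM2l.
have c0 : 0 <= c by exact: sqr_ge0.
(* The first summand forces more than [32 * c * W * (l4 + l)] rounds of [2 * M] runs each, which
   bring the failure probability down to [delta]. The second gives [eta * T >= 1 / eta >= 1], enough
   for the rounding errors. *)
pose V := 2 * M * (1 + 32 * (c * W) * (l4 + l)) + c * W.
have cW0 : 0 <= c * W by rewrite -cW invr_ge0 sqr_ge0.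
have X0 : 0 <= 32 * (c * W) * (l4 + l).
  by apply: mulr_ge0; [exact: mulr_ge0|apply: addr_ge0 => //; exact: ltW].
have M20 : 0 < 2 * M by exact: mulr_gt0.
have V0 : 0 <= V.
  apply: addr_ge0 => //; apply: mulr_ge0; first exact: ltW.
  exact: addr_ge0.
pose T0 := (Num.truncn V).+1; exists T0 => T T0T.
have VT : V < T%:R by apply: lt_le_trans (truncnS_gt V) _; rewrite ler_nat.
have T0V : T0%:R <= V + 1 by rewrite -natr1 lerD2r truncn_le.
have rX : 32 * (c * W) * (l4 + l) < (rounds nu T)%:R.
  have h1 : T%:R < ((rounds nu T)%:R + 1) * (2 * M) :> R.
    by rewrite natr1 -!natrM ltr_nat; apply: ltn_ceil; rewrite muln_gt0 period_gt0.
  have h2 : 2 * M * (1 + 32 * (c * W) * (l4 + l)) < ((rounds nu T)%:R + 1) * (2 * M).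
    by apply: le_lt_trans (lt_trans VT h1); rewrite lerDl.
  by move: h2; rewrite mulrC ltr_pM2r // [ltRHS]addrC ltrD2l.
have r0 : (0 < rounds nu T)%N by rewrite -(ltr_nat R); apply: le_lt_trans rX.
have T00 : 0 < T%:R :> R by apply: le_lt_trans VT.
have etaT : 4^-1 <= eta * T%:R.
  apply: (@le_trans _ _ (eta * (c * W))).
    rewrite -cW expr2 invfM mulrA divff ?gt_eqF // mul1r; apply: (@le_trans _ _ 1); first by lra.
    by rewrite invf_ge1.
  rewrite ler_pM2l //; apply: le_trans (ltW VT).
  by rewrite lerDr; apply: mulr_ge0; [exact: ltW|exact: addr_ge0].
have tauE : 32 * eta / G = eps * gap / (16 * (N * F)).
  by rewrite /eta; field; rewrite !gt_eqF.
have zE : (#|C| * 2 ^ nu * 2 ^ nu)%:R * (2 * (32 * eta / G)) = eps * gap / 8.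
  by rewrite AE tauE; field; rewrite !gt_eqF.
have eta01 : 0 < eta <= 1 by rewrite eta0.
apply: (@le_trans _ _ (prob L rho E (@design n nu col T) (concentrated col C L rho E eta))).
  apply: le_trans (prob_concentrated col_inj closure_le LD LZ gtmL T eta01).
  rewrite lerD2l lerN2 AE'.
  apply: (@le_trans _ _ (4 * (N * F) * expR (- ln (4 * (N * F) / delta)))).
    rewrite ler_pM2l ?mulr_gt0 // ler_expR lerN2 lnE.
    have -> : l4 + l = eta ^+ 2 / 32 * (32 * (c * W) * (l4 + l)).
      by rewrite -cW; field; rewrite gt_eqF.
    by rewrite ler_wpM2l ?divr_ge0 ?sqr_ge0 // ltW.
  rewrite expRN lnK ?posrE ?divr_gt0 ?mulr_gt0 // invf_div mulrC divfK // gt_eqF // mulr_gt0 //.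
apply: prob_mono => w conc; set q := canonical _ _.
have tau2 : 32 * eta / G <= 2^-1.
  rewrite tauE ler_pdivrMr ?mulr_gt0 //; apply: le_trans eg1 _; move: (N * F) A1 => ? ?; lra.
have z4 : (#|C| * 2 ^ nu * 2 ^ nu)%:R * (2 * (32 * eta / G)) <= 4^-1.
  by rewrite zE; move: (eps * gap) eg1 => ? ?; lra.
have cE : 1 + eps * gap / 2 = 1 + 4 * ((#|C| * 2 ^ nu * 2 ^ nu)%:R * (2 * (32 * eta / G))).
  by rewrite zE; field.
have [q0 pq qp] := marginal_estimate_close closure_le col_inj LD LZ gtmL weak stable gibbsp pE
  eta0 tau2 r0 etaT conc z4 cE.
rewrite -/q in q0 pq qp.
have c1 : 1 <= 1 + eps * gap / 2 by rewrite lerDl divr_ge0 // ltW.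
have q_sum : forall x, 0 <= q x by move=> x; exact: ltW.
apply/andP; split.
  apply: le_trans (l1dist_le c1 (fun x => ltW (p_gt0 x)) q_sum p_sum pq qp) _.
  by rewrite addrAC subrr add0r -mulrA ler_pM2l.
have Gp0 := Gparam_gt0 C p_gt0 q0.
(* Here the threshold, chosen from [p] alone, becomes a bound in terms of the random [q]. *)
have Gp : Gparam C p q <= 2 * G.
  apply: le_trans (Gparam_le C c1 p_gt0 q0 pq qp) _; rewrite ler_pM2r //.
  by move: (eps * gap) eg1 => ? ?; lra.
apply: le_trans T0V _.
have l0l : 0 < ln dmax^-1 <= l by rewrite ldmax_gt0.
apply: le_trans (threshold_le (ltW M0) c0 l40 l0l W1) _.
set K := (X in X * (W * l)); have K0 : 0 <= K.
  have MF : 0 <= 64 * M * c by apply: mulr_ge0 => //; apply: mulr_ge0 => //; exact: ltW.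
  apply: addr_ge0 => //; apply: divr_ge0; last exact: ltW.
  apply: addr_ge0 => //; apply: addr_ge0 => //; apply: addr_ge0; first exact: ltW.
  exact: mulr_ge0.
apply: scale_le => //; first exact: ltW.
rewrite /W mulrCA; apply: ler_wpM2l; first exact: sqr_ge0.
have P1 : 0 < Gparam C p q ^+ 2 * eps ^+ 2 by apply: mulr_gt0; exact: exprn_gt0.
have P2 : 0 < 4 * (eps * G) ^+ 2 by apply: mulr_gt0 => //; apply: exprn_gt0; exact: mulr_gt0.
rewrite -ler_pdivrMl // -invfM lef_pV2 ?posrE //.
have -> : 4 * (eps * G) ^+ 2 = (2 * G) ^+ 2 * eps ^+ 2 by ring.
apply: ler_wpM2r; first exact: sqr_ge0.
by rewrite lerXn2r // ?nnegrE ltW // mulr_gt0.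
Qed.

End Assembly.

Theorem proposition18 (R : realType) (nu : nat) (gap dmax : R)
    (gap_gt0 : 0 < gap) (dmax_gt0 : 0 < dmax) (dmax_lt1 : dmax < 1) :
  exists (K eps0 : R) (prog : program) (k : nat),
    [/\ 0 < K, 0 < eps0 &
    forall (n : nat) (C : {set {set 'I_n}}),
      (forall D, D \in C -> (#|mb_closure C D| <= nu)%N) ->
      exists (s : forall T, 'I_T -> setting n)
             (phat : forall T, outcomes n T -> {set 'I_n} -> pauli n -> R),
        [/\ (* the experiments are admissible and the estimates are
               distributions *)
            forall T (t : 'I_T), stabilizer_group (stab_span (gens (s T t))),
            forall T (w : outcomes n T) D,
              possible_outcomes (s T) w -> D \in subfactors C ->
              local_distribution (mb_closure C D) (phat T w (mb_closure C D)),
            (* accuracy *)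
            forall (p : pauli n -> R) (L : {linear op R n -> op R n})
                   (rho : {set pauli n} -> op R n)
                   (E : {set pauli n} -> {set pauli n} -> op R n),
              gibbs C p ->
              (forall x, p x = pauli_error_rate L x) ->
              gtm L rho E -> half_weak L -> half_stable L rho E ->
              (forall D, D \in C -> gap <= spectral_gap L (mb_closure C D)) ->
              forall eps delta : R,
                0 < eps < eps0 -> 0 < delta <= dmax ->
                exists T0 : nat, forall T : nat, (T0 <= T)%N ->
                  1 - delta <=
                  prob L rho E (s T)
                    (fun w =>
                       let q := canonical C (phat T w) in
                       let N : R := #|C|%:R in
                       (l1dist p q <= eps * rstar C p) &&
                       (T0%:R <= K * (N ^+ 2 / (Gparam C p q ^+ 2 * eps ^+ 2)
                                      * ln (N / delta))))
          & (* running time *)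
            forall T (w : outcomes n T), possible_outcomes (s T) w ->
              exists (out : seq (table n)) (t : nat),
                [/\ runs prog (enc_input C (s T) w) (enc_list (@enc_table n) out) t,
                    (t <= k * n.+1 ^ k * (T.+1 * bitlen T ^ k))%N
                  & describes_proportional out (canonical C (phat T w))]]].
Proof.
have [k kP] := cFAC_time nu.
exists (sample_constant nu gap dmax), 1, estimator, k; split=> //; first exact: sample_constant_gt0.
move=> n C closure_le; have [col col_inj] := closure_colouring closure_le.
exists (fun T => @design n nu col T), (fun T => @marginal_estimate R n nu col T); split.
- move=> T t; exact: basis_stabilizer.
- by move=> T w D _ _; apply: local_normalized => B y; exact: joint_estimate_gt0.
- move=> p L rho E gibbsp pE gtmL weak stable gap_le eps delta eps1 dd.
  have LD (A B : op R n) : L (A + B) = L A + L B by exact: linearD.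
  have LZ c (A : op R n) : L (c *: A) = c *: L A by exact: linearZZ.
  have [sub0|/set0Pn[S]] := eqVneq (subfactors C) set0.
    by exists 0%N => T _; exact: accuracy_trivial.
  rewrite mem_subfactors => /andP[S0 /exists_inP[D DC SD]].
  have D0 : D != set0 by apply: contraNneq S0 => D0; rewrite -subset0 -D0.
  exact: (accuracy_nontrivial closure_le col_inj LD LZ gtmL weak stable gibbsp pE gap_gt0 gap_le dmax_gt0 dmax_lt1 DC D0 eps1 dd).
- by move=> T w _; apply: (estimator_time R col closure_le) => N T'; exact: kP.
Qed.
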